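(* Let $T$ be an operator satisfying the following condition (D): there are constants $\delta\in(0,1)$ and $c>0$ such that for all $f$, $M_\delta^\#(Tf)(x)\le c\,Mf(x)$. Let $0<p<\infty$ and let $w\in C_{\max\{1,p\}+\epsilon}$ for some $\epsilon>0$. Then there is a constant $c$, independent of $f$, such that $$\|Tf\|_{L^p(w)}\le c\,\|Mf\|_{L^p(w)}.$$ Additionally, if $1<q<\infty$ and $T$ satisfies the following condition $(D_q)$: for every $0<\delta<1$ there exists a finite constant $c=c_{\delta,q,T}>0$ such that $M_\delta^\#\left(\overline{T}_q\bm{f}\right)(x)\le c\,M(|\bm{f}|_q)(x)$ for all $\bm{f}=\{f_j\}_{j=1}^\infty$; then there is a constant $c$, independent of $\bm{f}$, such that $$\|\overline{T}_q\bm{f}\|_{L^p(w)}\le c\,\|M(|\bm{f}|_q)\|_{L^p(w)}.$$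
   Context: Cubes in $\mathbb{R}^n$ have sides parallel to the axes. $M$ is the Hardy–Littlewood maximal operator, $M^\#f(x)=\sup_{Q\ni x}\inf_{c}\frac1{|Q|}\int_Q|f-c|$ is the sharp maximal function, and $M_\delta^\#f=\left(M^\#(|f|^\delta)\right)^{1/\delta}$. $|\bm{f}|_q=\left(\sum_j|f_j|^q\right)^{1/q}$, $\overline{T}_q\bm{f}=\left(\sum_j|Tf_j|^q\right)^{1/q}$. For $p>0$, a weight $w$ (non-negative locally integrable function) belongs to $C_p$ if there exist $c,\delta>0$ such that for every cube $Q$ and every measurable $E\subseteq Q$, $$w(E)\le c\left(\frac{|E|}{|Q|}\right)^\delta\int_{\mathbb{R}^n}M(\chi_Q)^pw,\qquad w(E)=\int_Ew.$$
   Formalization: It is assumed in addition that |{|Tf|>t}| is finite for every t>0 and every f in the domain of T (a class of measurable functions containing 0); without this the claim fails, e.g. for Tf equal to the constant ∫_{[0,1]^n} f, with w=1 and p>1. *)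

(* Defs.v *)
From HB Require Import structures.
From mathcomp Require Import all_boot all_order all_algebra.
From mathcomp Require Import all_classical all_reals all_analysis.

Set Implicit Arguments.
Unset Strict Implicit.
Unset Printing Implicit Defensive.
Import Order.TTheory GRing.Theory Num.Theory.
Import numFieldNormedType.Exports.

Local Open Scope classical_set_scope.
Local Open Scope ring_scope.
Local Open Scope ereal_scope.

(* The sigma-algebra on tuples is the product one, so the measurable subsets of
   [euclid R n] are the Borel subsets of R^n. *)
Notation euclid R n := (n.-tuple (measurableTypeR R)).

Section lebesgue_step.
Context {R : realType} {n : nat}.
Variable m : {sigma_finite_measure set (euclid R n) -> \bar R}.

Definition tcons (p : measurableTypeR R * euclid R n) : euclid R n.+1 :=
  [the n.+1.-tuple _ of p.1 :: p.2].

Lemma measurable_tcons : measurable_fun [set: _] tcons.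
Proof. by apply: measurable_cons => //; exact: measurable_snd. Qed.

Definition lebesgue_step : set (euclid R n.+1) -> \bar R :=
  pushforward (@lebesgue_measure R \x m) tcons.

Let lebesgue_step0 : lebesgue_step set0 = 0.
Proof. by rewrite /lebesgue_step /pushforward preimage_set0 measure0. Qed.

Let lebesgue_step_ge0 A : 0 <= lebesgue_step A.
Proof. by rewrite /lebesgue_step /pushforward measure_ge0. Qed.

Let lebesgue_step_sigma_additive : semi_sigma_additive lebesgue_step.
Proof.
move=> F mF tF mUF; rewrite /lebesgue_step /pushforward preimage_bigcup.
have mpre A : measurable A -> measurable (tcons @^-1` A).
  by move=> mA; rewrite -[X in measurable X]setTI; exact: measurable_tcons.
apply: measure_semi_sigma_additive.
- by move=> k; exact: mpre.
- apply/trivIsetP => /= i j _ _ ij; rewrite -preimage_setI.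
  by move/trivIsetP : tF => /(_ _ _ _ _ ij) ->//; rewrite preimage_set0.
- by rewrite -preimage_bigcup; exact: mpre.
Qed.

HB.instance Definition _ := isMeasure.Build _ _ _ lebesgue_step
  lebesgue_step0 lebesgue_step_ge0 lebesgue_step_sigma_additive.

Let lebesgue_step_sigma_finite : sigma_finite [set: euclid R n.+1] lebesgue_step.
Proof.
have /sigma_finiteP[F [FT ndF Ffin]] := sigma_finiteT (@lebesgue_measure R).
have /sigma_finiteP[G [GT ndG Gfin]] := sigma_finiteT m.
pose h (t : euclid R n.+1) : measurableTypeR R := thead t.
pose b (t : euclid R n.+1) : euclid R n := [tuple of behead t].
have mh : measurable_fun [set: _] h by exact: measurable_tnth.
have mb : measurable_fun [set: _] b by exact: measurable_behead.
exists (fun i => h @^-1` F i `&` b @^-1` G i).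
  apply/seteqP; split => // t _.
  have [i _ Fi] : (\bigcup_i F i) (h t) by rewrite -FT.
  have [j _ Gj] : (\bigcup_i G i) (b t) by rewrite -GT.
  exists (maxn i j) => //; split.
  - by have /subsetPset := ndF _ _ (leq_maxl i j); exact.
  - by have /subsetPset := ndG _ _ (leq_maxr i j); exact.
move=> i; have [mF Foo] := Ffin i; have [mG Goo] := Gfin i; split.
  apply: measurableI; rewrite -[X in measurable X]setTI; [exact: mh|exact: mb].
rewrite /lebesgue_step /pushforward.
rewrite (_ : _ @^-1` _ = F i `*` G i).
  by rewrite product_measure1E// lte_mul_pinfty// ge0_fin_numE.
apply/seteqP; split => -[x t]; rewrite /h /b /= theadE.
  by move=> [? Gt]; split => //=; congr (G i _): Gt; exact/val_inj.
by move=> [? Gt]; split => //=; congr (G i _): Gt; exact/val_inj.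
Qed.

HB.instance Definition _ := Measure_isSigmaFinite.Build _ _ _ lebesgue_step
  lebesgue_step_sigma_finite.

End lebesgue_step.

Fixpoint lebesgue (R : realType) (n : nat) :
    {sigma_finite_measure set (euclid R n) -> \bar R} :=
  match n with
  | 0%N => dirac ([tuple] : euclid R 0)
  | k.+1 => lebesgue_step (lebesgue R k)
  end.

(* This determines [lebesgue R n]. *)
Lemma lebesgue_box (R : realType) (n : nat) (A : 'I_n -> set (measurableTypeR R)) :
  (forall i, measurable (A i)) ->
  lebesgue R n [set x | forall i, A i (tnth x i)] =
  \prod_(i < n) (@lebesgue_measure R (A i)).
Proof.
elim: n A => [|n IH] A mA.
  by rewrite big_ord0 /= diracE mem_set// => -[].
rewrite big_ord_recl /= /lebesgue_step /pushforward.
rewrite -(IH (fun i => A (lift ord0 i)))//.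
rewrite (_ : _ @^-1` _ =
    A ord0 `*` [set x | forall i, A (lift ord0 i) (tnth x i)]).
  rewrite product_measure1E//.
  rewrite (_ : [set x | _] =
    \bigcap_(i in [set: 'I_n]) ((fun x => tnth x i) @^-1` A (lift ord0 i))).
    apply: fin_bigcap_measurable => // i _.
    by rewrite -[X in measurable X]setTI; apply: measurable_tnth.
  by apply/seteqP; split => x /= Ax i; [move=> _; exact: Ax|exact: (Ax i I)].
apply/seteqP; split => -[x t] /=.
  move=> Axt; split => [|i]; first exact: (Axt ord0).
  by have := Axt (lift ord0 i); rewrite tnthS.
move=> [/= Ax At] i.
by case: (unliftP ord0 i) => [j ->|->]; rewrite ?tnthS.
Qed.

Section maximal_functions.
Context {R : realType} {n : nat}.
Implicit Types (Q : set (euclid R n)) (x : euclid R n) (F : euclid R n -> \bar R).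

Definition is_cube Q : Prop :=
  exists (a : euclid R n) (l : R), (0 < l)%R /\
    Q = [set y | forall i, (tnth a i <= tnth y i <= tnth a i + l)%R].

Definition mean Q F : \bar R :=
  (\int[lebesgue R n]_(y in Q) F y) / lebesgue R n Q.

(* The functions are extended real-valued because an l^q norm may be infinite. *)
Definition maximal F x : \bar R :=
  ereal_sup [set mean Q (fun y => `|F y|) | Q in [set Q | is_cube Q /\ Q x]].

Definition sharp_maximal F x : \bar R :=
  ereal_sup [set ereal_inf [set mean Q (fun y => `|F y - c%:E|) | c in [set: R]]
            | Q in [set Q | is_cube Q /\ Q x]].

Definition sharp_maximal_pow (delta : R) F x : \bar R :=
  sharp_maximal (fun y => `|F y| `^ delta) x `^ delta^-1.

Definition lq_norm (q : R) (f : nat -> euclid R n -> R) x : \bar R :=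
  (\sum_(0 <= j <oo) `|(f j x)%:E| `^ q) `^ q^-1.

Definition weight (w : euclid R n -> R) : Prop :=
  [/\ measurable_fun [set: euclid R n] w, forall x, (0 <= w x)%R &
      forall Q, is_cube Q -> \int[lebesgue R n]_(x in Q) (w x)%:E < +oo].

Definition Cp_weight (p : R) (w : euclid R n -> R) : Prop :=
  weight w /\
  exists c delta : R, [/\ (0 < c)%R, (0 < delta)%R &
    forall Q (E : set (euclid R n)), is_cube Q -> measurable E -> E `<=` Q ->
      \int[lebesgue R n]_(x in E) (w x)%:E <=
      c%:E * (lebesgue R n E / lebesgue R n Q) `^ delta *
        \int[lebesgue R n]_x (maximal (fun y => (\1_Q y)%:E) x `^ p * (w x)%:E)].

Definition weighted_norm (p : R) (w : euclid R n -> R) F : \bar R :=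
  (\int[lebesgue R n]_x (`|F x| `^ p * (w x)%:E)) `^ p^-1.

End maximal_functions.

Section operators.
Context {R : realType} {n : nat}.
Implicit Types (X : set (euclid R n -> R)) (T : (euclid R n -> R) -> euclid R n -> R).

(* [X] is the domain of [T], the class over which "for all f" ranges.  The last
   clause is needed because [sharp_maximal] does not see constants: without it
   the linear operator sending f to the constant function with value its integral
   over the unit cube satisfies [condition_D] and every [condition_Dq], but is not
   controlled by the maximal operator, for instance if w = 1 and p > 1. *)
Definition operator_on X T : Prop :=
  [/\ X (fun=> 0%R),
      forall f, X f -> measurable_fun [set: euclid R n] f,
      forall f, X f -> measurable_fun [set: euclid R n] (T f) &
      forall f (t : R), X f -> (0 < t)%R ->
        lebesgue R n [set x | (t < `|T f x|)%R] < +oo].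

Definition condition_D X T : Prop :=
  exists delta c : R, [/\ (0 < delta < 1)%R, (0 < c)%R &
    forall f, X f -> forall x,
      sharp_maximal_pow delta (EFin \o T f) x <= c%:E * maximal (EFin \o f) x].

Definition condition_Dq (q : R) X T : Prop :=
  forall delta : R, (0 < delta < 1)%R ->
  exists c : R, (0 < c)%R /\
    forall f : nat -> euclid R n -> R, (forall j, X (f j)) -> forall x,
      sharp_maximal_pow delta (lq_norm q (fun j => T (f j))) x <=
      c%:E * maximal (lq_norm q f) x.

End operators.

(* Main.v *)
Require Import Defs.
From HB Require Import structures.
From mathcomp Require Import all_boot all_order all_algebra.
From mathcomp Require Import all_classical all_reals all_analysis.
From mathcomp Require Import measurable_realfun.
From mathcomp Require Import zify ring lra.
Set Implicit Arguments.
Unset Strict Implicit.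
Unset Printing Implicit Defensive.
Import Order.TTheory GRing.Theory Num.Theory.
Import numFieldNormedType.Exports.

Local Open Scope classical_set_scope.
Local Open Scope ring_scope.
Local Open Scope ereal_scope.

(** Write [f] for [|T g| ^ delta] and [h] for [|g|]; in the vector-valued case [T g] and
    [|g|] are replaced by l^q norms. The hypothesis on the sharp maximal function says that
    the mean oscillation of [f] over a cube is at most a constant times [M h ^ delta] at any
    point of the cube. The task is to bound the integral of [f ^ (p / delta)] against [w] by
    that of [M h ^ p], a good-lambda type inequality for a weight that is not assumed to
    be in A_infinity; all that is known of [w] is that a small part of a cube
    carries a small part of the tail integral of [M (1_Q) ^ q] against [w], where [q] exceeds
    [1] and [p].

    Everything is done on the grid of half-open dyadic cells, with the level of a cell
    counted from a smallest scale that tends to zero at the end. To a cell [Q] is attached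
    [a Q], the largest average of [h] over the triples of the ancestors of [Q]: it is at most
    the infimum of [M h] over the triple of [Q], and somewhere on [Q] the converse holds up to
    a constant ([exists_maximal_le]). So the oscillation of [f] over [Q] is controlled by
    [a Q ^ delta] ([osc_av]).

    First, along the chain of cells from a large cell [Q0] down to a point, stop whenever
    [a] has grown by a factor or the average of [f] has moved by a multiple of [a ^ delta].
    The stopping cells are sparse by weak type estimates, so they form a Carleson sequence
    ([stp_carleson]), and the difference of the averages of [f] is at most the sum of
    [a ^ delta] over the stopping cells met ([stp_domination]).

    Second, the cells are sorted by the height of [a]: let [Q] run over the maximal cells with
    [a Q >= B ^ k * a Q0], and let [Wsum k] be the total of their tail integrals. The cells
    of height [k + 1] fill a small part of each cell of height [k]. Splitting their tail
    integrals at the cell of height [k] gives an outer part, at most a small multiple of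
    [Wsum k] because [q > 1], and an inner part, the integral against [w] of a function with
    exponentially small distribution function ([carleson_exponential]); cutting that function
    at a high level bounds the inner part by a multiple of the weight of the set where
    [M h >= B ^ k * a Q0] plus another small multiple of [Wsum k]. Since [q > p] the factor
    [B ^ p] lost from one height to the next is absorbed, and [\sum_k B ^ (k * p) * Wsum k]
    is at most a constant times the integral of [M h ^ p] ([Wsum_total]). The recursion starts
    from one cell, so nothing has to be finite in advance. The exponential tails also bound
    the power [p / delta] of the sum over the stopping cells by the same total
    ([integral_stops]), and [local_estimate] follows.

    Third, the averages over the cells that shrink to a point have lower limit at least [f]
    almost everywhere ([av_lower_limit]), and the averages over large cells are eventually
    at most any [t > 0] up to a multiple of [a ^ delta], because the level sets of [f] have
    finite measure ([av_large]). Fatou and an exhaustion of the space give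
    [weighted_estimate]. When [a Q] is infinite for some cell, [M h] is infinite
    everywhere, and when [a Q] vanishes for some cell, [M h] and [f] are zero
    ([maximal_controls_oscillation]).

    For sequences, the finite truncations have level sets of finite measure; their tails are
    images of the zero function, which vanish by the scalar case, and one lets the length
    of the truncation tend to infinity ([vector_bound]). *)


(** * The integral of a larger function, and the dyadic grid *)

Section integral_monotone.
Context d (T : measurableType d) (R : realType) (mu : {measure set T -> \bar R}).

(** The integral of a nonnegative function is a supremum over the simple
    functions below it, so it is monotone without any measurability; this spares
    the measurability of the maximal functions. *)
Lemma le_integral_nonneg (D : set T) (f g : T -> \bar R) :
  (forall x, D x -> 0 <= f x) -> (forall x, D x -> f x <= g x) ->
  \int[mu]_(x in D) f x <= \int[mu]_(x in D) g x.
Proof.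
move=> f0 fg; rewrite !ge0_integralE//; last first.
  by move=> x Dx; exact: le_trans (f0 _ Dx) (fg _ Dx).
apply: le_ereal_sup => _ /= [h hf <-]; exists h => // x; apply: (le_trans (hf x)).
by rewrite /patch; case: ifPn => //; rewrite inE => Dx; exact: fg.
Qed.

End integral_monotone.

Section grid.
Context {R : realType} {n : nat}.
Local Notation E := (euclid R n).
Local Notation K := {ffun 'I_n -> int}.
Local Notation mu := (lebesgue R n).
Implicit Types (s t : R) (x y z : E).

Definition idx s x : K := [ffun i => Num.floor (tnth x i / s)%R].

Definition adj (k l : K) := [forall i, (`|k i - l i| <= 1)%R].

Definition cell s x : set E := [set y | idx s y = idx s x].

Definition cell3 s x : set E := [set y | adj (idx s y) (idx s x)].

Lemma adjP (k l : K) : reflect (forall i, (`|k i - l i| <= 1)%R) (adj k l).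
Proof. exact: forallP. Qed.

Lemma adjC (k l : K) : adj k l = adj l k.
Proof. by apply: eq_forallb => i; rewrite distrC. Qed.

Lemma adjxx (k : K) : adj k k.
Proof. by apply/adjP => i; rewrite subrr normr0. Qed.

Lemma cell_refl s x : cell s x x. Proof. by []. Qed.

Lemma cell_cell3 s x : cell s x `<=` cell3 s x.
Proof. by move=> y; rewrite /cell /cell3 /= => ->; exact: adjxx. Qed.

Lemma cell3C s x y : cell3 s x y = cell3 s y x.
Proof. by rewrite /cell3/= adjC. Qed.

Lemma eq_cell s x y : idx s x = idx s y -> cell s x = cell s y.
Proof. by rewrite /cell => ->. Qed.

Lemma eq_cell3 s x y : idx s x = idx s y -> cell3 s x = cell3 s y.
Proof. by rewrite /cell3 => ->. Qed.

(** Doubling the side halves the integer coordinates, which is what makes the grid nested. *)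
Lemma idx_half s x : (0 < s)%R ->
  idx (2 * s)%R x = [ffun i => (idx s x i %/ 2)%Z].
Proof.
move=> s0; apply/ffunP => i; rewrite !ffunE; apply/eqP; rewrite floor_eq.
set m := Num.floor (tnth x i / s)%R.
have /andP[m1 m2] : ((m%:~R : R) <= tnth x i / s < (m + 1)%:~R)%R by exact: floor_itv.
have -> : (tnth x i / (2 * s) = (tnth x i / s) / 2)%R.
  by rewrite invfM mulrA mulrAC.
have two (q : int) : (q%:~R * 2 = (q * 2)%:~R :> R)%R by rewrite intrM.
rewrite ler_pdivlMr// ltr_pdivrMr// !two; apply/andP; split.
  by apply: le_trans m1; rewrite ler_int; lia.
by apply: lt_le_trans m2 _; rewrite ler_int; lia.
Qed.

Lemma idx_double s x y : (0 < s)%R -> idx s x = idx s y ->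
  idx (2 * s)%R x = idx (2 * s)%R y.
Proof. by move=> s0 xy; rewrite !idx_half// xy. Qed.

Lemma adj_double s x y : (0 < s)%R -> adj (idx s x) (idx s y) ->
  adj (idx (2 * s)%R x) (idx (2 * s)%R y).
Proof.
move=> s0 /adjP xy; apply/adjP => i; rewrite !idx_half// !ffunE.
by have := xy i; rewrite !ffunE; lia.
Qed.

(** Touching is not transitive, but two steps become one at the next scale. *)
Lemma adj_trans_double s x y z : (0 < s)%R ->
  adj (idx s x) (idx s y) -> adj (idx s y) (idx s z) ->
  adj (idx (2 * s)%R x) (idx (2 * s)%R z).
Proof.
move=> s0 /adjP xy /adjP yz; apply/adjP => i; rewrite !idx_half// !ffunE.
by have := xy i; have := yz i; rewrite !ffunE; lia.
Qed.

Lemma pow2_gt0 (j : nat) : (0 < 2 ^+ j :> R)%R.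
Proof. by rewrite exprn_gt0. Qed.

Lemma lev_gt0 s (j : nat) : (0 < s)%R -> (0 < s * 2 ^+ j)%R.
Proof. by move=> s0; rewrite mulr_gt0// pow2_gt0. Qed.

Lemma levS s (j : nat) : (s * 2 ^+ j.+1 = 2 * (s * 2 ^+ j))%R.
Proof. by rewrite exprS; ring. Qed.

Lemma idx_lev s (i j : nat) x y : (0 < s)%R -> (i <= j)%N ->
  idx (s * 2 ^+ i)%R x = idx (s * 2 ^+ i)%R y ->
  idx (s * 2 ^+ j)%R x = idx (s * 2 ^+ j)%R y.
Proof.
move=> s0 ij xy; elim: j ij => [|j IH]; first by rewrite leqn0 => /eqP i0; rewrite i0 in xy.
rewrite leq_eqVlt => /predU1P[<-//|]; rewrite ltnS => /IH e.
by rewrite levS; apply: idx_double => //; exact: lev_gt0.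
Qed.

Lemma adj_lev s (i j : nat) x y : (0 < s)%R -> (i <= j)%N ->
  adj (idx (s * 2 ^+ i)%R x) (idx (s * 2 ^+ i)%R y) ->
  adj (idx (s * 2 ^+ j)%R x) (idx (s * 2 ^+ j)%R y).
Proof.
move=> s0 ij xy; elim: j ij => [|j IH]; first by rewrite leqn0 => /eqP i0; rewrite i0 in xy.
rewrite leq_eqVlt => /predU1P[<-//|]; rewrite ltnS => /IH e.
by rewrite levS; apply: adj_double => //; exact: lev_gt0.
Qed.

Lemma floor_ivt (a s : R) (k l : int) : (0 < s)%R ->
  ((k <= Num.floor (a / s)) && (Num.floor (a / s) < l))%R =
  (k%:~R * s <= a < l%:~R * s)%R.
Proof.
by move=> s0; rewrite floor_ge_int floor_lt_int ler_pdivlMr// ltr_pdivrMr.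
Qed.

Lemma cellE s x : (0 < s)%R -> cell s x =
  [set y : E | forall i, [set` `[((idx s x i)%:~R * s)%R, ((idx s x i + 1)%:~R * s)%R[] (tnth y i)].
Proof.
move=> s0; apply/seteqP; split => y /=.
  move=> yx i; rewrite /= in_itv /= -floor_ivt//.
  by move/ffunP : yx => /(_ i); rewrite !ffunE => ->; lia.
move=> H; apply/ffunP => i; have := H i.
by rewrite /= in_itv /= -floor_ivt// !ffunE; lia.
Qed.

Lemma cell3E s x : (0 < s)%R -> cell3 s x =
  [set y : E | forall i, [set` `[((idx s x i - 1)%:~R * s)%R, ((idx s x i + 2)%:~R * s)%R[] (tnth y i)].
Proof.
move=> s0; apply/seteqP; split => y /=.
  move=> /adjP yx i; rewrite /= in_itv /= -floor_ivt//.
  by move: (yx i); rewrite !ffunE; lia.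
move=> H; apply/adjP => i; have := H i.
by rewrite /= in_itv /= -floor_ivt// !ffunE; lia.
Qed.

Lemma measurable_box (A : 'I_n -> set (measurableTypeR R)) :
  (forall i, measurable (A i)) ->
  measurable [set x : E | forall i, A i (tnth x i)].
Proof.
move=> mA; rewrite (_ : [set x | _] =
  \bigcap_(i in [set: 'I_n]) ((fun x : E => tnth x i) @^-1` A i)).
  apply: fin_bigcap_measurable => // i _.
  by rewrite -[X in measurable X]setTI; apply: measurable_tnth.
by apply/seteqP; split => x /= Ax i; [move=> _; exact: Ax|exact: (Ax i I)].
Qed.

Lemma measurable_cell s x : (0 < s)%R -> measurable (cell s x).
Proof. by move=> s0; rewrite cellE//; exact: (measurable_box (fun i => measurable_itv _)). Qed.

Lemma measurable_cell3 s x : (0 < s)%R -> measurable (cell3 s x).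
Proof. by move=> s0; rewrite cell3E//; exact: (measurable_box (fun i => measurable_itv _)). Qed.

Lemma prod_EFin_cst (r : R) : \prod_(i < n) r%:E = (r ^+ n)%:E.
Proof.
by rewrite prodEFin prodr_const card_ord.
Qed.

Lemma mu_cell s x : (0 < s)%R -> mu (cell s x) = (s ^+ n)%:E.
Proof.
move=> s0; rewrite cellE// (lebesgue_box (fun i => measurable_itv _)).
rewrite -prod_EFin_cst; apply: eq_bigr => i _.
rewrite lebesgue_measure_itv/= lte_fin ltr_pM2r// ltr_int ltrDl ltr01.
by rewrite -EFinD intrD; congr EFin; ring.
Qed.

Lemma mu_cell3 s x : (0 < s)%R -> mu (cell3 s x) = ((3 * s) ^+ n)%:E.
Proof.
move=> s0; rewrite cell3E// (lebesgue_box (fun i => measurable_itv _)).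
rewrite -prod_EFin_cst; apply: eq_bigr => i _.
rewrite lebesgue_measure_itv/= lte_fin ltr_pM2r// ltr_int.
rewrite ifT; last by lia.
by rewrite -EFinD !intrD; congr EFin; ring.
Qed.

Lemma closed_boxE (a : E) (l : R) :
  [set y : E | forall i, (tnth a i <= tnth y i <= tnth a i + l)%R] =
  [set y : E | forall i, [set` `[(tnth a i)%R, (tnth a i + l)%R]] (tnth y i)].
Proof. by apply/seteqP; split => y /= H i; have := H i; rewrite /= in_itv. Qed.

Lemma measurable_cube (Q : set E) : is_cube Q -> measurable Q.
Proof.
move=> [a [l [l0 ->]]]; rewrite closed_boxE; exact: (measurable_box (fun i => measurable_itv _)).
Qed.

Lemma mu_closed_box (a : E) (l : R) : (0 < l)%R ->
  mu [set y : E | forall i, (tnth a i <= tnth y i <= tnth a i + l)%R] = (l ^+ n)%:E.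
Proof.
move=> l0; rewrite closed_boxE (lebesgue_box (fun i => measurable_itv _)).
rewrite -prod_EFin_cst; apply: eq_bigr => i _.
by rewrite lebesgue_measure_itv/= lte_fin ltrDl l0 -EFinD; congr EFin; ring.
Qed.

(** The passage from the half-open cells to the closed cubes of the maximal functions
    keeps the measure; the bounds on the coordinates keep track of the position. *)
Lemma cell_sub_cube s x : (0 < s)%R ->
  exists Q, [/\ is_cube Q, cell s x `<=` Q, mu Q = (s ^+ n)%:E &
    forall y, Q y -> forall i, ((idx s x i)%:~R * s <= tnth y i <= (idx s x i + 1)%:~R * s)%R].
Proof.
move=> s0; pose a : E := [tuple ((idx s x i)%:~R * s)%R | i < n].
exists [set y | forall i, (tnth a i <= tnth y i <= tnth a i + s)%R]; split.
- by exists a, s.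
- rewrite cellE// => y /= H i; have := H i; rewrite /a tnth_mktuple in_itv /= intrD mulrDl mul1r.
  by move=> /andP[-> /ltW ->].
- exact: mu_closed_box.
- by move=> y /= H i; have := H i; rewrite /a tnth_mktuple intrD mulrDl mul1r.
Qed.

Lemma cell3_sub_cube s x : (0 < s)%R ->
  exists Q, [/\ is_cube Q, cell3 s x `<=` Q & mu Q = ((3 * s) ^+ n)%:E].
Proof.
move=> s0; pose a : E := [tuple ((idx s x i - 1)%:~R * s)%R | i < n].
have s30 : (0 < 3 * s)%R by rewrite mulr_gt0.
exists [set y | forall i, (tnth a i <= tnth y i <= tnth a i + 3 * s)%R]; split.
- by exists a, (3 * s)%R.
- rewrite cell3E// => y /= H i; have := H i; rewrite /a tnth_mktuple in_itv /=.
  move=> /andP[-> /ltW yi] /=; apply: le_trans yi _.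
  by rewrite !intrD; lra.
- exact: mu_closed_box.
Qed.

(** A cube of side at most [t] cannot leave the neighbours of a cell that it meets. *)
Lemma cube_sub_cell3 (Q : set E) x t : is_cube Q -> Q x ->
  mu Q <= (t ^+ n)%:E -> (0 < n)%N -> (0 < t)%R -> Q `<=` cell3 t x.
Proof.
move=> [a [l [l0 ->]]] Qx; rewrite mu_closed_box// lee_fin => lt n0 t0.
have {}lt : (l <= t)%R by rewrite -(@ler_pXn2r _ n)// nnegrE ltW.
move=> y Qy; rewrite cell3E// => i /=; rewrite in_itv/= intrB intrD.
have := Qx i; have := Qy i => /andP[y1 y2] /andP[x1 x2].
have /andP[k1 k2] := floor_itv (tnth x i / t)%R.
rewrite ler_pdivlMr// in k1; rewrite ltr_pdivrMr// in k2.
rewrite intrD in k2.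
rewrite !ffunE.
set k : R := (Num.floor (tnth x i / t))%:~R in k1 k2 *.
by apply/andP; split; nra.
Qed.

Lemma measurable_idx s (A : set K) : (0 < s)%R -> measurable (idx s @^-1` A).
Proof.
move=> s0.
have -> : idx s @^-1` A = \bigcup_(k : K)
   (if `[< A k >] then [set y : E | idx s y = k] else set0).
  apply/seteqP; split => y /=.
    by move=> Ay; exists (idx s y) => //; rewrite asboolT.
  by move=> [k _]; case: asboolP => // Ak /= ->.
apply: countable_bigcupT_measurable => [|k]; first exact: countableP.
case: asboolP => // _.
have [[x <-]|N] := pselect (exists x, idx s x = k); first exact: measurable_cell.
rewrite (_ : [set _ | _] = set0)//.
by apply/seteqP; split => y //= yk; apply: N; exists y.
Qed.

(** Functions that only depend on the cell of side [s] need no measurability proof, as there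
    are countably many cells. *)
Definition adapted {T : Type} s (g : E -> T) :=
  forall x y, idx s x = idx s y -> g x = g y.

Lemma adapted_measurable d (T : measurableType d) s (g : E -> T) :
  (0 < s)%R -> adapted s g -> measurable_fun [set: E] g.
Proof.
move=> s0 ag _ Y mY; rewrite setTI.
rewrite (_ : g @^-1` Y = idx s @^-1` (idx s @` (g @^-1` Y))); first exact: measurable_idx.
apply/seteqP; split => [y Yy|y /= [x Yx /ag xy]]; first by exists y.
by rewrite -xy.
Qed.

Lemma adapted_mset s (p : E -> Prop) :
  (0 < s)%R -> adapted s p -> measurable [set x | p x].
Proof.
move=> s0 ap.
rewrite (_ : [set x | p x] = idx s @^-1` (idx s @` [set x | p x])); first exact: measurable_idx.
apply/seteqP; split => [y Yy|y /= [x Yx /ap xy]]; first by exists y.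
by rewrite -xy.
Qed.

Lemma adapted2_measurable d (T : measurableType d) s (g : E * E -> T) :
  (0 < s)%R -> (forall x y x' y', idx s x = idx s x' -> idx s y = idx s y' ->
   g (x, y) = g (x', y')) -> measurable_fun [set: E * E] g.
Proof.
move=> s0 ag _ Y mY; rewrite setTI.
have -> : g @^-1` Y = \bigcup_(k : K) \bigcup_(l : K)
   (if `[< exists x y, [/\ idx s x = k, idx s y = l & Y (g (x, y))] >]
    then (idx s @^-1` [set k]) `*` (idx s @^-1` [set l]) else set0).
  apply/seteqP; split => [[x y] /= Yxy|[x y] /=].
    exists (idx s x) => //; exists (idx s y) => //.
    by rewrite asboolT//; exists x, y.
  move=> [k _ [l _]]; case: asboolP => // -[x' [y' [<- <- Y']]] [/= e1 e2].
  by rewrite (ag _ _ _ _ e1 e2).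
apply: countable_bigcupT_measurable => [|k]; first exact: countableP.
apply: countable_bigcupT_measurable => [|l]; first exact: countableP.
by case: asboolP => // _; apply: measurableX; exact: measurable_idx.
Qed.

(* the cells, listed by the codes of their coordinates *)
Let piece s (i : nat) : set E := [set y | pickle (idx s y) = i].

Let mpiece s i : (0 < s)%R -> measurable (piece s i).
Proof. by move=> s0; rewrite /piece -[X in measurable X]/(idx s @^-1` [set k | pickle k = i]); exact: measurable_idx. Qed.

Let tpiece s (A : set E) : trivIset setT (fun i => A `&` piece s i).
Proof.
apply/trivIsetP => i j _ _ ij; apply/seteqP; split => y //= -[[_ yi] [_ yj]].
by move: ij; rewrite -yi -yj eqxx.
Qed.

Let piece_cover s (A : set E) : A = \bigcup_i (A `&` piece s i).
Proof. by apply/seteqP; split => [y Ay|y [i _ []//]]; exists (pickle (idx s y)). Qed.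

Let pieceE s i : (exists x, piece s i = cell s x) \/ piece s i = set0.
Proof.
have [[x xi]|N] := pselect (exists x, pickle (idx s x) = i).
  left; exists x; apply/seteqP; split => y; rewrite /piece/cell/=.
    by rewrite -xi => /(pcan_inj pickleK_inv).
  by move=> ->.
by right; apply/seteqP; split => y //= yi; apply: N; exists y.
Qed.

(** The workhorse for comparing integrals: all the estimates are proved cell by cell. *)
Lemma le_integral_cells s (A B : set E) (F G : E -> \bar R) : (0 < s)%R ->
  measurable A -> measurable_fun A F -> (forall x, A x -> 0 <= F x) ->
  measurable B -> measurable_fun B G -> (forall x, B x -> 0 <= G x) ->
  (forall x, \int[mu]_(y in A `&` cell s x) F y <=
             \int[mu]_(y in B `&` cell s x) G y) ->
  \int[mu]_(y in A) F y <= \int[mu]_(y in B) G y.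
Proof.
move=> s0 mA mF F0 mB mG G0 H.
rewrite [X in \int[mu]_(_ in X) F _](piece_cover s) [X in \int[mu]_(_ in X) G _](piece_cover s).
rewrite (@ge0_integral_bigcup _ _ _ mu (fun i => A `&` piece s i) F); first last.
- exact: tpiece.
- by move=> x; rewrite -piece_cover; exact: F0.
- by rewrite -piece_cover.
- by move=> i; apply: measurableI => //; exact: mpiece.
rewrite (@ge0_integral_bigcup _ _ _ mu (fun i => B `&` piece s i) G); first last.
- exact: tpiece.
- by move=> x; rewrite -piece_cover; exact: G0.
- by rewrite -piece_cover.
- by move=> i; apply: measurableI => //; exact: mpiece.
apply: lee_nneseries => [i _ _|i _].
  by apply: integral_ge0 => x [Ax _]; exact: F0.
by have [[x ->]|->] := pieceE s i; rewrite ?setI0 ?integral_set0.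
Qed.

End grid.

(** * Levels of the grid and the dyadic weak type estimate *)

Section levels.
Context {R : realType} {n : nat}.
Local Notation E := (euclid R n).
Local Notation mu := (lebesgue R n).
Variable s : R.
Hypothesis s0 : (0 < s)%R.
Implicit Types (x y : E) (i j : nat).

Definition level_cell j x : set E := cell (s * 2 ^+ j)%R x.
Definition level_cell3 j x : set E := cell3 (s * 2 ^+ j)%R x.
Definition vol j : R := ((s * 2 ^+ j) ^+ n)%R.

Lemma vol_gt0 j : (0 < vol j)%R.
Proof. by rewrite /vol exprn_gt0// lev_gt0. Qed.

Lemma mu_lcell j x : mu (level_cell j x) = (vol j)%:E.
Proof. by rewrite mu_cell// lev_gt0. Qed.

Lemma mu_lcell3 j x : mu (level_cell3 j x) = (3 ^+ n * vol j)%:E.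
Proof. by rewrite mu_cell3 ?lev_gt0// exprMn. Qed.

Lemma measurable_lcell j x : measurable (level_cell j x).
Proof. by apply: measurable_cell; exact: lev_gt0. Qed.

Lemma measurable_lcell3 j x : measurable (level_cell3 j x).
Proof. by apply: measurable_cell3; exact: lev_gt0. Qed.

Lemma integral_lcell_cst j x (r : \bar R) :
  \int[mu]_(y in level_cell j x) r = r * (vol j)%:E.
Proof.
rewrite (@integral_cst _ _ _ mu _ (measurable_lcell j x)).
by congr (_ * _); exact: mu_lcell.
Qed.

Lemma integral_lcell3_cst j x (r : \bar R) :
  \int[mu]_(y in level_cell3 j x) r = r * (3 ^+ n * vol j)%:E.
Proof.
rewrite (@integral_cst _ _ _ mu _ (measurable_lcell3 j x)).
by congr (_ * _); exact: mu_lcell3.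
Qed.

Lemma idx_lev0 j x y : idx s x = idx s y ->
  idx (s * 2 ^+ j)%R x = idx (s * 2 ^+ j)%R y.
Proof. by move=> xy; apply: (idx_lev s0 (leq0n j)); rewrite expr0 mulr1. Qed.

Lemma lcell_le i j x y : (i <= j)%N -> level_cell i x y -> level_cell j x y.
Proof. by move=> ij; apply: idx_lev. Qed.

Lemma eq_lcell i j x y : (i <= j)%N -> level_cell i x y -> level_cell j y = level_cell j x.
Proof. by move=> ij /(lcell_le ij) yx; rewrite /level_cell; exact: eq_cell. Qed.

Lemma lcell3_le i j x y : (i <= j)%N -> level_cell3 i x y -> level_cell3 j x y.
Proof. by move=> ij; apply: adj_lev. Qed.

(** The induction step of the arguments on the grid, which climb from the sons of a cell to
    the cell. *)
Lemma le_integral_sons j x0 (A B : set E) (F G : E -> \bar R) :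
  measurable A -> measurable_fun [set: E] F -> (forall x, 0 <= F x) ->
  measurable B -> measurable_fun [set: E] G -> (forall x, 0 <= G x) ->
  (forall x, level_cell j.+1 x0 x -> \int[mu]_(y in A `&` level_cell j x) F y <=
             \int[mu]_(y in B `&` level_cell j x) G y) ->
  \int[mu]_(y in A `&` level_cell j.+1 x0) F y <=
  \int[mu]_(y in B `&` level_cell j.+1 x0) G y.
Proof.
move=> mA mF F0 mB mG G0 H.
apply: (@le_integral_cells _ _ (s * 2 ^+ j)%R) => //.
- exact: lev_gt0.
- by apply: measurableI => //; exact: measurable_lcell.
- exact: measurable_funTS.
- by apply: measurableI => //; exact: measurable_lcell.
- exact: measurable_funTS.
move=> x; rewrite -!setIA -/(level_cell j x).
have [xx0|xx0] := pselect (level_cell j.+1 x0 x).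
  rewrite (_ : level_cell j.+1 x0 `&` level_cell j x = level_cell j x); first exact: H.
  apply/setIidPr => y yx.
  by rewrite -(@eq_lcell j.+1 j.+1 x0 x)//; exact: (lcell_le (leqnSn j)).
rewrite (_ : level_cell j.+1 x0 `&` level_cell j x = set0) ?setI0 ?integral_set0//.
apply/seteqP; split => // y /= [yx0 yx]; apply: xx0.
have := lcell_le (leqnSn j) yx.
by rewrite /level_cell/cell /= => <-.
Qed.

Lemma le_measure_sons j x0 (c : R) (A B : set E) : (0 <= c)%R ->
  measurable A -> measurable B ->
  (forall x, level_cell j.+1 x0 x -> c%:E * mu (A `&` level_cell j x) <= mu (B `&` level_cell j x)) ->
  c%:E * mu (A `&` level_cell j.+1 x0) <= mu (B `&` level_cell j.+1 x0).
Proof.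
move=> c0 mA mB H.
have mC k x : measurable (level_cell k x) by exact: measurable_lcell.
rewrite -[leRHS]mul1e -!integral_cst; try exact: measurableI.
apply: (@le_integral_sons _ _ A B) => //= x xx0.
rewrite !integral_cst ?mul1e//; try exact: measurableI.
exact: H.
Qed.

(** The weak type (1,1) estimate of the dyadic maximal function, by induction on the level:
    either the average over the cell itself is large and the whole cell is counted, or only
    averages over smaller cells matter and the sons can be treated separately. *)
Lemma dyadic_weak_type (g : E -> \bar R) (t : R) j x0 : (0 < t)%R ->
  measurable_fun [set: E] g -> (forall x, 0 <= g x) ->
  t%:E * mu ([set x | exists2 i, (i <= j)%N &
               (t * vol i)%:E < \int[mu]_(y in level_cell i x) g y] `&` level_cell j x0) <=
  \int[mu]_(y in level_cell j x0) g y.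
Proof.
move=> t0 mg g0.
have mS j' : measurable [set x | exists2 i, (i <= j')%N &
               (t * vol i)%:E < \int[mu]_(y in level_cell i x) g y].
  apply: (adapted_mset s0) => x y xy; apply/propext.
  by split => -[i ij H]; exists i => //; move: H; rewrite /level_cell (eq_cell (idx_lev0 i xy)).
elim: j x0 => [|j IH] x0.
  have [H|H] := ltP (t * vol 0)%:E (\int[mu]_(y in level_cell 0 x0) g y).
    apply: le_trans (ltW H); rewrite EFinM lee_pmul2l//= -(mu_lcell _ x0).
    apply: le_measure; rewrite ?inE; [|exact: measurable_lcell|exact: subIsetr].
    by apply: measurableI => //; exact: measurable_lcell.
  rewrite (_ : _ `&` _ = set0) ?measure0 ?mule0 ?integral_ge0//.
  apply/seteqP; split => // x [/= [i]]; rewrite leqn0 => /eqP -> + xx0.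
  by rewrite (eq_lcell (leqnn 0) xx0) ltNge H.
have [H|H] := ltP (t * vol j.+1)%:E (\int[mu]_(y in level_cell j.+1 x0) g y).
  apply: le_trans (ltW H); rewrite EFinM lee_pmul2l//= -(mu_lcell _ x0).
  apply: le_measure; rewrite ?inE; [|exact: measurable_lcell|exact: subIsetr].
  by apply: measurableI => //; exact: measurable_lcell.
set S := (X in _ * mu (X `&` _)).
rewrite (_ : S `&` _ = [set x | exists2 i, (i <= j)%N &
     (t * vol i)%:E < \int[mu]_(y in level_cell i x) g y] `&` level_cell j.+1 x0); last first.
  apply/seteqP; split => x [[i ij Hi] xx0]; split => //; last first.
    by exists i => //; exact: leqW.
  move: ij; rewrite leq_eqVlt ltnS => /predU1P[ij|]; last by exists i.
  by move: Hi; rewrite ij (eq_lcell (leqnn _) xx0) ltNge H.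
rewrite -integral_cst; last by apply: measurableI => //; exact: measurable_lcell.
rewrite -[X in _ <= \int[mu]_(y in X) _](setTI (level_cell j.+1 x0)).
apply: le_integral_sons => //=; first by move=> x; rewrite lee_fin ltW.
move=> x xx0; rewrite integral_cst; last by apply: measurableI => //; exact: measurable_lcell.
by rewrite setTI; exact: IH.
Qed.

(** Fubini, since being a neighbour is a symmetric relation. *)
Lemma integral_neighbours j (g F : E -> \bar R) :
  measurable_fun [set: E] g -> (forall x, 0 <= g x) ->
  measurable_fun [set: E] F -> (forall x, 0 <= F x) ->
  \int[mu]_y ((\int[mu]_(x in level_cell3 j y) g x) * F y) =
  \int[mu]_x (g x * \int[mu]_(y in level_cell3 j x) F y).
Proof.
move=> mg g0 mF F0.
pose k (z : E * E) : \bar R := (\1_(level_cell3 j z.1) z.2)%:E.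
have k0 z : 0 <= k z by rewrite lee_fin.
have mk : measurable_fun [set: E * E] k.
  apply: (adapted2_measurable (lev_gt0 j s0)) => x y x' y' xx' yy'.
  rewrite /k/= !indicE /level_cell3 (eq_cell3 xx').
  suff -> : (y \in cell3 (s * 2 ^+ j)%R x') = (y' \in cell3 (s * 2 ^+ j)%R x') by [].
  by apply/idP/idP; rewrite !inE /cell3 /= yy'.
have mk1 y : measurable_fun [set: E] (fun x => k (y, x)).
  by apply: measurableT_comp => //; exact: measurable_pair1.
have mk2 x : measurable_fun [set: E] (fun y => k (y, x)).
  by apply: measurableT_comp => //; exact: measurable_pair2.
have kC x y : k (x, y) = k (y, x).
  rewrite /k/= !indicE.
  suff -> : (y \in level_cell3 j x) = (x \in level_cell3 j y) by [].
  by apply/idP/idP; rewrite !inE /level_cell3 cell3C.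
have kE (G : E -> \bar R) y : \int[mu]_(x in level_cell3 j y) G x = \int[mu]_x (k (y, x) * G x).
  rewrite integral_mkcond; apply: eq_integral => x _.
  rewrite /patch /k/= indicE; case: ifPn => _; first by rewrite mul1e.
  by rewrite mul0e.
transitivity (\int[mu]_y \int[mu]_x (k (y, x) * g x * F y)).
  apply: eq_integral => y _; rewrite kE muleC -ge0_integralZl//.
  - by apply: eq_integral => x _; rewrite muleC.
  - by apply: emeasurable_funM.
  - by move=> x _; rewrite mule_ge0.
rewrite (@fubini_tonelli _ _ _ _ _ mu mu (fun z => k z * g z.2 * F z.1)); last first.
- by move=> z; rewrite !mule_ge0.
- apply: emeasurable_funM; first apply: emeasurable_funM => //.
  + by apply: measurableT_comp => //; exact: measurable_snd.
  + by apply: measurableT_comp => //; exact: measurable_fst.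
apply: eq_integral => x _ /=; rewrite kE -ge0_integralZl//.
- by apply: eq_integral => y _; rewrite kC muleA (muleC (g x)).
- by apply: emeasurable_funM.
- by move=> y _; rewrite mule_ge0.
Qed.

(** Each point has [3 ^ n] neighbours. *)
Lemma integral_neighbours1 j (g : E -> \bar R) :
  measurable_fun [set: E] g -> (forall x, 0 <= g x) ->
  \int[mu]_y (((vol j)^-1)%:E * (\int[mu]_(x in level_cell3 j y) g x)) =
  (3 ^+ n)%:E * \int[mu]_x g x.
Proof.
move=> mg g0.
under eq_integral do rewrite muleC.
rewrite (integral_neighbours j mg g0 (F := cst ((vol j)^-1)%:E))//; last first.
  by move=> _ /=; rewrite lee_fin invr_ge0 ltW// vol_gt0.
rewrite -ge0_integralZl//; apply: eq_integral => x _.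
rewrite integral_lcell3_cst -EFinM mulrCA mulVf ?mulr1 1?muleC//.
by rewrite gt_eqF// vol_gt0.
Qed.

End levels.

(** * Maximal cells and neighbouring cells *)

Section indicator.
Context {R : realType}.
Implicit Types P Q : Prop.

(** Conditions on the levels at a point are propositions, not sets of points. *)
Definition ind P : R := if `[< P >] then 1%R else 0%R.

Lemma indT P : P -> ind P = 1%R. Proof. by move=> p; rewrite /ind asboolT. Qed.

Lemma indF P : ~ P -> ind P = 0%R. Proof. by move=> p; rewrite /ind asboolF. Qed.

Lemma ind_ge0 P : (0 <= ind P)%R.
Proof. by rewrite /ind; case: asboolP. Qed.

Lemma ind_le1 P : (ind P <= 1)%R.
Proof. by rewrite /ind; case: asboolP. Qed.

Lemma indE T (A : set T) x : \1_A x = ind (A x).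
Proof. by rewrite indicE /ind; case: asboolP => Ax; [rewrite mem_set|rewrite memNset]. Qed.

Lemma le_ind P Q : (P -> Q) -> (ind P <= ind Q)%R.
Proof.
by move=> PQ; rewrite /ind; case: asboolP => [/PQ ?|_]; [rewrite asboolT|case: asboolP].
Qed.

(** Read as a condition on cells, this singles out the maximal cells of a family; at each
    point there is at most one, which is why sums over them have one term. *)
Definition ltop {T : Type} J (p : nat -> T -> Prop) j x : Prop :=
  [/\ (j <= J)%N, p j x & forall i, (j < i <= J)%N -> ~ p i x].

Lemma ltop_ex {T : Type} J (p : nat -> T -> Prop) j x : (j <= J)%N -> p j x ->
  exists2 i, (j <= i)%N & ltop J p i x.
Proof.
move=> jJ; have [k] := ubnP (J - j)%N; elim: k j jJ => // k IH j jJ kJ pj.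
have [[i /andP[ji iJ] pi]|N] := pselect (exists2 i, (j < i <= J)%N & p i x).
  have [|//|i' ii' ti'] := IH i iJ; first by lia.
  by exists i' => //; lia.
by exists j => //; split => // i iJ pi; apply: N; exists i.
Qed.

Lemma ltop_uniq {T : Type} J (p : nat -> T -> Prop) i j x :
  ltop J p i x -> ltop J p j x -> i = j.
Proof.
move=> [iJ pi Ni] [jJ pj Nj]; apply/eqP; rewrite eqn_leq.
apply/andP; split; rewrite leqNgt; apply/negP => ij.
  by apply: (Nj i) => //; rewrite ij.
by apply: (Ni j) => //; rewrite ij.
Qed.

Lemma sum_ltop {T : Type} J (p : nat -> T -> Prop) (u : nat -> \bar R) i x :
  ltop J p i x -> \sum_(j < J.+1) (ind (ltop J p j x))%:E * u j = u i.
Proof.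
move=> ti; have iJ : (i < J.+1)%N by case: ti.
rewrite (bigD1 (Ordinal iJ))//= indT// mul1e big1 ?adde0// => j ji.
rewrite indF ?mul0e// => tj; move/eqP: ji; apply; apply/val_inj => /=.
exact: ltop_uniq tj ti.
Qed.

Lemma sum_ltop0 {T : Type} J (p : nat -> T -> Prop) (u : nat -> \bar R) x :
  (forall i, ~ ltop J p i x) -> \sum_(j < J.+1) (ind (ltop J p j x))%:E * u j = 0.
Proof. by move=> N; rewrite big1// => j _; rewrite indF ?mul0e. Qed.

End indicator.

Section neighbours.
Context {R : realType} {n : nat}.
Local Notation E := (euclid R n).
Local Notation mu := (lebesgue R n).
Variable s : R.
Hypothesis s0 : (0 < s)%R.
Local Notation lcell := (level_cell s).
Local Notation lcell3 := (level_cell3 s).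
Local Notation vol := (@vol R n s).
Implicit Types (x y : E) (i j : nat).

(** A family indexed by the cells, encoded as a function of a level and a point. *)
Definition levelwise (T : Type) (p : nat -> E -> T) :=
  forall j x y, idx (s * 2 ^+ j)%R x = idx (s * 2 ^+ j)%R y -> p j x = p j y.

Lemma levelwise_adapted T (p : nat -> E -> T) j : levelwise p -> adapted s (p j).
Proof. by move=> lp x y /(idx_lev0 s0 j); exact: lp. Qed.

Lemma ltop_levelwise J (p : nat -> E -> Prop) : levelwise p -> levelwise (ltop J p).
Proof.
move=> lp j x y xy; apply/propext.
have h i : (j <= i)%N -> p i x = p i y by move=> ji; apply: lp; exact: idx_lev xy.
split => -[jJ pj N]; split => //.
- by rewrite -(h j).
- by move=> i /andP[ji iJ]; rewrite -h ?(ltnW ji)//; apply: N; rewrite ji.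
- by rewrite (h j).
- by move=> i /andP[ji iJ]; rewrite h ?(ltnW ji)//; apply: N; rewrite ji.
Qed.

Lemma adapted_ind (p : E -> Prop) : adapted s p -> adapted s (fun x => (ind (p x) : R)%:E).
Proof. by move=> ap x y /ap ->. Qed.

Lemma adapted_measurableT d (T : measurableType d) (g : E -> T) :
  adapted s g -> measurable_fun [set: E] g.
Proof. exact: adapted_measurable. Qed.

Lemma integral_ind (A D : set E) : measurable D -> measurable A ->
  \int[mu]_(x in D) (ind (A x))%:E = mu (A `&` D).
Proof.
by move=> mD mA; rewrite -(integral_indic mu)//; apply: eq_integral => x _; rewrite indE.
Qed.

(** Only the maximal cells of the family matter, and those are disjoint: a point of a tripled
    maximal cell sees the whole cell among its neighbours, so integrating the visible
    fraction counts it at least once, while by Fubini each cell is counted [3 ^ n] times. *)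
Lemma measure_neighbours J (p : nat -> E -> Prop) : levelwise p ->
  mu [set y | exists2 j, (j <= J)%N & exists2 x, lcell3 j y x & p j x] <=
  (3 ^+ n)%:E * mu [set x | exists2 j, (j <= J)%N & p j x].
Proof.
move=> lp; set U := [set y | _]; set V := [set x | _].
have lt := ltop_levelwise J lp.
have mU : measurable U.
  apply: (adapted_mset s0) => y y' yy'; apply/propext.
  by split=> -[j jJ [x yx pj]]; exists j => //; exists x => //;
    move: yx; rewrite /lcell3 /level_cell3 (eq_cell3 (idx_lev0 s0 j yy')).
have mV : measurable V.
  apply: (adapted_mset s0) => y y' yy'; apply/propext.
  by split=> -[j jJ pj]; exists j => //; rewrite -?(lp _ _ _ (idx_lev0 s0 j yy'))//
    (lp _ _ _ (idx_lev0 s0 j yy')).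
pose q j x : \bar R := (ind (ltop J p j x))%:E.
have q0 j x : 0 <= q j x by rewrite lee_fin ind_ge0.
have mq j : measurable_fun [set: E] (q j).
  by apply: adapted_measurableT; apply: adapted_ind; exact: levelwise_adapted.
pose nb j y := ((vol j)^-1)%:E * \int[mu]_(x in lcell3 j y) q j x.
have nb0 j y : 0 <= nb j y.
  by rewrite mule_ge0 ?integral_ge0// lee_fin invr_ge0 ltW// vol_gt0.
have mnb j : measurable_fun [set: E] (nb j).
  apply: adapted_measurableT => y y' yy'.
  by rewrite /nb /lcell3 /level_cell3 (eq_cell3 (idx_lev0 s0 j yy')).
rewrite -[mu U]mul1e -(integral_cst mu mU).
apply: (@le_trans _ _ (\int[mu]_y \sum_(j < J.+1) nb j y)).
  rewrite [leLHS]integral_mkcond; apply: le_integral_nonneg => y _.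
    by rewrite /patch; case: ifP.
  rewrite /patch; case: ifPn => [|_]; last exact: sume_ge0.
  rewrite inE => -[j jJ [x yx pj]].
  have [i ji ti] := ltop_ex jJ pj; have iJ : (i < J.+1)%N by case: ti.
  rewrite (bigD1 (Ordinal iJ))//=; apply: (@le_trans _ _ (nb i y)); last first.
    by rewrite leeDl// sume_ge0.
  rewrite [X in X <= _](_ : _ = ((vol i)^-1)%:E * \int[mu]_(z in lcell i x) q i z); last first.
    rewrite (@eq_integral _ _ _ mu _ (fun=> 1)); last first.
      by move=> z; rewrite inE => zx; rewrite /q indT// (lt i z x zx).
    rewrite integral_lcell_cst// mul1e -EFinM mulVf// gt_eqF// vol_gt0 //.
  apply: lee_wpmul2l; first by rewrite lee_fin invr_ge0 ltW// vol_gt0.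
  apply: ge0_subset_integral => //; [exact: measurable_lcell|exact: measurable_lcell3| |].
    exact: measurable_funTS.
  move=> z zx; have := lcell3_le s0 ji yx.
  by rewrite /level_cell3 /cell3/= zx adjC.
rewrite ge0_integral_sum//.
under eq_bigr do rewrite integral_neighbours1//.
rewrite -ge0_sume_distrr; last by move=> j _; exact: integral_ge0.
apply: lee_wpmul2l; first by rewrite lee_fin exprn_ge0.
rewrite -ge0_integral_sum// -[mu V]mul1e -(integral_cst mu mV) [leRHS]integral_mkcond.
apply: le_integral_nonneg => x _; first exact: sume_ge0.
have [[i ti]|N] := pselect (exists i, ltop J p i x).
  have := @sum_ltop R _ J p (fun=> 1) i x ti.
  under eq_bigr do rewrite mule1.
  move=> ->; rewrite /patch mem_set//; case: ti => iJ pi _; by exists i.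
have := @sum_ltop0 R _ J p (fun=> 1) x.
under eq_bigr do rewrite mule1.
move=> -> //; last by move=> i ti; apply: N; exists i.
by rewrite /patch; case: ifP.
Qed.

End neighbours.

(** * Carleson sequences *)

Section exponential.
Context {R : realType} {n : nat}.
Local Notation E := (euclid R n).
Local Notation mu := (lebesgue R n).
Variable s : R.
Hypothesis s0 : (0 < s)%R.
Local Notation lcell := (level_cell s).
Local Notation lcell3 := (level_cell3 s).
Local Notation vol := (@vol R n s).
Implicit Types (x y : E) (i j : nat).

Lemma eq_lcell0 i x y : idx s x = idx s y -> lcell i x = lcell i y.
Proof. by move=> xy; apply: eq_cell; exact: (idx_lev0 s0). Qed.

Lemma eq_lcell30 i x y : idx s x = idx s y -> lcell3 i x = lcell3 i y.
Proof. by move=> xy; apply: eq_cell3; exact: (idx_lev0 s0). Qed.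

(** A tripled cell with a large average contains a cell with a large average, so this
    reduces to the weak type estimate for cells by [measure_neighbours]. *)
Lemma dyadic_weak_type3 (g : E -> \bar R) (t : R) j x0 : (0 < t)%R ->
  measurable_fun [set: E] g -> (forall x, 0 <= g x) ->
  t%:E * mu ([set x | exists2 i, (i <= j)%N &
       (t * (3 ^+ n * vol i))%:E < \int[mu]_(y in lcell3 i x) g y] `&` lcell j x0) <=
  (3 ^+ n)%:E * \int[mu]_(y in lcell3 j x0) g y.
Proof.
move=> t0 mg g0.
pose p i z := lcell3 j x0 z /\ (i <= j)%N /\ (t * vol i)%:E < \int[mu]_(y in lcell i z) g y.
have lcj i x y : idx (s * 2 ^+ i)%R x = idx (s * 2 ^+ i)%R y -> (i <= j)%N ->
    lcell3 j x0 x = lcell3 j x0 y.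
  by move=> xy ij; rewrite /level_cell3 /cell3 /= (idx_lev s0 ij xy).
have lp : levelwise s p.
  move=> i x y xy; apply/propext; rewrite /p /level_cell (eq_cell xy).
  by split => -[x3 [ij H]]; [rewrite -(lcj i x y xy ij)|rewrite (lcj i x y xy ij)].
set S := (X in X `&` _).
have mS : measurable (S `&` lcell j x0).
  apply: measurableI; last exact: measurable_lcell.
  apply: (adapted_mset s0) => x y xy; apply/propext.
  by split => -[i ij H]; (exists i; first exact: ij); move: H; rewrite (eq_lcell30 i xy).
pose p' i z := (i <= j)%N /\ p i z.
set V := [set x | exists2 i, (i <= j)%N & p i x].
have mV : measurable V.
  apply: (adapted_mset s0) => y y' yy'; apply/propext.
  by split=> -[i ij pj]; exists i => //; rewrite -?(lp _ _ _ (idx_lev0 s0 i yy'))//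
    (lp _ _ _ (idx_lev0 s0 i yy')).
apply: (@le_trans _ _ (t%:E * ((3 ^+ n)%:E * mu V))).
  apply: lee_wpmul2l; first by rewrite lee_fin ltW.
  apply: le_trans (measure_neighbours s0 j lp).
  apply: le_measure; rewrite ?inE//.
    apply: (adapted_mset s0) => y y' yy'; apply/propext.
    by split=> -[i ij [x yx pj]]; exists i => //; exists x => //;
      move: yx; rewrite (eq_lcell30 i yy').
  move=> x [[i ij Hi] xx0]; exists i => //; apply: contrapT => N.
  move: Hi; rewrite ltNge => /negP; apply.
  rewrite EFinM -(integral_lcell3_cst s0 i x).
  apply: (le_integral_cells (lev_gt0 i s0)) => //.
  - exact: measurable_lcell3.
  - exact: measurable_funTS.
  - exact: measurable_lcell3.
  - by move=> y _; rewrite lee_fin ltW.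
  move=> z; have [zx|zx] := pselect (lcell3 i x z); last first.
    rewrite (_ : lcell3 i x `&` _ = set0) ?integral_set0//.
    apply/seteqP; split => // y [/= yx yz]; apply: zx.
    by move: yx; rewrite /level_cell3 /cell3 /= yz.
  rewrite (_ : lcell3 i x `&` _ = lcell i z); last first.
    apply/setIidPr => y yz; move: zx.
    by rewrite /level_cell3 /cell3 /= yz.
  rewrite (integral_lcell_cst s0) leNgt -EFinM; apply/negP => Hz; apply: N; exists z => //.
  split => //; have := lcell3_le s0 ij zx.
  by rewrite /level_cell3 /cell3 /= xx0.
rewrite muleCA; apply: lee_wpmul2l; first by rewrite lee_fin exprn_ge0.
rewrite -(integral_cst mu mV).
rewrite (_ : V = V `&` lcell3 j x0); last by apply/esym/setIidPl => x [i _ []].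
have m3 := measurable_lcell3 s0 j x0.
apply: (le_integral_cells (lev_gt0 j s0)) => //.
- exact: measurableI.
- by move=> y _; rewrite lee_fin ltW.
- exact: measurable_funTS.
move=> z; have [zx|zx] := pselect (lcell3 j x0 z); last first.
  rewrite (_ : _ `&` lcell3 j x0 `&` _ = set0) ?integral_set0 ?integral_ge0//.
  apply/seteqP; split => // y [/= [_ yx] yz]; apply: zx.
  by move: yx; rewrite /level_cell3 /cell3 /= yz.
rewrite (_ : lcell3 j x0 `&` _ = lcell j z); last first.
  apply/setIidPr => y yz; move: zx.
  by rewrite /level_cell3 /cell3 /= yz.
apply: le_trans (dyadic_weak_type s0 j z t0 mg g0).
rewrite integral_cst; last first.
  by apply: measurableI; [exact: measurableI|exact: measurable_cell (lev_gt0 j s0)].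
apply: lee_wpmul2l; first by rewrite lee_fin ltW.
apply: le_measure; rewrite ?inE.
- by apply: measurableI; [exact: measurableI|exact: measurable_cell (lev_gt0 j s0)].
- apply: measurableI; last exact: measurable_lcell.
  apply: (adapted_mset s0) => x y xy; apply/propext.
  by split => -[i ij H]; (exists i; first exact: ij); move: H; rewrite (eq_lcell0 i xy).
by move=> x [[[i ij [_ [_ Hi]]] _] xz]; split => //; exists i.
Qed.

Variables (c : nat -> E -> R).
Hypothesis c_levelwise : levelwise s c.
Hypothesis c_ge0 : forall j x, (0 <= c j x)%R.

Definition csum j x : R := (\sum_(i < j.+1) c i x)%R.

Lemma csum_ge0 j x : (0 <= csum j x)%R.
Proof. by apply: sumr_ge0. Qed.

Lemma csumS j x : (csum j.+1 x = csum j x + c j.+1 x)%R.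
Proof. by rewrite /csum big_ord_recr. Qed.

Lemma csum0 x : (csum 0 x = c 0 x)%R.
Proof. by rewrite /csum big_ord_recr /= big_ord0 add0r. Qed.

Lemma adapted_csum j : adapted s (csum j).
Proof.
move=> x y xy; apply: eq_bigr => i _; apply: c_levelwise.
exact: (idx_lev0 s0).
Qed.

Lemma measurable_csum_gt j v : measurable [set x | (v < csum j x)%R].
Proof. by apply: (adapted_mset s0) => x y /(adapted_csum j) ->. Qed.

Lemma c_le_csum j x : (c j x <= csum j x)%R.
Proof. by rewrite /csum big_ord_recr /= lerDr sumr_ge0. Qed.

Variables (J : nat) (L : R).
Hypothesis L_gt0 : (0 < L)%R.
Hypothesis carleson : forall j x0, (j <= J)%N ->
  \int[mu]_(x in lcell j x0) (csum j x)%:E <= (L * vol j)%:E.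

(** By induction on the level, as for John and Nirenberg: as long as the sum over the large
    cells stays below [v] one can pass to the sons, and once it exceeds [v] the Carleson
    bound and Chebyshev leave at most half of the cell for a further rise by [2 * L]. *)
Lemma carleson_halving j x0 (v : R) : (j <= J)%N -> (0 <= v)%R ->
  2%:E * mu ([set x | (v + 2 * L < csum j x)%R] `&` lcell j x0) <=
  mu ([set x | (v < csum j x)%R] `&` lcell j x0).
Proof.
move=> + v0.
have big k y w : (k <= J)%N -> (0 <= w)%R -> (w < c k y)%R ->
    2%:E * mu ([set x | (w + 2 * L < csum k x)%R] `&` lcell k y) <=
    mu ([set x | (w < csum k x)%R] `&` lcell k y).
  move=> kJ w0 wc.
  have -> : [set x | (w < csum k x)%R] `&` lcell k y = lcell k y.
    apply/setIidPr => x xy /=; apply: (lt_le_trans wc).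
    by rewrite -(c_levelwise xy); exact: c_le_csum.
  rewrite [leRHS](mu_lcell s0).
  have mS : measurable ([set x | (w + 2 * L < csum k x)%R] `&` lcell k y).
    by apply: measurableI; [exact: measurable_csum_gt|exact: measurable_lcell].
  rewrite -(@lee_pmul2l _ L%:E)// ?lte_fin// -EFinM; apply: le_trans (carleson y kJ).
  rewrite muleA -EFinM -(integral_cst mu mS).
  rewrite [leLHS]integral_mkcond [leRHS]integral_mkcond.
  apply: le_integral_nonneg => x _; rewrite /patch; case: ifPn => //.
    by move=> _; rewrite lee_fin mulr_ge0// ltW.
    rewrite inE => -[/= H xy]; rewrite mem_set// lee_fin; apply: ltW.
    by apply: le_lt_trans H; rewrite mulrC lerDr.
  by move=> _; case: ifP => //; rewrite lee_fin csum_ge0.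
elim: j x0 v v0 => [|j IH] x0 v v0 jJ.
  have [cv|cv] := ltP v (c 0 x0); first exact: big.
  rewrite (_ : [set x | _] `&` _ = set0) ?measure0 ?mule0//.
  apply/seteqP; split => // x [/= + xx0]; rewrite csum0 (c_levelwise xx0).
  by rewrite ltNge => /negP; apply; rewrite (le_trans cv)// lerDl mulr_ge0// ltW.
have [cv|cv] := ltP v (c j.+1 x0); first exact: big.
have h w : [set x | (w < csum j.+1 x)%R] `&` lcell j.+1 x0 =
           [set x | (w - c j.+1 x0 < csum j x)%R] `&` lcell j.+1 x0.
  by apply/seteqP; split => x [/= Hx xx0]; split => //=; move: Hx;
    rewrite csumS (c_levelwise xx0) ltrBlDr.
rewrite !h addrAC; apply: le_measure_sons => //; [exact: measurable_csum_gt..|].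
by move=> x xx0; apply: IH; [rewrite subr_ge0|exact: ltnW].
Qed.

Lemma carleson_exponential j x0 i : (j <= J)%N ->
  mu ([set x | (2 * L * i%:R < csum j x)%R] `&` lcell j x0) <= (2 ^- i * vol j)%:E.
Proof.
move=> jJ; elim: i => [|i IH].
  rewrite expr0 invr1 mul1r -(mu_lcell s0 j x0); apply: le_measure; rewrite ?inE//.
  - by apply: measurableI; [exact: measurable_csum_gt|exact: measurable_lcell].
  - exact: measurable_lcell.
have v0 : (0 <= 2 * L * i%:R)%R by rewrite !mulr_ge0// ltW.
have := le_trans (carleson_halving x0 jJ v0) IH.
rewrite (_ : (2 * L * i%:R + 2 * L = 2 * L * i.+1%:R)%R); last by rewrite -(natr1 i); ring.
rewrite -lee_pdivlMl// -EFinM => /le_trans; apply; rewrite lee_fin.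
by rewrite exprS invfM mulrA.
Qed.

(** * Weighted integrals of Carleson sums *)

(* [W] is a weight, and [D j x] the average over a cell of the tail integral that controls
   the weight of the small parts of the cell in the [C_p] condition *)
Variables (W : E -> \bar R) (D : nat -> E -> \bar R) (kap rho : R).
Hypothesis mW : measurable_fun [set: E] W.
Hypothesis W_ge0 : forall x, 0 <= W x.
Hypothesis D_ge0 : forall j x, 0 <= D j x.
Hypothesis D_levelwise : levelwise s D.
Hypothesis kap_ge0 : (0 <= kap)%R.
Hypothesis rho_itv : (0 < rho < 1)%R.
Hypothesis W_small : forall j x0 i (A : set E), (j <= J)%N -> measurable A ->
  A `<=` lcell j x0 -> mu A <= (2 ^- i * vol j)%:E ->
  \int[mu]_(x in A) W x <= (kap * rho ^+ i)%:E * (D j x0 * (vol j)%:E).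

Lemma c_le_L j x : (j <= J)%N -> (c j x <= L)%R.
Proof.
move=> jJ; rewrite -lee_fin -(@lee_pmul2r _ (vol j)%:E)// ?lte_fin ?vol_gt0//.
rewrite -[leRHS]EFinM; apply: le_trans (carleson x jJ).
rewrite -(integral_lcell_cst s0 j x); apply: le_integral_nonneg => y yx.
  by rewrite lee_fin.
by rewrite lee_fin -(c_levelwise yx) c_le_csum.
Qed.

Lemma csum_le_L j x : (j <= J)%N -> (csum j x <= L * j.+1%:R)%R.
Proof.
move=> jJ; rewrite mulr_natr -[j.+1 in leRHS]card_ord -sumr_const.
by apply: ler_sum => i _; apply: c_le_L; have := ltn_ord i; lia.
Qed.

(** A layer cake bound in steps of [2 * L], the natural scale of [carleson_halving]; the
    number of steps is bounded by the number of levels. *)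
Lemma integral_csum_layers (Phi : R -> R) (b0 : R) (b : nat -> R) j x0 :
  (j <= J)%N -> (forall r, (0 <= Phi r)%R) -> (0 <= b0)%R -> (forall i, (0 <= b i)%R) ->
  (forall r, (0 <= r <= 2 * L * j.+1%:R)%R ->
     (Phi r <= b0 + \sum_(i < j.+1) b i * ind (2 * L * i%:R < r)%R)%R) ->
  \int[mu]_(x in lcell j x0) ((Phi (csum j x))%:E * W x) <=
  b0%:E * \int[mu]_(x in lcell j x0) W x +
  \sum_(i < j.+1) (b i)%:E *
     \int[mu]_(x in [set x | (2 * L * i%:R < csum j x)%R] `&` lcell j x0) W x.
Proof.
move=> jJ Phi0 b00 bge0 H.
have mc := measurable_lcell s0 j x0.
have mWc : measurable_fun (lcell j x0) W by exact: measurable_funTS.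
pose q i x : \bar R := (b i)%:E * ((ind (2 * L * i%:R < csum j x)%R : R)%:E * W x).
have q0 i x : 0 <= q i x by rewrite !mule_ge0// lee_fin ?ind_ge0.
have mi i : measurable_fun (lcell j x0) (fun x => (ind (2 * L * i%:R < csum j x)%R : R)%:E).
  apply: measurable_funTS; apply: (adapted_measurable s0).
  by move=> x y /(adapted_csum j) ->.
have mq i : measurable_fun (lcell j x0) (q i).
  by apply: emeasurable_funM => //; apply: emeasurable_funM.
apply: (@le_trans _ _ (\int[mu]_(x in lcell j x0) (b0%:E * W x + \sum_(i < j.+1) q i x))).
  apply: le_integral_nonneg => x xx0; first by rewrite mule_ge0// lee_fin.
  have cH : (Phi (csum j x) <= b0 + \sum_(i < j.+1) b i * ind (2 * L * i%:R < csum j x))%R.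
    apply: H; rewrite csum_ge0 (le_trans (csum_le_L x jJ))// ler_wpM2r//.
    by rewrite mulrC ler_peMr ?ltW// ltr1n.
  apply: (@le_trans _ _ ((b0 + \sum_(i < j.+1) b i * ind (2 * L * i%:R < csum j x))%:E * W x)).
    by apply: lee_wpmul2r; rewrite // lee_fin.
  rewrite EFinD ge0_muleDl; last 2 first.
  - by rewrite lee_fin.
  - by rewrite lee_fin sumr_ge0// => i _; rewrite mulr_ge0// ind_ge0.
  apply: leeD => //; rewrite -sumEFin ge0_sume_distrl; last first.
    by move=> i _; rewrite lee_fin mulr_ge0// ind_ge0.
  by apply: lee_sum => i _; rewrite /q EFinM muleA.
rewrite ge0_integralD//; last 4 first.
- by move=> x _; rewrite mule_ge0.
- by apply: emeasurable_funM.
- by move=> x _; exact: sume_ge0.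
- exact: emeasurable_sum.
rewrite ge0_integralZl//.
rewrite ge0_integral_sum//; apply: leeD => //; apply: lee_sum => i _.
rewrite /q ge0_integralZl//; [|exact: emeasurable_funM|by move=> x _; rewrite mule_ge0// lee_fin ind_ge0|by rewrite lee_fin].
apply: lee_wpmul2l; first by rewrite lee_fin.
rewrite [leLHS]integral_mkcond [leRHS]integral_mkcond.
apply: le_integral_nonneg => x _; rewrite /patch.
  by case: ifP => // _; rewrite mule_ge0// lee_fin ind_ge0.
case: ifPn => [|_]; last by case: ifP.
rewrite inE => xx0; have [ci|ci] := pselect (2 * L * i%:R < csum j x)%R.
  by rewrite mem_set// indT// mul1e.
by rewrite indF// mul0e; case: ifP.
Qed.

Lemma integral_csum_tail j x0 i : (j <= J)%N ->
  \int[mu]_(x in [set x | (2 * L * i%:R < csum j x)%R] `&` lcell j x0) W x <=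
  (kap * rho ^+ i)%:E * (D j x0 * (vol j)%:E).
Proof.
move=> jJ; apply: W_small => //; last exact: carleson_exponential.
by apply: measurableI; [exact: measurable_csum_gt|exact: measurable_lcell].
Qed.

Lemma integral_csum_cell j x0 : (j <= J)%N ->
  \int[mu]_(x in lcell j x0) W x <= kap%:E * (D j x0 * (vol j)%:E).
Proof.
move=> jJ; rewrite -[kap]mulr1 -(expr0 rho); apply: W_small => //.
  exact: measurable_lcell.
by rewrite expr0 invr1 mul1r; have := mu_lcell s0 j x0 => ->.
Qed.

Let DV_ge0 j x : 0 <= D j x * (vol j)%:E.
Proof. by rewrite mule_ge0// lee_fin ltW// vol_gt0. Qed.

Let rho_ge0 : (0 <= rho)%R. Proof. by case/andP: rho_itv => /ltW. Qed.

(** The weight of the layers decays like [rho ^ i], hence [Phi] may grow exponentially. *)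
Lemma integral_csum_Phi (Phi : R -> R) (b0 : R) (b : nat -> R) (B : R) j x0 :
  (j <= J)%N -> (forall r, (0 <= Phi r)%R) -> (0 <= b0)%R -> (forall i, (0 <= b i)%R) ->
  (forall r N, (0 <= r <= 2 * L * N%:R)%R ->
     (Phi r <= b0 + \sum_(i < N) b i * ind (2 * L * i%:R < r)%R)%R) ->
  (forall N, (\sum_(i < N) b i * rho ^+ i <= B)%R) ->
  \int[mu]_(x in lcell j x0) ((Phi (csum j x))%:E * W x) <=
  ((b0 + B) * kap)%:E * (D j x0 * (vol j)%:E).
Proof.
move=> jJ Phi0 b00 bge0 H HB.
apply: le_trans (integral_csum_layers x0 jJ Phi0 b00 bge0 (fun r => @H r _)) _.
have B0 : (0 <= B)%R by have := HB 0%N; rewrite big_ord0.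
have -> : ((b0 + B) * kap)%:E = (b0 * kap)%:E + (B * kap)%:E by rewrite -EFinD mulrDl.
rewrite ge0_muleDl ?lee_fin ?mulr_ge0//; apply: leeD.
  rewrite EFinM -muleA; apply: lee_wpmul2l; first by rewrite lee_fin.
  exact: integral_csum_cell.
apply: (@le_trans _ _ (\sum_(i < j.+1) (b i * rho ^+ i * kap)%:E * (D j x0 * (vol j)%:E))).
  apply: lee_sum => i _; rewrite -(mulrA (b i)) (mulrC (rho ^+ i)%R) (EFinM (b i)) -(muleA (b i)%:E).
  by apply: lee_wpmul2l; [rewrite lee_fin|exact: integral_csum_tail].
rewrite -ge0_sume_distrl; last first.
  by move=> i _; rewrite lee_fin !mulr_ge0// exprn_ge0.
apply: lee_wpmul2r => //; rewrite sumEFin lee_fin -mulr_suml ler_wpM2r//.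
Qed.

(** Cutting at height [2 * L * M]: the low part only costs the weight of the cell,
    without its tail, and the cost of the high part is small for large [M]. *)
Lemma integral_csum_cut M j x0 : (j <= J)%N ->
  \int[mu]_(x in lcell j x0) ((csum j x)%:E * W x) <=
  (2 * L * M%:R)%:E * \int[mu]_(x in lcell j x0) W x +
  (2 * L * kap * rho ^+ M / (1 - rho))%:E * (D j x0 * (vol j)%:E).
Proof.
move=> jJ; have /andP[rho0 rho1] := rho_itv.
have L2 : (0 <= 2 * L)%R by rewrite mulr_ge0// ltW.
pose Phi (r : R) := (Num.max r 0)%R.
have -> : \int[mu]_(x in lcell j x0) ((csum j x)%:E * W x) =
          \int[mu]_(x in lcell j x0) ((Phi (csum j x))%:E * W x).
  by apply: eq_integral => x _; rewrite /Phi max_l// csum_ge0.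
pose a0 := (2 * L * M%:R)%R; pose a i : R := if (i < M)%N then 0%R else (2 * L)%R.
have a0ge0 : (0 <= a0)%R by rewrite mulr_ge0.
have age0 i : (0 <= a i)%R by rewrite /a; case: ifP.
have H N r : (0 <= r <= 2 * L * N%:R)%R ->
   (Phi r <= a0 + \sum_(i < N) a i * ind (2 * L * i%:R < r))%R.
  move=> /andP[r0 rN]; rewrite /Phi max_l//.
  elim: N rN => [|N IH] rN; first by rewrite big_ord0 addr0 (le_trans rN)// mulr0.
  have [NM|MN] := leqP N.+1 M.
    apply: (@le_trans _ _ a0).
      by apply: (le_trans rN); rewrite /a0 ler_wpM2l// ler_nat.
    by rewrite lerDl sumr_ge0// => i _; rewrite mulr_ge0// ind_ge0.
  rewrite big_ord_recr /=; have [Nr|rN'] := ltP (2 * L * N%:R)%R r; last first.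
    by rewrite indF ?mulr0 ?addr0 ?IH//; apply/negP; rewrite -leNgt.
  rewrite indT// mulr1 {2}/a ltnNge -ltnS MN /=.
  rewrite addrA; apply: (@le_trans _ _ (2 * L * N%:R + 2 * L)%R).
    by apply: (le_trans rN); rewrite -(natr1 N) mulrDr mulr1.
  rewrite lerD2r.
  have -> : (2 * L * N%:R = 2 * L * M%:R + \sum_(i < N) a i)%R.
    have : (M <= N)%N by [].
    elim: {IH MN rN Nr} N => [|N IH].
      by rewrite leqn0 => /eqP ->; rewrite big_ord0 addr0.
    have [NM|MN _] := ltnP N M.
      move=> MN; have -> : M = N.+1 by lia.
      rewrite big1 ?addr0// => i _; rewrite /a ifT//.
      by apply: leq_trans NM; have := ltn_ord i; lia.
    rewrite big_ord_recr /= addrA -IH// /a ltnNge MN /=.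
    by rewrite -(natr1 N); ring.
  rewrite lerD2l; apply: ler_sum => i _; rewrite indT ?mulr1//.
  by apply: le_lt_trans Nr; rewrite ler_wpM2l// ler_nat ltnW.
apply: le_trans (integral_csum_layers x0 jJ _ a0ge0 age0 (@H _)) _.
  by move=> r; rewrite /Phi le_max lexx orbT.
apply: leeD => //.
apply: (@le_trans _ _ (\sum_(i < j.+1) (a i * rho ^+ i * kap)%:E * (D j x0 * (vol j)%:E))).
  apply: lee_sum => i _; rewrite -(mulrA (a i)) (mulrC (rho ^+ i)%R) (EFinM (a i)) -(muleA (a i)%:E).
  by apply: lee_wpmul2l; [rewrite lee_fin|exact: integral_csum_tail].
rewrite -ge0_sume_distrl; last first.
  by move=> i _; rewrite lee_fin !mulr_ge0// exprn_ge0.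
apply: lee_wpmul2r => //; rewrite sumEFin lee_fin -mulr_suml.
have geo N : (\sum_(i < N) a i * rho ^+ i * (1 - rho) + 2 * L * rho ^+ maxn N M =
              2 * L * rho ^+ M)%R.
  elim: N => [|N IH]; first by rewrite big_ord0 add0r max0n.
  rewrite big_ord_recr /= -IH /a; case: ltnP => NM.
    by rewrite !(maxn_idPr _) ?(ltnW NM)// !mul0r addr0.
  by rewrite !(maxn_idPl _) ?(leqW NM)// exprS; ring.
have -> : (2 * L * kap * rho ^+ M / (1 - rho) = 2 * L * rho ^+ M / (1 - rho) * kap)%R by ring.
apply: ler_wpM2r => //; rewrite ler_pdivlMr ?subr_gt0// mulr_suml.
by rewrite -(geo j.+1) lerDl mulr_ge0// exprn_ge0.
Qed.

End exponential.

(** * Stopping cells *)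

Section powers.
Context {R : realType}.

Lemma le_poweR (r : R) (x y : \bar R) : (0 <= r)%R -> 0 <= x -> x <= y -> x `^ r <= y `^ r.
Proof.
move=> r0 x0 xy; apply: gt0_ler_poweR => //.
  by rewrite in_itv /= x0 leey.
by rewrite in_itv /= (le_trans x0 xy) leey.
Qed.

Lemma le_powR (r x y : R) : (0 <= r)%R -> (0 <= x)%R -> (x <= y)%R -> (x `^ r <= y `^ r)%R.
Proof.
by move=> r0 x0 xy; apply: ge0_ler_powR => //; rewrite nnegrE // (le_trans x0 xy).
Qed.

Lemma powR_gt1 (r x : R) : (0 < r)%R -> (1 < x)%R -> (1 < x `^ r)%R.
Proof.
move=> r0 x1; have := @gt0_ltr_powR R r r0 1%R x; rewrite powR1; apply => //.
- by rewrite nnegrE.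
- by rewrite nnegrE ltW// (lt_trans ltr01).
Qed.

(** An induction on the number of terms absorbs the sum on the right even when its terms are
    infinite. *)
Lemma sum_absorb (u v : nat -> \bar R) K :
  (forall k, 0 <= u k) -> (forall k, 0 <= v k) ->
  (forall k, u k.+1 <= v k + 2^-1%:E * u k) ->
  \sum_(k < K) u k <= 2%:E * (u 0%N + \sum_(k < K) v k).
Proof.
move=> u0 v0 H.
have su N : 0 <= \sum_(k < N) u k by exact: sume_ge0.
have sv N : 0 <= \sum_(k < N) v k by exact: sume_ge0.
elim: K => [|K IH]; first by rewrite !big_ord0 mule_ge0// adde_ge0.
rewrite big_ord_recl /=.
apply: (@le_trans _ _ (u 0%N + (\sum_(k < K) v k + 2^-1%:E * \sum_(k < K) u k))).
  apply: leeD => //; rewrite ge0_sume_distrr// -big_split /=.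
  by apply: lee_sum => k _; exact: H.
apply: (@le_trans _ _ (u 0%N + (\sum_(k < K) v k + (u 0%N + \sum_(k < K) v k)))).
  apply: leeD => //; apply: leeD => //.
  apply: (@le_trans _ _ (2^-1%:E * (2%:E * (u 0%N + \sum_(k < K) v k)))).
    by apply: lee_wpmul2l.
  by rewrite muleA -EFinM mulVf// mul1e.
rewrite addeA mule_natl mule2n.
by apply: leeD; apply: leeD => //; rewrite big_ord_recr /= leeDl.
Qed.

End powers.

Section leap_inequalities.
Context {R : realType}.
Implicit Types C K T v x y z t : R.

Let dist3 x y z : (`|x - z| <= `|x - y| + `|y - z|)%R.
Proof. by rewrite (le_trans _ (ler_normD _ _))// addrA subrK. Qed.

Lemma leap_bound C K T v v' x y z t : (0 <= K)%R -> (v' <= v)%R ->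
  (`|x - y| <= C * v)%R -> (`|y - z| <= K * v')%R -> (`|z - t| <= (C + K) * T)%R ->
  (`|x - t| <= (C + K) * (v + T))%R.
Proof.
move=> K0 vv xy yz zt; apply: (le_trans (dist3 x z t)).
rewrite mulrDr lerD//; apply: (le_trans (dist3 x y z)).
by rewrite mulrDl lerD// (le_trans yz)// ler_wpM2l.
Qed.

Lemma last_leap_bound C K T v x z t : (0 <= K)%R -> (v <= T)%R ->
  (`|x - z| <= K * v)%R -> (`|z - t| <= (C + K) * T)%R ->
  (`|x - t| <= (C + 2 * K) * T)%R.
Proof.
move=> K0 vT xz zt; apply: (le_trans (dist3 x z t)).
have -> : ((C + 2 * K) * T = K * T + (C + K) * T)%R by ring.
by rewrite lerD// (le_trans xz)// ler_wpM2l.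
Qed.

Lemma half_absorb x y : (x <= y + 2^-1 * x)%R -> (x <= 2 * y)%R.
Proof. by move=> xy; lra. Qed.

End leap_inequalities.

Section stopping.
Context {R : realType} {n : nat}.
Local Notation E := (euclid R n).
Local Notation mu := (lebesgue R n).
Variable s : R.
Hypothesis s0 : (0 < s)%R.
Local Notation lcell := (level_cell s).
Local Notation vol := (@vol R n s).
Implicit Types (x y : E) (i j d : nat).
Variables (J : nat) (a m : nat -> E -> R) (C1 Cm delta : R).
Hypothesis a_levelwise : levelwise s a.
Hypothesis a_gt0 : forall j x, (0 < a j x)%R.
Hypothesis a_dec : forall j x, (a j.+1 x <= a j x)%R.
Hypothesis C1_ge0 : (0 <= C1)%R.
Hypothesis a_weak : forall j x l, (j <= J)%N -> (a j x < l)%R ->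
  mu ([set y | exists2 i, (i <= j)%N & (l <= a i y)%R] `&` lcell j x) <=
  (C1 * a j x / l * vol j)%:E.
Hypothesis m_levelwise : levelwise s m.
Hypothesis delta_gt0 : (0 < delta)%R.
Hypothesis Cm_ge0 : (0 <= Cm)%R.
Hypothesis m_step : forall j x, (j < J)%N -> (`|m j x - m j.+1 x| <= Cm * a j x `^ delta)%R.
Hypothesis m_weak : forall j x t, (j <= J)%N -> (0 < t)%R ->
  mu ([set y | exists2 i, (i <= j)%N & (t < `|m i y - m j x|)%R] `&` lcell j x) <=
  (Cm * a j x `^ delta / t * vol j)%:E.

(** The constants [leap_ratio] and [leap_const] are such that at most half of a cell is covered by
    smaller cells at which one of the two conditions of [leap] holds. *)
Definition leap_ratio : R := (4 * C1 + 2)%R.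
Definition leap_const : R := (4 * Cm + 1)%R.

Lemma leap_ratio_gt1 : (1 < leap_ratio)%R.
Proof. by rewrite /leap_ratio ltr_wpDl// ?mulr_ge0// ltr1n. Qed.

Lemma leap_const_gt0 : (0 < leap_const)%R.
Proof. by rewrite /leap_const ltr_wpDl// mulr_ge0. Qed.

Definition leap l j x : Prop :=
  (leap_ratio * a l x <= a j x)%R \/ (leap_const * a l x `^ delta < `|m j x - m l x|)%R.

(** The stopping cells are found from the largest cell downwards, so the recursion is on the depth [d]
    and the level visited is [J - d]; the value is the level of the last stop. *)
Fixpoint cur d x : nat :=
  if d is d'.+1 then
    if `[< leap (cur d' x) (J - d) x >] then (J - d)%N else cur d' x
  else J.

Definition stp j x : R := ind ((j <= J)%N /\ cur (J - j)%N x = j).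

Lemma a_le i j x : (i <= j)%N -> (a j x <= a i x)%R.
Proof.
by move=> /subnK <-; elim: (j - i)%N => // d IH; exact: le_trans (a_dec _ _) IH.
Qed.

Lemma cur_ge d x : (J - d <= cur d x)%N.
Proof.
elim: d => [|d IH] /=; first by rewrite subn0.
by case: ifP => // _; apply: leq_trans IH; rewrite leq_sub2l.
Qed.

Lemma cur_levelwise d x y : idx (s * 2 ^+ (J - d))%R x = idx (s * 2 ^+ (J - d))%R y ->
  cur d x = cur d y.
Proof.
elim: d => [//|d IH] xy /=.
have h i : (J - d.+1 <= i)%N -> a i x = a i y /\ m i x = m i y.
  move=> ji; have := idx_lev s0 ji xy => e.
  by split; [exact: a_levelwise|exact: m_levelwise].
have e : cur d x = cur d y.
  by apply: IH; apply: idx_lev xy => //; rewrite leq_sub2l.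
suff -> : leap (cur d x) (J - d.+1) x = leap (cur d y) (J - d.+1) y by rewrite e.
have jc : (J - d.+1 <= cur d y)%N by apply: leq_trans (cur_ge d y); rewrite leq_sub2l.
have [a1 m1] := h _ (leqnn _); have [a2 m2] := h _ jc.
by rewrite /leap e a1 a2 m1 m2.
Qed.

Lemma stp_levelwise : levelwise s stp.
Proof.
move=> j x y xy; rewrite /stp; have [jJ|Jj] := leqP j J; last first.
  by rewrite !indF// => -[].
by rewrite (@cur_levelwise (J - j) x y) ?subKn.
Qed.

Lemma stp_ge0 j x : (0 <= stp j x)%R. Proof. exact: ind_ge0. Qed.

(** Between two consecutive stops there is a leap from the first one. *)
Lemma cur_leap j d x : (j <= J)%N -> cur (J - j)%N x = j -> cur (J - j + d)%N x <> j ->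
  exists2 i, (i <= j)%N & leap j i x.
Proof.
move=> jJ cj; elim: d => [|d IH]; first by rewrite addn0.
have [c|c] := eqVneq (cur (J - j + d)%N x) j; last by move=> _; apply: IH; exact/eqP.
rewrite addnS /= c; case: asboolP => // l _.
by exists (J - (J - j + d).+1)%N => //; lia.
Qed.

(** At least half of a stopping cell contains no further stop, by the two weak type estimates. *)
Lemma stp_final j x0 : (j <= J)%N -> cur (J - j)%N x0 = j ->
  mu (lcell j x0) <= 2%:E * mu ([set x | cur J x = j] `&` lcell j x0).
Proof.
move=> jJ cj.
have mc := measurable_lcell s0 j x0.
have mF : measurable [set x | cur J x = j].
  apply: (adapted_mset s0) => x y /(idx_lev0 s0 0) xy; apply/propext.
  by rewrite (@cur_levelwise J x y)// subnn.
have adW (P : nat -> E -> Prop) : (forall i x y, idx s x = idx s y -> P i x = P i y) ->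
    measurable ([set x | exists2 i, (i <= j)%N & P i x] `&` lcell j x0).
  move=> eP; apply: measurableI => //; apply: (adapted_mset s0) => x y xy; apply/propext.
  by split => -[i ij Pi]; exists i => //; [rewrite -(eP i x y)|rewrite (eP i x y)].
have ea i x y : idx s x = idx s y -> a i x = a i y.
  by move=> /(idx_lev0 s0 i); exact: a_levelwise.
have em i x y : idx s x = idx s y -> m i x = m i y.
  by move=> /(idx_lev0 s0 i); exact: m_levelwise.
pose A1 := [set x | exists2 i, (i <= j)%N & (leap_ratio * a j x0 <= a i x)%R] `&` lcell j x0.
pose A2 := [set x | exists2 i, (i <= j)%N & (leap_const * a j x0 `^ delta < `|m i x - m j x0|)%R] `&` lcell j x0.
have mA1 : measurable A1 by apply: adW => i x y /ea ->.
have mA2 : measurable A2 by apply: adW => i x y /em ->.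
have Ba1 := leap_ratio_gt1.
have Km0 := leap_const_gt0.
have ad0 : (0 < a j x0 `^ delta)%R by exact: powR_gt0.
have A1le : mu A1 <= (4^-1 * vol j)%:E.
  apply: (le_trans (a_weak jJ _)); first by rewrite ltr_pMl.
  rewrite lee_fin ler_wpM2r ?(ltW (vol_gt0 _ _))// ler_pdivrMr; last by rewrite mulr_gt0// (lt_trans ltr01).
  rewrite mulrA ler_wpM2r ?(ltW (a_gt0 _ _))//.
  by rewrite /leap_ratio mulrDr mulrA mulVf// mul1r lerDl mulr_ge0// invr_ge0.
have A2le : mu A2 <= (4^-1 * vol j)%:E.
  apply: (le_trans (m_weak x0 jJ (mulr_gt0 Km0 ad0))).
  rewrite lee_fin ler_wpM2r ?(ltW (vol_gt0 _ _))// ler_pdivrMr ?mulr_gt0//.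
  rewrite mulrA ler_wpM2r ?(ltW ad0)//.
  by rewrite /leap_const mulrDr mulrA mulVf// mul1r lerDl mulr_ge0// invr_ge0.
have sub : lcell j x0 `<=` ([set x | cur J x = j] `&` lcell j x0) `|` (A1 `|` A2).
  move=> x xx0; have [c|c] := pselect (cur J x = j); first by left.
  right; have cx : cur (J - j)%N x = j by rewrite (@cur_levelwise _ x x0) ?subKn.
  have [|i ij [l|l]] := @cur_leap j j x jJ cx; first by rewrite subnK.
    by left; split => //; exists i => //; rewrite (a_levelwise (esym xx0)).
  by right; split => //; exists i => //; rewrite (a_levelwise (esym xx0)) (m_levelwise (esym xx0)).
have mFx : measurable ([set x | cur J x = j] `&` lcell j x0) by exact: measurableI.
have le1 : mu (lcell j x0) <= mu ([set x | cur J x = j] `&` lcell j x0) + (2^-1 * vol j)%:E.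
  apply: (@le_trans _ _ (mu (([set x | cur J x = j] `&` lcell j x0) `|` (A1 `|` A2)))).
    by apply: le_measure; rewrite ?inE//; apply: measurableU => //; exact: measurableU.
  apply: le_trans (measureU2 _ _ _) _ => //; first exact: measurableU.
  apply: leeD => //; apply: le_trans (measureU2 _ _ _) _ => //.
  have -> : (2^-1 * vol j)%:E = (4^-1 * vol j)%:E + (4^-1 * vol j)%:E :> \bar R.
    by rewrite -EFinD; congr EFin; field.
  exact: leeD.
have volE : mu (lcell j x0) = (vol j)%:E by exact: mu_lcell.
move: le1; rewrite volE.
case: (mu (_ `&` _)) (measure_ge0 mu ([set x | cur J x = j] `&` lcell j x0)) => [r| |] //= r0.
  by rewrite -EFinD -EFinM !lee_fin => /half_absorb.
by move=> _; rewrite mulry gtr0_sg// mul1e leey.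
Qed.

(** The final parts of the stopping cells are disjoint and fill half of each. *)
Lemma stp_carleson j x0 : (j <= J)%N ->
  \int[mu]_(x in lcell j x0) (csum stp j x)%:E <= (2 * vol j)%:E.
Proof.
move=> jJ; have mc := measurable_lcell s0 j x0.
pose q i x : R := (2 * ind (cur J x = i))%R.
have q0 i x : (0 <= q i x)%R by rewrite mulr_ge0// ind_ge0.
have mcur i : measurable [set x | cur J x = i].
  apply: (adapted_mset s0) => x y /(idx_lev0 s0 0) xy; apply/propext.
  by rewrite (@cur_levelwise J x y)// subnn.
have mq i S : measurable_fun S (fun x => (q i x)%:E).
  apply: measurable_funTS; apply: (adapted_measurable s0) => x y /(idx_lev0 s0 0) xy.
  by rewrite /q (@cur_levelwise J x y)// subnn.
have ms i S : measurable_fun S (fun x => (stp i x)%:E).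
  apply: measurable_funTS; apply: (adapted_measurable s0) => x y /(idx_lev0 s0 i) xy.
  by rewrite (stp_levelwise xy).
under eq_integral do rewrite /csum -sumEFin.
rewrite ge0_integral_sum//; last by move=> i x _; rewrite lee_fin stp_ge0.
apply: (@le_trans _ _ (\sum_(i < j.+1) \int[mu]_(x in lcell j x0) (q i x)%:E)).
  apply: lee_sum => i _; have ij : (i <= j)%N by rewrite -ltnS.
  apply: (le_integral_cells (lev_gt0 i s0)) => //.
    by move=> x _; rewrite lee_fin stp_ge0.
    by move=> x _; rewrite lee_fin.
  move=> z; rewrite -/(lcell i z).
  have [zx|zx] := pselect (lcell j x0 z); last first.
    rewrite (_ : lcell j x0 `&` _ = set0) ?integral_set0//.
    apply/seteqP; split => // y [/= yx yz]; apply: zx.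
    by move: (lcell_le s0 ij yz) yx; rewrite /level_cell/cell/= => ->.
  rewrite (_ : lcell j x0 `&` _ = lcell i z); last first.
    apply/setIidPr => y yz; move: (lcell_le s0 ij yz) zx.
    by rewrite /level_cell/cell/= => ->.
  have mz := measurable_lcell s0 i z.
  have [cz|cz] := pselect ((i <= J)%N /\ cur (J - i)%N z = i); last first.
    rewrite integral0_eq; first by apply: integral_ge0 => x _; rewrite lee_fin.
    by move=> x xz; rewrite (stp_levelwise xz) /stp indF.
  apply: (@le_trans _ _ (mu (lcell i z))).
    rewrite -[leRHS]mul1e -(integral_cst mu mz).
    by apply: le_integral_nonneg => x _; rewrite lee_fin ?stp_ge0 ?ind_le1.
  case: cz => iJ cz; apply: (le_trans (stp_final iJ cz)).
  rewrite /q; under eq_integral do rewrite EFinM.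
  rewrite ge0_integralZl//; last 2 first.
  - by apply: measurable_funTS; under eq_fun do rewrite -(indE [set x | cur J x = i]);
      exact/measurable_EFinP/measurable_indic.
  - by move=> x _; rewrite lee_fin ind_ge0.
  apply: lee_wpmul2l; first by rewrite lee_fin.
  by rewrite -(integral_ind mz (mcur i)).
rewrite -ge0_integral_sum//; last by move=> i x _; rewrite lee_fin.
rewrite EFinM -(integral_lcell_cst s0 j x0 2%:E); apply: le_integral_nonneg => x _.
  by apply: sume_ge0 => i _; rewrite lee_fin.
rewrite sumEFin lee_fin -mulr_sumr -[leRHS]mulr1 ler_wpM2l//.
have [cj|cj] := ltnP (cur J x) j.+1.
  rewrite (bigD1 (Ordinal cj))//= indT// big1 ?addr0// => i ij; rewrite indF// => ci.
  by move/eqP: ij; apply; apply/val_inj.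
rewrite big1// => i _; rewrite indF// => ci; have := ltn_ord i.
by rewrite -ci ltnNge cj.
Qed.

Let v j x := (a j x `^ delta)%R.

Let v_ge0 j x : (0 <= v j x)%R. Proof. exact: powR_ge0. Qed.

Let v_le i j x : (i <= j)%N -> (v j x <= v i x)%R.
Proof.
by move=> ij; apply: le_powR; [exact: ltW|exact: ltW|exact: a_le].
Qed.

Definition stop_const : R := (Cm + 2 * leap_const)%R.

(** Before the next stop the average has moved little; at the stop it may jump, but only by
    one step of the grid. *)
Lemma stp_domination x :
  (`|m 0 x - m J x| <= stop_const * \sum_(i < J.+1) stp i x * a i x `^ delta)%R.
Proof.
pose T d := (\sum_(J - d <= i < J.+1) stp i x * v i x)%R.
have T_ge0 d : (0 <= T d)%R.
  by apply: sumr_ge0 => i _; rewrite mulr_ge0 ?stp_ge0 ?v_ge0.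
have Km0 := ltW leap_const_gt0.
have TS d : (d < J)%N -> (T d.+1 = stp (J - d.+1)%N x * v (J - d.+1)%N x + T d)%R.
  move=> dJ; rewrite /T big_ltn; last by rewrite ltnS leq_subr.
  by rewrite -subSn// subSS.
have main d : (d <= J)%N ->
   [/\ (`|m (cur d x) x - m J x| <= (Cm + leap_const) * T d)%R,
       (`|m (J - d)%N x - m (cur d x) x| <= leap_const * v (cur d x) x)%R &
       (v (cur d x) x <= T d)%R].
  elim: d => [|d IH] dJ.
    rewrite /= subn0 !subrr normr0; split; rewrite ?mulr_ge0//; first exact: addr_ge0.
    by rewrite /T subn0 big_nat1 /stp subnn /= indT// mul1r.
  have [I1 I2 I3] := IH (ltnW dJ).
  have jJ : (J - d.+1 <= J)%N by exact: leq_subr.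
  have cd : (J - d.+1 <= cur d x)%N.
    by apply: leq_trans (cur_ge d x); rewrite leq_sub2l.
  have jS : ((J - d.+1).+1 = J - d)%N by rewrite -subSn// subSS.
  have curS : cur d.+1 x = if `[< leap (cur d x) (J - d.+1)%N x >] then (J - d.+1)%N else cur d x by [].
  rewrite curS TS//; case: asboolP => [l|Nl].
    have s1 : stp (J - d.+1)%N x = 1%R.
      by rewrite /stp indT//; split => //; rewrite subKn// curS asboolT.
    rewrite s1 mul1r subrr normr0; split.
    - have jlt : (J - d.+1 < J)%N by rewrite ltn_subrL (leq_ltn_trans _ dJ).
      have := m_step x jlt; rewrite jS => h1.
      exact: leap_bound (v_le x cd) h1 I2 I1.
    - by rewrite mulr_ge0.
    - by rewrite lerDl.
  have sv0 : (0 <= stp (J - d.+1)%N x * v (J - d.+1)%N x)%R by rewrite mulr_ge0 ?stp_ge0.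
  split.
  - by apply: (le_trans I1); rewrite ler_wpM2l ?lerDr// addr_ge0.
  - by rewrite leNgt; apply/negP => h; apply: Nl; right.
  - by apply: (le_trans I3); rewrite lerDr.
have [I1 I2 I3] := main J (leqnn J).
rewrite subnn in I2.
have TE : T J = (\sum_(i < J.+1) stp i x * a i x `^ delta)%R.
  by rewrite /T subnn big_mkord.
by rewrite -TE; exact: last_leap_bound I3 I2 I1.
Qed.

End stopping.

(** * Powers of sums *)

Section zero_one_sequences.
Context {R : realType}.
Variables (r : R) (g C : R).
Hypothesis r_gt0 : (0 < r)%R.
Hypothesis g_gt1 : (1 < g)%R.

(** If [v] is at most a small multiple of [u] it is absorbed in the factor [g], otherwise [v] dominates. *)
Lemma powR_split : exists C', (0 <= C')%R /\ forall u v : R, (0 <= u)%R -> (0 <= v)%R ->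
  ((u + v) `^ r <= g * u `^ r + C' * v `^ r)%R.
Proof.
have g0 : (0 < g)%R by rewrite (lt_trans ltr01).
pose e := (g `^ r^-1 - 1)%R.
have e0 : (0 < e)%R by rewrite subr_gt0; apply: powR_gt1; rewrite ?invr_gt0.
exists ((1 + e^-1) `^ r)%R; split; first exact: powR_ge0.
move=> u v u0 v0; have [vu|uv] := leP v (e * u)%R.
  apply: (@le_trans _ _ (g * u `^ r)%R); last by rewrite lerDl mulr_ge0 ?powR_ge0.
  have -> : (g * u `^ r = ((1 + e) * u) `^ r)%R.
    have -> : (1 + e = g `^ r^-1)%R by rewrite /e addrC subrK.
    by rewrite powRM ?powR_ge0// -powRrM mulVf ?gt_eqF// powRr1// ltW.
  by apply: le_powR; rewrite ?addr_ge0 ?(ltW r_gt0)// mulrDl mul1r lerD2l.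
apply: (@le_trans _ _ ((1 + e^-1) `^ r * v `^ r)%R); last by rewrite lerDr mulr_ge0 ?powR_ge0 ?ltW.
rewrite -powRM ?addr_ge0 ?invr_ge0 ?ler01 ?(ltW e0)//.
apply: le_powR; rewrite ?addr_ge0 ?(ltW r_gt0)// mulrDl mul1r addrC lerD2l.
by rewrite ler_pdivlMl// ltW.
Qed.

Hypothesis C_ge0 : (0 <= C)%R.
Hypothesis splitC : forall u v : R, (0 <= u)%R -> (0 <= v)%R ->
  ((u + v) `^ r <= g * u `^ r + C * v `^ r)%R.
Variable (c v : nat -> R).
Hypothesis c01 : forall i, c i = 0%R \/ c i = 1%R.
Hypothesis v_ge0 : forall i, (0 <= v i)%R.

Let c_ge0 i : (0 <= c i)%R. Proof. by case: (c01 i) => ->. Qed.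

(** By iteration of [powR_split] from the first term on: each nonzero term costs a factor [g]
    for all the later ones. *)
Lemma powR_sum01 J : ((\sum_(i < J.+1) c i * v i) `^ r <=
  C * \sum_(i < J.+1) c i * g `^ (\sum_(l < i.+1) c l) * v i `^ r)%R.
Proof.
have g0 : (0 <= g)%R by rewrite ltW// (lt_trans ltr01).
pose S j := (\sum_(l < j) c l)%R.
pose T j := (\sum_(j <= i < J.+1) c i * v i)%R.
pose U j := (\sum_(j <= i < J.+1) c i * g `^ (S i.+1) * v i `^ r)%R.
have T0 j : (0 <= T j)%R by apply: sumr_ge0 => i _; rewrite mulr_ge0.
have U0 j : (0 <= U j)%R by apply: sumr_ge0 => i _; rewrite !mulr_ge0 ?powR_ge0.
have SS j : (S j.+1 = S j + c j)%R by rewrite /S big_ord_recr.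
suff main d : (d <= J.+1)%N -> (g `^ S (J.+1 - d)%N * T (J.+1 - d)%N `^ r <= C * U (J.+1 - d)%N)%R.
  have := main J.+1 (leqnn _); rewrite subnn {1}/S big_ord0 powRr0 mul1r.
  by rewrite /T /U !big_mkord.
elim: d => [|d IH] dJ.
  by rewrite subn0 /T /U !big_geq// powR0 ?gt_eqF// !mulr0.
have := IH (ltnW dJ); set j := (J.+1 - d.+1)%N.
have -> : (J.+1 - d = j.+1)%N by rewrite /j -subSn// subSS.
have jJ : (j < J.+1)%N by rewrite /j ltn_subrL.
have TE : T j = (c j * v j + T j.+1)%R by rewrite /T big_ltn.
have UE : U j = (c j * g `^ (S j.+1) * v j `^ r + U j.+1)%R by rewrite /U big_ltn.
rewrite TE UE mulrDr SS; case: (c01 j) => ->.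
  by rewrite !mul0r !add0r mulr0 add0r addr0.
rewrite !mul1r powRD ?powRr1//; last by apply/implyP => _; rewrite gt_eqF// (lt_trans ltr01).
move=> IHj; rewrite addrC (@le_trans _ _ (g `^ S j * (g * T j.+1 `^ r + C * v j `^ r))%R)//.
  by rewrite ler_wpM2l ?powR_ge0// splitC.
rewrite mulrDr [leRHS]addrC lerD//; first by rewrite mulrA.
have -> : (C * (g `^ S j * g * v j `^ r) = g * (g `^ S j * (C * v j `^ r)))%R by ring.
by apply: ler_peMl; rewrite ?(ltW g_gt1)// !mulr_ge0 ?powR_ge0.
Qed.

(** A geometric sum, as the partial sums of the nonzero terms are [1], [2] and so on. *)
Lemma sum01_count T : (\sum_(i < T.+1) c i * g `^ (\sum_(l < i.+1) c l) <=
  g / (g - 1) * g `^ (\sum_(l < T.+1) c l))%R.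
Proof.
have g0 : (0 < g)%R by rewrite (lt_trans ltr01).
have g1 : (0 < g - 1)%R by rewrite subr_gt0.
pose S j := (\sum_(l < j) c l)%R.
have SS j : (S j.+1 = S j + c j)%R by rewrite /S big_ord_recr.
suff main N : (\sum_(i < N) c i * g `^ S i.+1 <= g / (g - 1) * g `^ S N)%R by exact: main.
elim: N => [|N IH]; first by rewrite big_ord0 mulr_ge0 ?powR_ge0// divr_ge0 ?ltW.
rewrite big_ord_recr /= SS; case: (c01 N) => ->; first by rewrite mul0r !addr0.
rewrite mul1r powRD ?(powRr1 (ltW g0)); last by apply/implyP => _; rewrite gt_eqF.
apply: (le_trans (lerD IH (lexx _))); rewrite le_eqVlt; apply/orP; left; apply/eqP.
by field; exact: lt0r_neq0.
Qed.

End zero_one_sequences.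

(** * Heights of the maximal function *)

Section tops.
Context {R : realType} {n : nat}.
Local Notation E := (euclid R n).
Local Notation mu := (lebesgue R n).
Variable s : R.
Hypothesis s0 : (0 < s)%R.
Local Notation lcell := (level_cell s).
Local Notation lcell3 := (level_cell3 s).
Local Notation vol := (@vol R n s).
Implicit Types (x y : E) (i j : nat).
Variables (c : nat -> E -> R).
Hypothesis c_levelwise : levelwise s c.
Hypothesis c_ge0 : forall j x, (0 <= c j x)%R.
Variables (J : nat) (W : E -> \bar R) (D : nat -> E -> \bar R).
Hypothesis mW : measurable_fun [set: E] W.
Hypothesis W_ge0 : forall x, 0 <= W x.
Hypothesis D_ge0 : forall j x, 0 <= D j x.
Hypothesis D_levelwise : levelwise s D.

(** The bound on each cell is applied to the maximal cells of a family [b] that covers the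
    support of the sequence; below such a cell its tail is only paid once. *)
Lemma integral_csum_tops (A kp : R) (b : nat -> E -> Prop) : levelwise s b ->
  (forall j x, (j <= J)%N -> (0 < c j x)%R -> exists2 i, (j <= i <= J)%N & b i x) ->
  (0 <= A)%R -> (0 <= kp)%R ->
  (forall j x0, (j <= J)%N ->
    \int[mu]_(x in lcell j x0) ((csum c j x)%:E * W x) <=
    A%:E * \int[mu]_(x in lcell j x0) W x + kp%:E * (D j x0 * (vol j)%:E)) ->
  \int[mu]_x ((csum c J x)%:E * W x) <=
  A%:E * \int[mu]_(x in [set x | exists2 i, (i <= J)%N & b i x]) W x +
  kp%:E * \int[mu]_x \sum_(i < J.+1) (ind (b i x))%:E * D i x.
Proof.
move=> lb cb A0 kp0 H.
pose O j : set E := [set x | exists2 i, (i <= j)%N & b i x].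
have lO j : adapted s (O j).
  move=> x y xy; apply/propext.
  have e i : b i x = b i y by apply: lb; exact: (idx_lev0 s0).
  by split => -[i ij bi]; exists i => //; [rewrite -e|rewrite e].
pose G1 j x := A%:E * ((ind (O j x))%:E * W x).
pose G2 j x := kp%:E * \sum_(i < j.+1) (ind (b i x))%:E * D i x.
have bD_ge0 i x : 0 <= (ind (b i x))%:E * D i x by rewrite mule_ge0// lee_fin ind_ge0.
have mO j : measurable_fun [set: E] (fun x => (ind (O j x) : R)%:E).
  by apply: (adapted_measurable s0) => x y /lO ->.
have mG1 j : measurable_fun [set: E] (G1 j).
  by apply: emeasurable_funM => //; exact: emeasurable_funM.
have mD i : measurable_fun [set: E] (fun x => (ind (b i x))%:E * D i x).
  apply: (adapted_measurable s0) => x y /(idx_lev0 s0 i) xy.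
  by rewrite (lb _ _ _ xy) (D_levelwise xy).
have mG2 j : measurable_fun [set: E] (G2 j).
  by apply: emeasurable_funM => //; exact: emeasurable_sum.
have G10 j x : 0 <= G1 j x by rewrite !mule_ge0// lee_fin ?ind_ge0.
have G20 j x : 0 <= G2 j x by rewrite mule_ge0 ?lee_fin// sume_ge0.
have mcs j : measurable_fun [set: E] (fun x => (csum c j x)%:E * W x).
  apply: emeasurable_funM => //.
  by apply: (adapted_measurable s0) => x y xy; rewrite (adapted_csum s0 c_levelwise j xy).
have cs0 j x : 0 <= (csum c j x)%:E * W x by rewrite mule_ge0// lee_fin csum_ge0.
have top j x0 : (j <= J)%N -> b j x0 ->
    \int[mu]_(x in lcell j x0) ((csum c j x)%:E * W x) <=
    \int[mu]_(x in lcell j x0) (G1 j x + G2 j x).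
  move=> jJ bj; have mc := measurable_lcell s0 j x0.
  apply: le_trans (H j x0 jJ) _.
  rewrite muleA -(integral_lcell_cst s0 j x0 (kp%:E * D j x0)).
  rewrite -ge0_integralZl; [|exact: mc|exact: measurable_funTS|by []|by rewrite lee_fin].
  rewrite -ge0_integralD//; last 3 first.
  - by move=> x _; rewrite mule_ge0.
  - by apply: measurable_funTS; exact: emeasurable_funM.
  - by move=> x _; rewrite mule_ge0.
  apply: le_integral_nonneg => x xx0; first by rewrite adde_ge0// mule_ge0.
  have bx : b j x by rewrite (lb _ _ _ xx0).
  apply: leeD; first by rewrite /G1 indT ?mul1e//; exists j.
  apply: lee_wpmul2l; first by rewrite lee_fin.
  rewrite big_ord_recr /= indT// mul1e (D_levelwise xx0) leeDr//.
  exact: sume_ge0.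
have notop j x0 : (j <= J)%N -> (forall i, (j < i <= J)%N -> ~ b i x0) -> ~ b j x0 ->
    c j x0 = 0%R.
  move=> jJ Nb bj; apply/eqP; rewrite eq_le c_ge0 andbT leNgt; apply/negP => /(cb _ _ jJ)[i].
  move=> /andP[ji iJ] bi; move: ji; rewrite leq_eqVlt => /predU1P[ij|ji].
    by apply: bj; rewrite ij.
  by apply: (Nb i) => //; rewrite ji.
have key j x0 : (j <= J)%N -> (forall i, (j < i <= J)%N -> ~ b i x0) ->
    \int[mu]_(x in lcell j x0) ((csum c j x)%:E * W x) <=
    \int[mu]_(x in lcell j x0) (G1 j x + G2 j x).
  elim: j x0 => [|j IH] x0 jJ Nb.
    have [b0|b0] := pselect (b 0%N x0); first exact: top.
    rewrite integral0_eq; first by apply: integral_ge0 => x _; rewrite adde_ge0.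
    by move=> x xx0; rewrite csum0 (c_levelwise xx0) notop// mul0e.
  have [b0|b0] := pselect (b j.+1 x0); first exact: top.
  have mc := measurable_lcell s0 j.+1 x0.
  apply: (@le_trans _ _ (\int[mu]_(x in lcell j.+1 x0) ((csum c j x)%:E * W x))).
    apply: le_integral_nonneg => x xx0 //.
    by rewrite csumS (c_levelwise xx0) notop// addr0.
  apply: (@le_trans _ _ (\int[mu]_(x in lcell j.+1 x0) (G1 j x + G2 j x))); last first.
    apply: le_integral_nonneg => x xx0; first by rewrite adde_ge0.
    apply: leeD.
      apply: lee_wpmul2l; first by rewrite lee_fin.
      apply: lee_wpmul2r => //; rewrite lee_fin; apply: le_ind => -[i ij bi].
      by exists i => //; exact: leqW.
    apply: lee_wpmul2l; first by rewrite lee_fin.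
    by rewrite [leRHS]big_ord_recr /= leeDl.
  have := @le_integral_sons R n s s0 j x0 setT setT
    (fun x => (csum c j x)%:E * W x) (fun x => G1 j x + G2 j x).
  rewrite !setTI; apply => //; first exact: emeasurable_funD.
    by move=> x; rewrite adde_ge0.
  move=> x xx0; rewrite !setTI; apply: IH; first exact: ltnW.
  move=> i /andP[ji iJ]; move: ji; rewrite leq_eqVlt => /predU1P[ij|ji].
    by rewrite -ij (lb _ _ _ xx0).
  rewrite (lb i x x0); first by apply: Nb; rewrite ji.
  exact: (idx_lev s0 (ltnW ji) xx0).
have mOJ : measurable (O J) by exact: (adapted_mset s0 (lO J)).
apply: (@le_trans _ _ (\int[mu]_x (G1 J x + G2 J x))).
  apply: (le_integral_cells (lev_gt0 J s0)) => //; first exact: emeasurable_funD.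
    by move=> x _; rewrite adde_ge0.
  move=> x; rewrite !setTI; apply: key => // i /andP[Ji iJ].
  by move: iJ; rewrite leqNgt Ji.
rewrite ge0_integralD//; apply: leeD.
  rewrite ge0_integralZl; [|by []|exact: emeasurable_funM| |by rewrite lee_fin].
    apply: lee_wpmul2l; first by rewrite lee_fin.
    rewrite [leRHS]integral_mkcond; apply: le_integral_nonneg => x _.
      by rewrite mule_ge0// lee_fin ind_ge0.
    rewrite /patch; case: ifPn; first by rewrite inE => Ox; rewrite indT// mul1e.
    by rewrite notin_setE => Ox; rewrite indF// mul0e.
  by move=> x _; rewrite mule_ge0// lee_fin ind_ge0.
rewrite ge0_integralZl; [by []|by []|exact: emeasurable_sum| |by rewrite lee_fin].
by move=> x _; exact: sume_ge0.
Qed.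

End tops.

Section sawyer.
Context {R : realType} {n : nat}.
Local Notation E := (euclid R n).
Local Notation mu := (lebesgue R n).
Variable s : R.
Hypothesis s0 : (0 < s)%R.
Local Notation lcell := (level_cell s).
Local Notation lcell3 := (level_cell3 s).
Local Notation vol := (@vol R n s).
Implicit Types (x y : E) (i j k : nat).
Variables (J : nat) (x0 : E) (W : E -> \bar R) (D : nat -> E -> \bar R).
Hypothesis mW : measurable_fun [set: E] W.
Hypothesis W_ge0 : forall x, 0 <= W x.
Hypothesis D_ge0 : forall j x, 0 <= D j x.
Hypothesis D_levelwise : levelwise s D.
(* [D j x] is the average over [lcell j x] of the tail integral of [W] *)
Variables (beta theta : R).
Hypothesis beta_itv : (0 < beta < 1)%R.
Hypothesis theta_ge0 : (0 <= theta)%R.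
Hypothesis D_rec : forall j x,
  D j x = ((vol j)^-1)%:E * \int[mu]_(y in lcell3 j x) W y + beta%:E * D j.+1 x.
Hypothesis D_near : forall j x y, lcell3 j x y -> D j y <= theta%:E * D j x.
Variables (kap rho : R).
Hypothesis kap_ge0 : (0 <= kap)%R.
Hypothesis rho_itv : (0 < rho < 1)%R.
Hypothesis W_small : forall j y i (A : set E), (j <= J)%N -> measurable A ->
  A `<=` lcell j y -> mu A <= (2 ^- i * vol j)%:E ->
  \int[mu]_(x in A) W x <= (kap * rho ^+ i)%:E * (D j y * (vol j)%:E).
(* [a j x] is the size on [lcell j x] of the averages of the function *)
Variables (a : nat -> E -> R) (C1 B : R).
Hypothesis a_levelwise : levelwise s a.
Hypothesis a_gt0 : forall j x, (0 < a j x)%R.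
Hypothesis a_dec : forall j x, (a j.+1 x <= a j x)%R.
Hypothesis a_step : forall j x, (a j x <= 2 ^+ n * a j.+1 x)%R.
Hypothesis C1_ge0 : (0 <= C1)%R.
Hypothesis a_weak : forall j x l, (j <= J)%N -> (a j x < l)%R ->
  mu ([set y | exists2 i, (i <= j)%N & (l <= a i y)%R] `&` lcell j x) <=
  (C1 * a j x / l * vol j)%:E.
Hypothesis B_gt : (2 ^+ n < B)%R.

Definition lam k : R := (B ^+ k * a J x0)%R.

Definition big k j x := [/\ (j <= J)%N, lcell J x0 x & (lam k <= a j x)%R].

Definition stop k := ltop J (big k).

(** The total of the tail integrals of the maximal cells of height [k]: since [D] is an
    average, integrating it over a cell restores the tail integral. *)
Definition Wsum k : \bar R := \int[mu]_x \sum_(j < J.+1) (ind (stop k j x))%:E * D j x.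

Definition near_stop k j y := (j <= J)%N /\ exists2 x, lcell3 j y x & stop k j x.

Definition near_stop_set k : set E := [set y | exists2 j, (j <= J)%N & near_stop k j y].

Let B_gt1 : (1 < B)%R.
Proof. by apply: le_lt_trans B_gt; rewrite exprn_ege1// ler1n. Qed.

Let B_gt0 : (0 < B)%R. Proof. exact: lt_trans B_gt1. Qed.

Lemma lam_gt0 k : (0 < lam k)%R.
Proof. by rewrite mulr_gt0// exprn_gt0. Qed.

Lemma lamS k : (lam k.+1 = B * lam k)%R.
Proof. by rewrite /lam exprS mulrA. Qed.

Lemma lam_ltS k : (lam k < lam k.+1)%R.
Proof. by rewrite lamS ltr_pMl// lam_gt0. Qed.

Lemma big_levelwise k : levelwise s (big k).
Proof.
move=> j x y xy; apply/propext; rewrite /big (a_levelwise xy).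
by split => -[jJ xx0 H]; split => //; move: xx0; rewrite /level_cell/cell/= (idx_lev s0 jJ xy).
Qed.

Lemma stop_levelwise k : levelwise s (stop k).
Proof. exact: ltop_levelwise (big_levelwise k). Qed.

Lemma near_stop_levelwise k : levelwise s (near_stop k).
Proof.
move=> j x y xy; apply/propext; rewrite /near_stop /level_cell3.
by split=> -[jJ [z zx Hz]]; split => //; exists z => //; move: zx; rewrite (eq_cell3 xy).
Qed.

Lemma big_le k i j x : (i <= j)%N -> big k j x -> big k i x.
Proof.
move=> ij [jJ xx0 H]; split => //; first exact: leq_trans ij jJ.
apply: (le_trans H); move: (ij) => /subnK <-.
elim: (j - i)%N => // d IH; exact: le_trans (a_dec _ _) IH.
Qed.

Lemma bigW k j x : big k.+1 j x -> big k j x.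
Proof. by move=> [jJ xx0 H]; split => //; apply: le_trans H; exact/ltW/lam_ltS. Qed.

(** By maximality the parent of the cell is below the height, and [a] changes at most by
    [2 ^ n] in one step. *)
Lemma stop_le_a k j x : stop k j x -> (a j x <= 2 ^+ n * lam k)%R.
Proof.
move=> [jJ [_ xx0 H] N]; have [Jj|jJ'] := leqP J j.
  have -> : j = J by apply/eqP; rewrite eqn_leq jJ.
  rewrite (a_levelwise xx0) mulrA; apply: ler_peMl; first exact/ltW.
  by rewrite mulr_ege1 ?exprn_ege1 ?ler1n// ltW.
apply: (le_trans (a_step _ _)); rewrite ler_wpM2l ?exprn_ge0//.
rewrite leNgt; apply/negP => al; apply: (N j.+1); first by rewrite ltnSn.
by split => //; exact: ltW.
Qed.

Lemma stop_chain k i x : stop k.+1 i x -> exists2 T, (i <= T)%N & stop k T x.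
Proof. by move=> [iJ /bigW bi _]; exact: ltop_ex. Qed.

(** On a maximal cell of height [k.+1] this is the coefficient with which the ancestor of level
    [j] enters its tail integral, and only ancestors of height [k] are kept; elsewhere it is zero. *)
Definition decay k j x : R :=
  (\sum_(i < j.+1) ind (stop k.+1 i x) * ind (big k j x) * beta ^+ (j - i))%R.

Lemma decay_ge0 k j x : (0 <= decay k j x)%R.
Proof.
have /andP[b0 _] := beta_itv.
by apply: sumr_ge0 => i _; rewrite !mulr_ge0 ?ind_ge0// exprn_ge0 ?ltW.
Qed.

Lemma decay_levelwise k j : adapted s (decay k j).
Proof.
move=> x y xy; apply: eq_bigr => i _.
by rewrite (stop_levelwise k.+1 (idx_lev0 s0 i xy)) (big_levelwise k (idx_lev0 s0 j xy)).
Qed.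

Lemma measurable_decay k j S : measurable_fun S (fun x => (decay k j x)%:E).
Proof.
apply: measurable_funTS; apply: (adapted_measurable s0) => x y xy.
by rewrite (decay_levelwise k j xy).
Qed.

Lemma decay_stop k i j x : stop k.+1 i x -> (i <= j)%N -> big k j x ->
  decay k j x = (beta ^+ (j - i))%R.
Proof.
move=> ti ij bj; rewrite /decay (bigD1 (Ordinal (ij : (i < j.+1)%N)))//= !indT// !mul1r.
rewrite big1 ?addr0// => l li; rewrite indF ?mul0r// => tl; move/eqP: li; apply.
by apply/val_inj; exact: ltop_uniq tl ti.
Qed.

Lemma decay_0 k j x : (forall i, ~ (stop k.+1 i x /\ (i <= j)%N /\ big k j x)) -> decay k j x = 0%R.
Proof.
move=> N; rewrite /decay big1// => i _.
have [ti|ti] := pselect (stop k.+1 i x); last by rewrite indF ?mul0r.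
have [bj|bj] := pselect (big k j x); last by rewrite (indF bj) mulr0 mul0r.
by exfalso; apply: (N i); split => //; split => //; rewrite -ltnS.
Qed.

Lemma decay_sum_le k j x : (\sum_(i < j.+1) decay k i x <= (1 - beta)^-1)%R.
Proof.
have /andP[b0 b1] := beta_itv.
have inv0 : (0 <= (1 - beta)^-1)%R by rewrite invr_ge0 subr_ge0 ltW.
have [[i ti]|N] := pselect (exists i, stop k.+1 i x); last first.
  by rewrite big1// => i _; apply: decay_0 => l [tl _]; apply: N; exists l.
have Hle l : (decay k l x <= if (i <= l)%N then beta ^+ (l - i) else 0)%R.
  case: leqP => il.
    have [bl|bl] := pselect (big k l x); first by rewrite (decay_stop ti il bl).
    by rewrite decay_0 ?exprn_ge0 ?ltW// => l' [_ [_ /bl]].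
  rewrite decay_0// => l' [tl [ll _]].
  by move: il; rewrite (ltop_uniq ti tl) ltnNge ll.
apply: (@le_trans _ _ (\sum_(l < j.+1) (if (i <= l)%N then beta ^+ (l - i) else 0))%R).
  by apply: ler_sum => l _; exact: Hle.
have geo N : (\sum_(l < N) (if (i <= l)%N then beta ^+ (l - i) else 0) * (1 - beta)
             + beta ^+ (N - i) = 1)%R.
  elim: N => [|N IH]; first by rewrite big_ord0 add0r.
  rewrite big_ord_recr /= -[RHS]IH; case: leqP => iN; last first.
    have -> : (N.+1 - i = 0)%N by apply/eqP; rewrite subn_eq0.
    have -> : (N - i = 0)%N by apply/eqP; rewrite subn_eq0 ltnW.
    by rewrite mul0r addr0.
  by rewrite subSn// exprS; ring.
rewrite -[leRHS]mul1r ler_pdivlMr ?subr_gt0// mulr_suml -[leRHS](geo j.+1) lerDl.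
by rewrite exprn_ge0// ltW.
Qed.

(** Unfold the recursion [D_rec] of the tail integrals from a maximal cell of height [k.+1] up
    to the maximal cell of height [k] that contains it. *)
Lemma Wsum_split k : Wsum k.+1 <=
  \int[mu]_x (\sum_(j < J.+1) (((vol j)^-1)%:E * ((decay k j x)%:E * \int[mu]_(y in lcell3 j x) W y))) +
  \int[mu]_x (\sum_(T < J.+1) ((ind (stop k T x))%:E * D T x * (decay k T x)%:E)).
Proof.
have /andP[b0 b1] := beta_itv.
pose w3 j x := \int[mu]_(y in lcell3 j x) W y.
have w30 j x : 0 <= w3 j x by exact: integral_ge0.
have voli j : 0 <= ((vol j)^-1)%:E by rewrite lee_fin invr_ge0 ltW// vol_gt0.
have unfold i d x : D i x = \sum_(i <= j < i + d) (beta ^+ (j - i))%:E * (((vol j)^-1)%:E * w3 j x)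
     + (beta ^+ d)%:E * D (i + d)%N x.
  elim: d => [|d IH]; first by rewrite addn0 big_geq// add0e expr0 mul1e.
  rewrite {1}IH addnS big_nat_recr ?leq_addr//= -addeA.
  apply: (f_equal2 (fun u v : \bar R => u + v)) => //.
  rewrite D_rec ge0_muleDr; last 2 first.
  - by apply: mule_ge0; [exact: voli|exact: w30].
  - by apply: mule_ge0 => //; rewrite lee_fin ltW.
  by rewrite addKn exprSr EFinM -muleA.
have m1 : measurable_fun [set: E] (fun x => \sum_(j < J.+1) (((vol j)^-1)%:E * ((decay k j x)%:E * w3 j x))).
  apply: emeasurable_sum => j; apply: emeasurable_funM => //; apply: emeasurable_funM.
    exact: measurable_decay.
  by apply: (adapted_measurable s0) => x y xy; rewrite /w3 (eq_lcell30 s0 j xy).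
have m2 : measurable_fun [set: E] (fun x => \sum_(T < J.+1) ((ind (stop k T x))%:E * D T x * (decay k T x)%:E)).
  apply: emeasurable_sum => j; apply: emeasurable_funM; last exact: measurable_decay.
  apply: (adapted_measurable s0) => x y /(idx_lev0 s0 j) xy.
  by rewrite (stop_levelwise k xy) (D_levelwise xy).
have t1 j x : 0 <= ((vol j)^-1)%:E * ((decay k j x)%:E * w3 j x).
  by rewrite !mule_ge0// lee_fin decay_ge0.
have t2 T x : 0 <= (ind (stop k T x))%:E * D T x * (decay k T x)%:E.
  by rewrite !mule_ge0// lee_fin ?ind_ge0 ?decay_ge0.
rewrite -ge0_integralD//; last 2 first.
- by move=> x _; exact: sume_ge0.
- by move=> x _; exact: sume_ge0.
apply: le_integral_nonneg => x _.
  by apply: sume_ge0 => j _; rewrite mule_ge0// lee_fin ind_ge0.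
have [[i ti]|N] := pselect (exists i, stop k.+1 i x); last first.
  rewrite (@sum_ltop0 R _ J (big k.+1) (D ^~ x) x) ?adde_ge0 ?sume_ge0//.
  by move=> i ti; apply: N; exists i.
rewrite (sum_ltop (D ^~ x) ti).
have [T iT tT] := stop_chain ti.
have [TJ bT _] := tT.
rewrite (unfold i (T - i)%N x) subnKC//; apply: leeD; last first.
  have TJ' : (T < J.+1)%N by [].
  rewrite (bigD1 (Ordinal TJ'))//= indT// mul1e (decay_stop ti iT bT) muleC leeDl//.
  exact: sume_ge0.
rewrite -(big_mkord xpredT (fun j => ((vol j)^-1)%:E * ((decay k j x)%:E * w3 j x))).
rewrite [leRHS](big_cat_nat _ (n := i))//=; last by apply: leqW; exact: leq_trans iT TJ.
rewrite (@big_cat_nat _ _ _ T i J.+1)//=; last exact: leqW.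
rewrite -[leLHS]add0e; apply: leeD; first exact: sume_ge0.
rewrite -[leLHS]adde0; apply: leeD; last exact: sume_ge0.
rewrite big_nat [leRHS]big_nat; apply: lee_sum => j /andP[ij jT].
by rewrite (decay_stop ti ij (big_le (ltnW jT) bT)) muleCA.
Qed.

Lemma measurable_weak_set l j S : measurable S ->
  measurable ([set y | exists2 i, (i <= j)%N & (l <= a i y)%R] `&` S).
Proof.
move=> mS; apply: measurableI => //; apply: (adapted_mset s0) => x y xy; apply/propext.
have e i : a i x = a i y by apply: a_levelwise; exact: (idx_lev0 s0).
by split => -[i ij li]; exists i => //; [rewrite -e|rewrite e].
Qed.

(** The cells of height [k.+1] fill a fraction [eta] of a cell of height [k], and each of them is
    small compared with it, so that its coefficient is at most [eta1]. With [eta] of order [B ^ -1]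
    and [eta1 = eta ^ (q - 1)] the gain is [B ^ -q], which beats the loss [B ^ p] in [Wsum_total]. *)
Lemma Wsum_outside k (eta eta1 : R) : (0 <= eta1)%R ->
  (C1 * 2 ^+ n / B <= eta)%R ->
  (forall i T, (i <= T)%N -> (vol i <= eta * vol T)%R -> (beta ^+ (T - i) <= eta1)%R) ->
  \int[mu]_x (\sum_(T < J.+1) ((ind (stop k T x))%:E * D T x * (decay k T x)%:E)) <=
  (eta1 * eta)%:E * Wsum k.
Proof.
move=> eta10 Ceta Hbeta.
have eta0 : (0 <= eta)%R by apply: le_trans Ceta; rewrite divr_ge0 ?mulr_ge0 ?exprn_ge0// ltW.
have mt T : measurable_fun [set: E] (fun x => (ind (stop k T x))%:E * D T x).
  apply: (adapted_measurable s0) => x y /(idx_lev0 s0 T) xy.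
  by rewrite (stop_levelwise k xy) (D_levelwise xy).
have t0 T x : 0 <= (ind (stop k T x))%:E * D T x by rewrite mule_ge0// lee_fin ind_ge0.
have mH T : measurable_fun [set: E] (fun x => (decay k T x)%:E) by exact: measurable_decay.
rewrite /Wsum !ge0_integral_sum//; last 2 first.
- by move=> T; apply: emeasurable_funM.
- by move=> T x _; rewrite mule_ge0// lee_fin decay_ge0.
rewrite ge0_sume_distrr; last by move=> T _; exact: integral_ge0.
apply: lee_sum => T _.
rewrite -ge0_integralZl//; last by rewrite lee_fin mulr_ge0.
apply: (le_integral_cells (lev_gt0 T s0)) => //.
- by apply: emeasurable_funM.
- by move=> x _; rewrite mule_ge0// lee_fin decay_ge0.
- by apply: emeasurable_funM.
- by move=> x _; rewrite mule_ge0// lee_fin mulr_ge0.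
move=> z; rewrite !setTI -/(lcell T z).
have mc := measurable_lcell s0 T z.
have [tz|tz] := pselect (stop k T z); last first.
  rewrite integral0_eq; last by move=> x xz; rewrite (stop_levelwise k xz) indF// !mul0e.
  by apply: integral_ge0 => x _; rewrite mule_ge0// lee_fin mulr_ge0.
have TJ : (T <= J)%N by case: tz.
have al := stop_le_a tz.
have all : (a T z < lam k.+1)%R.
  by apply: (le_lt_trans al); rewrite lamS ltr_pM2r// lam_gt0.
pose S := [set y | exists2 i, (i <= T)%N & (lam k.+1 <= a i y)%R] `&` lcell T z.
have mS : measurable S by exact: measurable_weak_set.
have muS : mu S <= (eta * vol T)%:E.
  apply: (le_trans (a_weak TJ all)); rewrite lee_fin ler_wpM2r ?(ltW (vol_gt0 _ _))//.
  apply: le_trans Ceta.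
  rewrite ler_pdivrMr ?lam_gt0// lamS mulrA divfK ?gt_eqF// -!mulrA.
  exact: ler_wpM2l.
have HS y : lcell T z y -> (decay k T y <= eta1 * ind (S y))%R.
  move=> yz; have [[i [ti [iT bT]]]|N] := pselect (exists i, stop k.+1 i y /\ (i <= T)%N /\ big k T y).
    have [iJ [_ _ li] _] := ti.
    rewrite (decay_stop ti iT bT) indT ?mulr1; last by split => //; exists i.
    apply: Hbeta => //; rewrite -lee_fin -(mu_lcell s0 i y); apply: le_trans muS.
    apply: le_measure; rewrite ?inE//; first exact: measurable_lcell.
    move=> x xy; split; first by exists i => //; rewrite (a_levelwise xy).
    by move: (lcell_le s0 iT xy); rewrite /level_cell/cell/= => ->.
  rewrite decay_0; first by rewrite mulr_ge0// ind_ge0.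
  by move=> i Hi; apply: N; exists i.
apply: (@le_trans _ _ (\int[mu]_(x in lcell T z) (D T z * eta1%:E * (ind (S x))%:E))).
  apply: le_integral_nonneg => x xz; first by rewrite mule_ge0// lee_fin decay_ge0.
  rewrite (stop_levelwise k xz) indT// mul1e (D_levelwise xz) -muleA -EFinM.
  by apply: lee_wpmul2l => //; rewrite lee_fin; exact: HS.
rewrite ge0_integralZl//; last 3 first.
- by apply: measurable_funTS; under eq_fun do rewrite -indE; exact/measurable_EFinP/measurable_indic.
- by move=> x _; rewrite lee_fin ind_ge0.
- by rewrite mule_ge0.
rewrite (integral_ind mc mS) setIidl; last by move=> x [].
rewrite (@eq_integral _ _ _ mu _ (fun=> (eta1 * eta)%:E * D T z)); last first.
  by move=> x; rewrite inE => xz; rewrite (stop_levelwise k xz) indT// mul1e (D_levelwise xz).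
rewrite (integral_lcell_cst s0) -(muleA (D T z)) muleCA [leRHS](_ : _ = eta1%:E * (D T z * (eta * vol T)%:E)).
  by apply: lee_wpmul2l; rewrite ?lee_fin//; exact: lee_wpmul2l.
by rewrite !EFinM -!muleA; congr (_ * _); rewrite muleCA.
Qed.

(** The Carleson constant of [mean_decay]: two sums over neighbours and a geometric series. *)
Definition overlap_const : R := (3 ^+ n * 3 ^+ n / (1 - beta))%R.

Lemma overlap_const_gt0 : (0 < overlap_const)%R.
Proof.
have /andP[b0 b1] := beta_itv.
by rewrite /overlap_const divr_gt0 ?subr_gt0// mulr_gt0// exprn_gt0.
Qed.

Lemma decay_le k j x : (decay k j x <= (1 - beta)^-1)%R.
Proof.
apply: le_trans (decay_sum_le k j x); rewrite big_ord_recr /= lerDr.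
by apply: sumr_ge0 => i _; exact: decay_ge0.
Qed.

(** By Fubini, integrating [decay] against the weights of the triples amounts to integrating this
    average over the neighbours against the weight. *)
Definition mean_decay k j y : R := fine (((vol j)^-1)%:E * \int[mu]_(x in lcell3 j y) (decay k j x)%:E).

Lemma mean_decay_ge0 k j y : (0 <= mean_decay k j y)%R.
Proof.
apply: fine_ge0; rewrite mule_ge0 ?lee_fin ?invr_ge0 ?(ltW (vol_gt0 _ _))//.
by apply: integral_ge0 => x _; rewrite lee_fin decay_ge0.
Qed.

Lemma mean_decayE k j y : (mean_decay k j y)%:E = ((vol j)^-1)%:E * \int[mu]_(x in lcell3 j y) (decay k j x)%:E.
Proof.
have i0 : 0 <= \int[mu]_(x in lcell3 j y) (decay k j x)%:E.
  by apply: integral_ge0 => x _; rewrite lee_fin decay_ge0.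
rewrite fineK// fin_numM// ge0_fin_numE//.
apply: (@le_lt_trans _ _ (\int[mu]_(x in lcell3 j y) ((1 - beta)^-1)%:E)).
  by apply: le_integral_nonneg => x _; rewrite lee_fin ?decay_ge0 ?decay_le.
by rewrite (integral_lcell3_cst s0) -EFinM ltry.
Qed.

Lemma mean_decay_levelwise k : levelwise s (mean_decay k).
Proof. by move=> j x y xy; rewrite /mean_decay /level_cell3 (eq_cell3 xy). Qed.

Lemma mean_decay_near k j y : (j <= J)%N -> (0 < mean_decay k j y)%R ->
  exists2 i, (j <= i <= J)%N & near_stop k i y.
Proof.
move=> jJ c0.
have [x yx Hx] : exists2 x, lcell3 j y x & decay k j x <> 0%R.
  apply: contrapT => N; move: c0; rewrite /mean_decay integral0_eq ?mule0 ?ltxx//.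
  by move=> x xy; congr EFin; apply: contrapT => Hx; apply: N; exists x.
have bx : big k j x.
  apply: contrapT => bx; apply: Hx; apply: decay_0 => i [_ [_ /bx]] //.
have [i ji ti] := ltop_ex jJ bx; have iJ : (i <= J)%N by case: ti.
exists i; rewrite ?ji//; split => //; exists x => //.
exact: (lcell3_le s0 ji yx).
Qed.

(** Over the neighbours of a cell the coefficients of one maximal cell form a geometric series. *)
Lemma mean_decay_carleson k j y : (j <= J)%N ->
  \int[mu]_(x in lcell j y) (csum (mean_decay k) j x)%:E <= (overlap_const * vol j)%:E.
Proof.
move=> jJ; have mc := measurable_lcell s0 j y; have mc3 := measurable_lcell3 s0 j y.
pose F x : \bar R := (ind (lcell j y x))%:E.
have F0 x : 0 <= F x by rewrite lee_fin ind_ge0.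
have mF : measurable_fun [set: E] F.
  by rewrite /F; under eq_fun do rewrite -indE; exact/measurable_EFinP/measurable_indic.
have Hge x i : 0 <= (decay k i x)%:E by rewrite lee_fin decay_ge0.
have mH i S : measurable_fun S (fun x => (decay k i x)%:E) by exact: measurable_decay.
have mcH i : measurable_fun [set: E] (fun x => (mean_decay k i x)%:E).
  apply: (adapted_measurable s0) => x z /(idx_lev0 s0 i) xz.
  by rewrite (mean_decay_levelwise k xz).
apply: (@le_trans _ _ (\sum_(i < j.+1) (\int[mu]_x ((mean_decay k i x)%:E * F x)))).
  rewrite -ge0_integral_sum//; last 2 first.
  - by move=> i; apply: emeasurable_funM.
  - by move=> i x _; rewrite mule_ge0// lee_fin mean_decay_ge0.
  rewrite [leLHS]integral_mkcond; apply: le_integral_nonneg => x _; rewrite /patch.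
    case: ifP => // _; rewrite lee_fin; apply: sumr_ge0 => i _; exact: mean_decay_ge0.
  case: ifPn => [|_]; last by apply: sume_ge0 => i _; rewrite mule_ge0// lee_fin mean_decay_ge0.
  rewrite inE => xy; rewrite -sumEFin; apply: lee_sum => i _.
  by rewrite /F indT// mule1.
apply: (@le_trans _ _ (\sum_(i < j.+1) (\int[mu]_x ((3 ^+ n)%:E * ((decay k i x)%:E * (ind (lcell3 j y x))%:E))))).
  apply: lee_sum => i _.
  under eq_integral do rewrite mean_decayE -muleA.
  rewrite ge0_integralZl//; last 3 first.
  - apply: emeasurable_funM => //; apply: (adapted_measurable s0) => x z xz.
    by rewrite (eq_lcell30 s0 i xz).
  - by move=> x _; rewrite mule_ge0// integral_ge0.
  - by rewrite lee_fin invr_ge0 ltW// vol_gt0.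
  rewrite (integral_neighbours s0 i (mH i _) _ mF F0)//.
  rewrite -ge0_integralZl//; last 3 first.
  - apply: emeasurable_funM => //; apply: (adapted_measurable s0) => x z xz.
    by rewrite (eq_lcell30 s0 i xz).
  - by move=> x _; rewrite mule_ge0// integral_ge0.
  - by rewrite lee_fin invr_ge0 ltW// vol_gt0.
  apply: le_integral_nonneg => x _.
    by rewrite !mule_ge0 ?integral_ge0// lee_fin invr_ge0 ltW// vol_gt0.
  rewrite muleCA [leRHS]muleCA; apply: lee_wpmul2l => //.
  have [xy|xy] := pselect (lcell3 j y x); last first.
    rewrite (indF xy) mule0 integral0_eq ?mule0// => z zx.
    rewrite /F indF// => zy; apply: xy.
    have := lcell3_le s0 (ltnSE (ltn_ord i)) zx.
    by rewrite /level_cell3 /cell3 /= zy adjC.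
  rewrite indT// mule1; apply: (@le_trans _ _ (((vol i)^-1)%:E * \int[mu]_(z in lcell3 i x) 1)).
    apply: lee_wpmul2l; first by rewrite lee_fin invr_ge0 ltW// vol_gt0.
    by apply: le_integral_nonneg => z _; rewrite // lee_fin ind_le1.
  rewrite (integral_lcell3_cst s0) mul1e -EFinM lee_fin mulrCA mulVf ?mulr1//.
  by rewrite gt_eqF// vol_gt0.
have mI : measurable_fun [set: E] (fun x => (ind (lcell3 j y x) : R)%:E).
  by under eq_fun do rewrite -indE; exact/measurable_EFinP/measurable_indic.
rewrite -ge0_integral_sum//; last 2 first.
- by move=> i; apply: emeasurable_funM => //; exact: emeasurable_funM.
- by move=> i x _; rewrite !mule_ge0// lee_fin ?ind_ge0.
apply: (@le_trans _ _ (\int[mu]_(x in lcell3 j y) (3 ^+ n * (1 - beta)^-1)%:E)); last first.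
  by rewrite (integral_lcell3_cst s0) -EFinM lee_fin /overlap_const le_eqVlt; apply/orP; left; apply/eqP; ring.
rewrite [leRHS]integral_mkcond; apply: le_integral_nonneg => x _.
  by apply: sume_ge0 => i _; rewrite !mule_ge0// lee_fin ?ind_ge0.
rewrite /patch; case: ifPn; last first.
  by rewrite notin_setE => xy; rewrite big1// => i _; rewrite indF// !mule0.
rewrite inE => xy; under eq_bigr do rewrite indT// mule1 -EFinM.
rewrite sumEFin lee_fin -mulr_sumr ler_wpM2l ?exprn_ge0//.
exact: decay_sum_le.
Qed.

(** Replacing a maximal cell by its neighbours costs [theta] for the tail integral and [3 ^ n] for
    their number. *)
Lemma Wsum_near k : \int[mu]_x \sum_(i < J.+1) (ind (near_stop k i x))%:E * D i x <=
  (theta * 3 ^+ n)%:E * Wsum k.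
Proof.
pose g i x := (ind (stop k i x))%:E * D i x.
have g0 i x : 0 <= g i x by rewrite mule_ge0// lee_fin ind_ge0.
have mg i : measurable_fun [set: E] (g i).
  apply: (adapted_measurable s0) => x y /(idx_lev0 s0 i) xy.
  by rewrite /g (stop_levelwise k xy) (D_levelwise xy).
have voli j : 0 <= ((vol j)^-1)%:E by rewrite lee_fin invr_ge0 ltW// vol_gt0.
have gi i y : 0 <= \int[mu]_(z in lcell3 i y) g i z by apply: integral_ge0 => z _; exact: g0.
rewrite /Wsum !ge0_integral_sum//; last 2 first.
- move=> i; apply: (adapted_measurable s0) => x y /(idx_lev0 s0 i) xy.
  by rewrite (near_stop_levelwise k xy) (D_levelwise xy).
- by move=> i x _; rewrite mule_ge0// lee_fin ind_ge0.
rewrite ge0_sume_distrr; last by move=> i _; apply: integral_ge0 => x _; exact: g0.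
apply: lee_sum => i _; rewrite EFinM -muleA -(integral_neighbours1 s0 i)//.
rewrite -ge0_integralZl; first last.
- by rewrite lee_fin.
- by move=> x _; exact: mule_ge0.
- by apply: (adapted_measurable s0) => x z xz; rewrite (eq_lcell30 s0 i xz).
- by [].
apply: le_integral_nonneg => y _; first by rewrite mule_ge0// lee_fin ind_ge0.
have [[iJ [x yx tx]]|N] := pselect (near_stop k i y); last first.
  by rewrite indF// mul0e; apply: mule_ge0; [rewrite lee_fin|exact: mule_ge0].
rewrite indT ?mul1e; last by split => //; exists x.
rewrite muleCA; apply: (@le_trans _ _ (((vol i)^-1)%:E * (theta%:E * \int[mu]_(z in lcell i x) g i x))).
  rewrite (integral_lcell_cst s0) /g indT// mul1e muleCA (muleCA _ (D i x)) -EFinM.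
  rewrite mulVf ?gt_eqF ?vol_gt0// mule1.
  by apply: D_near; rewrite /level_cell3 cell3C.
apply: lee_wpmul2l => //; apply: lee_wpmul2l => //.
rewrite (@eq_integral _ _ _ mu _ (g i)); last first.
  by move=> z; rewrite inE => zx; rewrite /g (stop_levelwise k zx) (D_levelwise zx).
apply: ge0_subset_integral => //; [exact: measurable_lcell|exact: measurable_lcell3|exact: measurable_funTS|].
by move=> z zx; move: yx; rewrite /level_cell3 /cell3 /= zx.
- exact: (mg i).
- exact: (g0 i).
- exact: mg.
- by move=> i x _; exact: g0.
Qed.

(** The inner part of [Wsum_split] is the integral of the Carleson sum of [mean_decay] against the
    weight; the cut of [integral_csum_cut] is made on the maximal cells near those of height [k]. *)
Lemma Wsum_inside k M :
  \int[mu]_x (\sum_(j < J.+1) (((vol j)^-1)%:E * ((decay k j x)%:E * \int[mu]_(y in lcell3 j x) W y))) <=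
  (2 * overlap_const * M%:R)%:E * \int[mu]_(x in near_stop_set k) W x +
  (2 * overlap_const * kap * rho ^+ M / (1 - rho) * (theta * 3 ^+ n))%:E * Wsum k.
Proof.
have /andP[r0 r1] := rho_itv.
have voli j : 0 <= ((vol j)^-1)%:E by rewrite lee_fin invr_ge0 ltW// vol_gt0.
have w30 j x : 0 <= \int[mu]_(y in lcell3 j x) W y by exact: integral_ge0.
have Hge i x : 0 <= (decay k i x)%:E by rewrite lee_fin decay_ge0.
have mH i S : measurable_fun S (fun x => (decay k i x)%:E) by exact: measurable_decay.
have mHw j : measurable_fun [set: E] (fun x => (decay k j x)%:E * \int[mu]_(y in lcell3 j x) W y).
  apply: emeasurable_funM => //; apply: (adapted_measurable s0) => x z xz.
  by rewrite (eq_lcell30 s0 j xz).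
have mcH i : measurable_fun [set: E] (fun x => (mean_decay k i x)%:E).
  apply: (adapted_measurable s0) => x z /(idx_lev0 s0 i) xz.
  by rewrite (mean_decay_levelwise k xz).
rewrite ge0_integral_sum//; last 2 first.
- by move=> j; apply: emeasurable_funM.
- by move=> j x _; rewrite !mule_ge0.
rewrite (eq_bigr (fun j : 'I_J.+1 => \int[mu]_y ((mean_decay k j y)%:E * W y))); last first.
  move=> j _; rewrite ge0_integralZl//; last by move=> x _; rewrite mule_ge0.
  rewrite -(integral_neighbours s0 j (mH j _) _ mW W_ge0)//.
  rewrite -ge0_integralZl//.
  - by apply: eq_integral => y _; rewrite mean_decayE muleA.
  - apply: emeasurable_funM => //; apply: (adapted_measurable s0) => x z xz.
    by rewrite (eq_lcell30 s0 j xz).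
  - by move=> x _; rewrite mule_ge0// integral_ge0.
rewrite -ge0_integral_sum//; last 2 first.
- by move=> j; apply: emeasurable_funM.
- by move=> j x _; rewrite mule_ge0// lee_fin mean_decay_ge0.
rewrite (@eq_integral _ _ _ mu _ (fun x => (csum (mean_decay k) J x)%:E * W x)); last first.
  move=> x _; rewrite /csum -sumEFin ge0_sume_distrl// => j _.
  by rewrite lee_fin mean_decay_ge0.
have L0 := ltW overlap_const_gt0.
have L2 : (0 <= 2 * overlap_const)%R by rewrite mulr_ge0.
have A0 : (0 <= 2 * overlap_const * M%:R)%R by rewrite mulr_ge0.
have kp0 : (0 <= 2 * overlap_const * kap * rho ^+ M / (1 - rho))%R.
  apply: divr_ge0; last by rewrite subr_ge0 ltW.
  by apply: mulr_ge0; [exact: mulr_ge0|exact/exprn_ge0/ltW].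
apply: le_trans (@integral_csum_tops R n s s0 (mean_decay k) (@mean_decay_levelwise k) (@mean_decay_ge0 k) J W D mW W_ge0
  D_ge0 D_levelwise _ _ (near_stop k) (@near_stop_levelwise k) (@mean_decay_near k) A0 kp0 _) _.
  move=> j y jJ.
  apply: (@integral_csum_cut R n s s0 (mean_decay k) (@mean_decay_levelwise k) (@mean_decay_ge0 k) J overlap_const overlap_const_gt0
   (@mean_decay_carleson k) W D kap rho mW W_ge0 D_ge0 kap_ge0 rho_itv W_small) => //.
apply: leeD => //; rewrite [(_ * (theta * _))%:E]EFinM -muleA.
apply: lee_wpmul2l; first by rewrite lee_fin.
exact: Wsum_near.
Qed.

Lemma Wsum_step k M (eta eta1 : R) : (0 <= eta1)%R ->
  (C1 * 2 ^+ n / B <= eta)%R ->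
  (forall i T, (i <= T)%N -> (vol i <= eta * vol T)%R -> (beta ^+ (T - i) <= eta1)%R) ->
  Wsum k.+1 <= (2 * overlap_const * M%:R)%:E * \int[mu]_(x in near_stop_set k) W x +
  (2 * overlap_const * kap * rho ^+ M / (1 - rho) * (theta * 3 ^+ n) + eta1 * eta)%:E * Wsum k.
Proof.
move=> eta10 Ceta Hb; apply: le_trans (Wsum_split k) _.
have eta0 : (0 <= eta)%R by apply: le_trans Ceta; rewrite divr_ge0 ?mulr_ge0 ?exprn_ge0// ltW.
have /andP[r0 r1] := rho_itv.
have L0 := ltW overlap_const_gt0.
rewrite EFinD ge0_muleDl; last 2 first.
- rewrite lee_fin; apply: mulr_ge0; last by rewrite mulr_ge0// exprn_ge0.
  apply: divr_ge0; last by rewrite subr_ge0 ltW.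
  apply: mulr_ge0; last exact/exprn_ge0/ltW.
  by apply: mulr_ge0 => //; exact: mulr_ge0.
- by rewrite lee_fin mulr_ge0.
by rewrite [leRHS]addeA; apply: leeD; [exact: Wsum_inside|exact: Wsum_outside].
Qed.

Lemma Wsum0 : Wsum 0 <= D J x0 * (vol J)%:E.
Proof.
rewrite -(integral_lcell_cst s0 J x0) [leRHS]integral_mkcond.
apply: le_integral_nonneg => x _.
  by apply: sume_ge0 => j _; rewrite mule_ge0// lee_fin ind_ge0.
rewrite /patch; case: ifPn; rewrite ?inE ?notin_setE => xx0.
  have tJ : stop 0 J x.
    split => //; last by move=> i /andP[Ji iJ]; move: iJ; rewrite leqNgt Ji.
    by split => //; rewrite /lam expr0 mul1r (a_levelwise xx0).
  by rewrite (sum_ltop (D ^~ x) tJ) (D_levelwise xx0).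
by rewrite (@sum_ltop0 R _ J (big 0) (D ^~ x) x)// => i [_ [_ /xx0]].
Qed.

Variables (p : R) (G : E -> \bar R).
Hypothesis p_gt0 : (0 < p)%R.
Hypothesis G_ge : forall j x y, lcell3 j x y -> (a j x)%:E <= G y.

Let Bp_gt1 : (1 < B `^ p)%R.
Proof. exact: powR_gt1. Qed.

Lemma lamp k : (lam k `^ p = (B `^ p) ^+ k * lam 0 `^ p)%R.
Proof.
rewrite /lam expr0 mul1r powRM ?exprn_ge0 ?ltW//; congr (_ * _)%R.
have -> : (B ^+ k = B `^ k%:R)%R by rewrite powR_mulrn// ltW.
by rewrite powRAC powR_mulrn// powR_ge0.
Qed.

Definition geom_const : R := (1 - (B `^ p)^-1)^-1.

Lemma geom_const_gt0 : (0 < geom_const)%R.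
Proof. by rewrite invr_gt0 subr_gt0 invf_lt1// (lt_trans ltr01). Qed.

Lemma lam_le_G k y : near_stop_set k y -> (lam k)%:E <= G y.
Proof.
move=> [j jJ [_ [x yx [_ [_ _ lx] _]]]]; apply: (@le_trans _ _ (a j x)%:E) => //.
by apply: G_ge; rewrite /level_cell3 cell3C.
Qed.

(** A geometric series dominated by its last term, the largest height reached at [y]. *)
Lemma sum_lamp_le K y : \sum_(k < K) (lam k `^ p * ind (near_stop_set k y))%:E <= geom_const%:E * G y `^ p.
Proof.
have b0 : (0 < B `^ p)%R by rewrite (lt_trans ltr01).
have geo N : (\sum_(k < N.+1) (B `^ p) ^+ k <= geom_const * (B `^ p) ^+ N)%R.
  rewrite -ler_pdivrMl ?geom_const_gt0// /geom_const invrK mulr_sumr.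
  have -> : (\sum_(i < N.+1) (1 - (B `^ p)^-1) * (B `^ p) ^+ i = (B `^ p) ^+ N - (B `^ p)^-1)%R.
    elim: N => [|N IH]; first by rewrite big_ord_recr big_ord0 /= expr0 add0r mulr1.
    rewrite big_ord_recr /= IH exprS; field; exact: lt0r_neq0.
  by rewrite gerBl invr_ge0 ltW.
elim: K => [|K IH]; first by rewrite big_ord0 mule_ge0 ?poweR_ge0// lee_fin ltW// geom_const_gt0.
have [OK|OK] := pselect (near_stop_set K y); last first.
  by rewrite big_ord_recr /= indF// mulr0 adde0.
apply: (@le_trans _ _ (geom_const%:E * (lam K `^ p)%:E)).
  rewrite sumEFin -EFinM lee_fin; apply: (@le_trans _ _ (\sum_(k < K.+1) (B `^ p) ^+ k * lam 0 `^ p)%R).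
    apply: ler_sum => k _; rewrite -lamp ler_piMr ?powR_ge0//; exact: ind_le1.
  by rewrite -mulr_suml (lamp K) mulrA ler_wpM2r// powR_ge0.
apply: lee_wpmul2l; first by rewrite lee_fin ltW// geom_const_gt0.
rewrite -poweR_EFin; apply: le_poweR; [exact: ltW|by rewrite lee_fin ltW// lam_gt0|exact: lam_le_G].
Qed.

(** The smallness assumption turns [Wsum_step], multiplied by [lam k.+1 `^ p], into the recursion
    of [sum_absorb]. *)
Lemma Wsum_total K M (eta eta1 : R) : (0 <= eta1)%R ->
  (C1 * 2 ^+ n / B <= eta)%R ->
  (forall i T, (i <= T)%N -> (vol i <= eta * vol T)%R -> (beta ^+ (T - i) <= eta1)%R) ->
  (B `^ p * (2 * overlap_const * kap * rho ^+ M / (1 - rho) * (theta * 3 ^+ n) + eta1 * eta) <= 2^-1)%R ->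
  \sum_(k < K) (lam k `^ p)%:E * Wsum k <=
  2%:E * ((lam 0 `^ p)%:E * (D J x0 * (vol J)%:E) +
          (B `^ p * (2 * overlap_const * M%:R) * geom_const)%:E * \int[mu]_x (G x `^ p * W x)).
Proof.
move=> eta10 Ceta Hb small.
have /andP[b0 b1] := beta_itv; have /andP[r0 r1] := rho_itv.
have eta0 : (0 <= eta)%R by apply: le_trans Ceta; rewrite divr_ge0 ?mulr_ge0 ?exprn_ge0// ltW.
have L0 := ltW overlap_const_gt0.
have A0 : (0 <= B `^ p * (2 * overlap_const * M%:R))%R.
  by apply: mulr_ge0; [exact: powR_ge0|apply: mulr_ge0 => //; exact: mulr_ge0].
have W0 k : 0 <= Wsum k.
  by apply: integral_ge0 => x _; apply: sume_ge0 => j _; rewrite mule_ge0// lee_fin ind_ge0.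
have iO k : 0 <= \int[mu]_(x in near_stop_set k) W x by exact: integral_ge0.
pose u k := (lam k `^ p)%:E * Wsum k.
pose v k := (B `^ p * (2 * overlap_const * M%:R))%:E * ((lam k `^ p)%:E * \int[mu]_(x in near_stop_set k) W x).
have u0 k : 0 <= u k by rewrite mule_ge0// lee_fin powR_ge0.
have v0 k : 0 <= v k by rewrite !mule_ge0// lee_fin powR_ge0.
apply: le_trans (@sum_absorb R u v K u0 v0 _) _.
  move=> k; rewrite /u lamS powRM ?(ltW B_gt0) ?(ltW (lam_gt0 _))// EFinM -muleA.
  have Bp0 : 0 <= (B `^ p)%:E by rewrite lee_fin powR_ge0.
  have lp0 : 0 <= (lam k `^ p)%:E by rewrite lee_fin powR_ge0.
  apply: (@le_trans _ _ ((B `^ p)%:E * ((lam k `^ p)%:E *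
     ((2 * overlap_const * M%:R)%:E * \int[mu]_(x in near_stop_set k) W x +
  (2 * overlap_const * kap * rho ^+ M / (1 - rho) * (theta * 3 ^+ n) + eta1 * eta)%:E * Wsum k)))).
    by apply: lee_wpmul2l => //; apply: lee_wpmul2l => //; exact: (Wsum_step k M eta10 Ceta Hb).
  set S := (_ + eta1 * eta)%R in small *.
  have S0 : (0 <= S)%R.
    rewrite /S; apply: addr_ge0; last exact: mulr_ge0.
    apply: mulr_ge0; last by rewrite mulr_ge0// exprn_ge0.
    apply: divr_ge0; last by rewrite subr_ge0 ltW.
    apply: mulr_ge0; last exact/exprn_ge0/ltW.
    by apply: mulr_ge0 => //; exact: mulr_ge0.
  have LM0 : 0 <= (2 * overlap_const * M%:R)%:E * \int[mu]_(x in near_stop_set k) W x.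
    by rewrite mule_ge0// lee_fin; apply: mulr_ge0 => //; exact: mulr_ge0.
  have SW : 0 <= S%:E * Wsum k by rewrite mule_ge0.
  rewrite (ge0_muleDr _ LM0 SW) (ge0_muleDr _ (mule_ge0 lp0 LM0) (mule_ge0 lp0 SW)).
  apply: leeD.
    rewrite /v (EFinM (B `^ p)) -!muleA; apply: lee_wpmul2l => //.
    by rewrite muleCA.
  rewrite muleCA [leRHS]muleCA; apply: lee_wpmul2l => //.
  rewrite muleA -EFinM; apply: lee_wpmul2r => //.
apply: lee_wpmul2l; first by rewrite lee_fin.
apply: leeD.
  by apply: lee_wpmul2l; [rewrite lee_fin powR_ge0|exact: Wsum0].
rewrite /v -ge0_sume_distrr; last by move=> k _; rewrite mule_ge0// lee_fin powR_ge0.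
rewrite (EFinM _ geom_const) -muleA; apply: lee_wpmul2l; first by rewrite lee_fin.
have CB0 : (0 <= geom_const)%R by rewrite ltW// geom_const_gt0.
have mO k : measurable (near_stop_set k).
  apply: (adapted_mset s0) => x y xy; apply/propext.
  have e i : near_stop k i x = near_stop k i y.
    by apply: near_stop_levelwise; exact: (idx_lev0 s0).
  by split => -[i iJ ti]; exists i => //; [rewrite -e|rewrite e].
have mI k : measurable_fun [set: E] (fun x => (ind (near_stop_set k x) : R)%:E).
  by under eq_fun do rewrite -indE; exact/measurable_EFinP/measurable_indic.
have lI0 k x : 0 <= (lam k `^ p * ind (near_stop_set k x))%:E by rewrite lee_fin mulr_ge0 ?powR_ge0// ind_ge0.
have mlI k : measurable_fun [set: E] (fun x => (lam k `^ p * ind (near_stop_set k x))%:E * W x).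
  by apply: emeasurable_funM => //; under eq_fun do rewrite EFinM; exact: emeasurable_funM.
rewrite -lee_pdivrMl ?geom_const_gt0//.
apply: (@le_trans _ _ (\int[mu]_x ((geom_const^-1)%:E * \sum_(k < K) ((lam k `^ p * ind (near_stop_set k x))%:E * W x)))); last first.
  apply: le_integral_nonneg => x _.
    apply: mule_ge0; first by rewrite lee_fin invr_ge0.
    by apply: sume_ge0 => k _; exact: mule_ge0.
  rewrite -ge0_sume_distrl// muleA; apply: lee_wpmul2r => //.
  by rewrite lee_pdivrMl ?geom_const_gt0//; exact: sum_lamp_le.
rewrite ge0_integralZl//; last 3 first.
- exact: emeasurable_sum.
- by move=> x _; apply: sume_ge0 => k _; rewrite mule_ge0.
- by rewrite lee_fin invr_ge0.
apply: lee_wpmul2l; first by rewrite lee_fin invr_ge0.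
rewrite ge0_integral_sum//; last by move=> k x _; rewrite mule_ge0.
apply: lee_sum => k _; rewrite -ge0_integralZl//; last 2 first.
- exact: measurable_funTS.
- by rewrite lee_fin powR_ge0.
rewrite [leLHS]integral_mkcond; apply: le_integral_nonneg => x _; rewrite /patch.
  by case: ifP => // _; rewrite mule_ge0// lee_fin powR_ge0.
case: ifPn; rewrite ?inE ?notin_setE => Ox; first by rewrite indT// mulr1.
by rewrite indF// mulr0 mul0e.
Qed.

Variables (delta r g Cg : R).
Hypothesis r_gt0 : (0 < r)%R.
Hypothesis dr_p : (delta * r = p)%R.
Hypothesis g_gt1 : (1 < g)%R.
Hypothesis g4rho : (g `^ 4 * rho < 1)%R.
Hypothesis Cg_ge0 : (0 <= Cg)%R.
Hypothesis splitCg : forall u v : R, (0 <= u)%R -> (0 <= v)%R ->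
  ((u + v) `^ r <= g * u `^ r + Cg * v `^ r)%R.
Variable c : nat -> E -> R.
Hypothesis c_levelwise : levelwise s c.
Hypothesis c01 : forall i x, c i x = 0%R \/ c i x = 1%R.
Hypothesis c_carleson : forall j y, (j <= J)%N ->
  \int[mu]_(x in lcell j y) (csum c j x)%:E <= (2 * vol j)%:E.

Let c_ge0 i x : (0 <= c i x)%R. Proof. by case: (c01 i x) => ->. Qed.

Let g_ge0 : (0 <= g)%R. Proof. by rewrite ltW// (lt_trans ltr01). Qed.

(** The number of stops below a cell loses a factor [g ^ 4] and gains [rho] for each step of height
    [4] of its distribution function. *)
Definition tail_const : R := (g `^ 4 / (1 - g `^ 4 * rho))%R.

Let tail_const_ge0 : (0 <= tail_const)%R.
Proof. by rewrite divr_ge0 ?powR_ge0// subr_ge0 ltW. Qed.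

Lemma integral_powR_csum j y : (j <= J)%N ->
  \int[mu]_(x in lcell j y) ((g `^ csum c j x)%:E * W x) <=
  ((1 + tail_const) * kap)%:E * (D j y * (vol j)%:E).
Proof.
move=> jJ; have /andP[r0 r1] := rho_itv.
have t0 : (0 <= g `^ 4)%R by exact: powR_ge0.
have two : (0 < 2 :> R)%R by [].
apply: (@integral_csum_Phi R n s s0 c c_levelwise c_ge0 J 2%R two c_carleson W D kap rho mW W_ge0
   D_ge0 kap_ge0 rho_itv W_small (fun z => (g `^ z)%R) 1%R (fun i => (g `^ 4) ^+ i.+1)%R tail_const j y jJ) => //.
- by move=> z; exact: powR_ge0.
- by move=> i; exact: exprn_ge0.
- move=> z N /andP[z0]; elim: N z z0 => [|N IH] z z0 zN.
    rewrite big_ord0 addr0; have -> : z = 0%R by apply/eqP; rewrite eq_le z0 -(mulr0 (2 * 2)%R) zN.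
    by rewrite powRr0.
  have [Nz|zN'] := ltP (2 * 2 * N%:R)%R z; last first.
    rewrite big_ord_recr /= indF ?mulr0 ?addr0 ?IH//; apply/negP; rewrite -leNgt//.
  rewrite big_ord_recr /= indT// mulr1 addrA -[leLHS]add0r lerD//.
    rewrite addr_ge0// sumr_ge0// => i _; rewrite mulr_ge0 ?ind_ge0// exprn_ge0//.
  rewrite -powR_mulrn// -powRrM ler_powR ?(ltW g_gt1)//.
  by move: zN; rewrite -natrM.
- move=> N; have tr0 : (0 < 1 - g `^ 4 * rho)%R by rewrite subr_gt0.
  rewrite /tail_const ler_pdivlMr// mulr_suml.
  have geo : (\sum_(i < N) (g `^ 4) ^+ i.+1 * rho ^+ i * (1 - g `^ 4 * rho) =
     g `^ 4 - g `^ 4 * (g `^ 4 * rho) ^+ N)%R.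
    elim: N => [|N IH]; first by rewrite big_ord0 expr0 mulr1 subrr.
    by rewrite big_ord_recr /= IH !exprMn !exprS; ring.
  by rewrite geo gerBl mulr_ge0// exprn_ge0// mulr_ge0// ltW.
Qed.

(** The number of heights needed is at most the number of levels, as [B > 2 ^ n]. *)
Lemma lam_bracket i x : (i <= J)%N -> lcell J x0 x ->
  exists2 k, (k < J.+1)%N & (lam k <= a i x < lam k.+1)%R.
Proof.
move=> iJ xx0.
have top : (a i x < lam J.+1)%R.
  apply: le_lt_trans (lam_ltS J); rewrite /lam -(a_levelwise xx0).
  apply: (@le_trans _ _ ((2 ^+ n) ^+ (J - i) * a J x)%R).
    have main d l : (d + l = J)%N -> (a l x <= (2 ^+ n) ^+ d * a J x)%R.
      elim: d l => [|d IH] l; first by rewrite add0n => ->; rewrite expr0 mul1r.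
      rewrite addSnnS => /IH h; apply: (le_trans (a_step _ _)).
      by rewrite exprS -mulrA ler_wpM2l ?exprn_ge0.
    by apply: main; rewrite subnK.
  rewrite ler_wpM2r ?(ltW (a_gt0 _ _))//.
  have n1 : (1 <= 2 ^+ n :> R)%R by rewrite exprn_ege1// ler1n.
  apply: (@le_trans _ _ ((2 ^+ n) ^+ J)%R); first by rewrite ler_weXn2l// leq_subr.
  by rewrite lerXn2r ?nnegrE ?(ltW B_gt0) ?(ltW B_gt)// (le_trans ler01).
have bot : (lam 0 <= a i x)%R.
  rewrite /lam expr0 mul1r -(a_levelwise xx0).
  move: (iJ) => /subnK <-; elim: (J - i)%N => // d IH; exact: le_trans (a_dec _ _) IH.
elim: (J.+1) top => [|K IH] top; first by move: top; rewrite ltNge bot.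
have [aK|Ka] := ltP (a i x) (lam K).
  by have [k kK H] := IH aK; exists k => //; exact: ltnW.
by exists K => //; rewrite Ka top.
Qed.

(** By [powR_sum01] the power of the sum is a sum of [a ^ p] over the stopping cells, each with a
    factor [g] for every larger one. Grouping them by height, [sum01_count] leaves a power
    of [g] that counts the stops inside the maximal cell of that height, and this count has exponential
    tails even for the weight. *)
Lemma integral_stops :
  \int[mu]_(x in lcell J x0) (((\sum_(i < J.+1) c i x * a i x `^ delta) `^ r)%:E * W x) <=
  (Cg * (g / (g - 1)) * ((1 + tail_const) * kap) * B `^ p)%:E *
  \sum_(k < J.+1) (lam k `^ p)%:E * Wsum k.
Proof.
have g10 : (0 < g - 1)%R by rewrite subr_gt0.
have gg0 : (0 <= g / (g - 1))%R by rewrite divr_ge0 ?(ltW g10).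
have lp0 k : (0 <= lam k `^ p)%R by exact: powR_ge0.
(* sorted by height [k] and by the level [T] of the maximal cell of that height *)
pose q k T x : R := (ind (stop k T x) * g `^ csum c T x)%R.
have q0 k T x : (0 <= q k T x)%R by rewrite mulr_ge0 ?ind_ge0 ?powR_ge0.
have pw x : lcell J x0 x ->
  ((\sum_(i < J.+1) c i x * a i x `^ delta) `^ r <=
   Cg * (g / (g - 1)) * \sum_(k < J.+1) lam k.+1 `^ p * \sum_(T < J.+1) q k T x)%R.
  move=> xx0.
  have := powR_sum01 r_gt0 g_gt1 Cg_ge0 splitCg (c01 ^~ x) (fun i => powR_ge0 (a i x) delta) J.
  move=> /le_trans; apply.
  rewrite -mulrA ler_wpM2l//.
  apply: (@le_trans _ _ (\sum_(i < J.+1) \sum_(k < J.+1)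
     lam k.+1 `^ p * (c i x * g `^ csum c i x * ind (big k i x)))%R).
    apply: ler_sum => i _; have iJ : (i <= J)%N by rewrite -ltnS.
    have [k kJ /andP[lk kl]] := lam_bracket iJ xx0.
    rewrite (bigD1 (Ordinal kJ))//= indT// mulr1 -[leLHS]addr0 lerD//.
      rewrite -powRrM dr_p mulrC ler_wpM2r ?mulr_ge0 ?powR_ge0//.
      by apply: le_powR; rewrite ?ltW.
    by apply: sumr_ge0 => l _; rewrite !mulr_ge0 ?ind_ge0 ?powR_ge0.
  rewrite exchange_big /= mulr_sumr; apply: ler_sum => k _.
  rewrite -mulr_sumr [leRHS]mulrCA ler_wpM2l//.
  have [[T tT]|N] := pselect (exists T, stop k T x); last first.
    rewrite big1; first by rewrite mulr_ge0// sumr_ge0.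
    move=> i _; rewrite indF ?mulr0// => bi; apply: N.
    by have [T _ tT] := ltop_ex (ltnSE (ltn_ord i)) bi; exists T.
  have TJ : (T < J.+1)%N by case: tT.
  apply: (@le_trans _ _ (g / (g - 1) * q k T x)%R); last first.
    rewrite ler_wpM2l// (bigD1 (Ordinal TJ))//= lerDl; exact: sumr_ge0.
  rewrite /q indT// mul1r.
  apply: le_trans (sum01_count g_gt1 (c01 ^~ x) T).
  rewrite -(big_mkord xpredT (fun i => c i x * g `^ csum c i x * ind (big k i x))%R).
  rewrite -(big_mkord xpredT (fun i => c i x * g `^ (\sum_(l < i.+1) c l x))%R).
  rewrite [leLHS](big_cat_nat _ (n := T.+1))//= -[leRHS]addr0 lerD//.
    apply: ler_sum => i _; rewrite ler_piMr ?ind_le1// mulr_ge0// powR_ge0 //.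
  rewrite big_nat big1// => i /andP[Ti iJ]; rewrite indF ?mulr0// => bi.
  by case: tT => _ _ N; apply: (N i) => //; rewrite Ti -ltnS.
have mq k T : measurable_fun [set: E] (fun x => (q k T x)%:E * W x).
  apply: emeasurable_funM => //; apply: (adapted_measurable s0) => x y xy.
  by rewrite /q (stop_levelwise k (idx_lev0 s0 T xy)) (adapted_csum s0 c_levelwise T xy).
have qW0 k T x : 0 <= (q k T x)%:E * W x by rewrite mule_ge0// lee_fin q0.
pose F k x := \sum_(T < J.+1) (q k T x)%:E * W x.
have F0 k x : 0 <= F k x by apply: sume_ge0 => T _; exact: qW0.
have mF k : measurable_fun [set: E] (F k) by exact: emeasurable_sum.
have lF0 k x : 0 <= (lam k.+1 `^ p)%:E * F k x by apply: mule_ge0 => //; rewrite lee_fin.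
have C0 : (0 <= Cg * (g / (g - 1)))%R by rewrite mulr_ge0.
apply: (@le_trans _ _ (\int[mu]_x ((Cg * (g / (g - 1)))%:E * \sum_(k < J.+1) (lam k.+1 `^ p)%:E * F k x))).
  rewrite [leLHS]integral_mkcond; apply: le_integral_nonneg => x _; rewrite /patch.
    by case: ifP => // _; rewrite mule_ge0// lee_fin powR_ge0.
  have S0 : 0 <= \sum_(k < J.+1) (lam k.+1 `^ p)%:E * F k x.
    by apply: sume_ge0 => k _; exact: lF0.
  case: ifPn => [|_]; last by rewrite mule_ge0.
  rewrite inE => /pw h; apply: (@le_trans _ _ ((Cg * (g / (g - 1)) *
    \sum_(k < J.+1) lam k.+1 `^ p * \sum_(T < J.+1) q k T x)%:E * W x)).
    by apply: lee_wpmul2r; rewrite ?lee_fin.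
  rewrite EFinM -muleA; apply: lee_wpmul2l; first by rewrite lee_fin.
  rewrite -sumEFin ge0_sume_distrl; last by move=> k _; rewrite lee_fin mulr_ge0// sumr_ge0.
  apply: lee_sum => k _; rewrite EFinM -muleA; apply: lee_wpmul2l; first by rewrite lee_fin.
  by rewrite -sumEFin ge0_sume_distrl// => T _; rewrite lee_fin.
rewrite ge0_integralZl; [|by []| | |by rewrite lee_fin]; last 2 first.
- by apply: emeasurable_sum => k; exact: emeasurable_funM.
- by move=> x _; apply: sume_ge0 => k _; exact: lF0.
rewrite -(mulrA (Cg * _)%R) (EFinM (Cg * _)) -muleA; apply: lee_wpmul2l; first by rewrite lee_fin.
rewrite ge0_integral_sum; [|by []| |]; last 2 first.
- by move=> k; exact: emeasurable_funM.
- by move=> k x _; exact: lF0.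
have K0 : (0 <= (1 + tail_const) * kap)%R by rewrite mulr_ge0 ?addr_ge0.
have W0 k : 0 <= Wsum k.
  by apply: integral_ge0 => x _; apply: sume_ge0 => j _; rewrite mule_ge0// lee_fin ind_ge0.
rewrite ge0_sume_distrr; last by move=> k _; apply: mule_ge0; rewrite ?lee_fin.
apply: lee_sum => k _; rewrite ge0_integralZl; [|by []|by []|by move=> x _|by rewrite lee_fin].
rewrite lamS powRM ?(ltW B_gt0) ?(ltW (lam_gt0 _))//.
have -> : ((1 + tail_const) * kap * B `^ p)%:E * ((lam k `^ p)%:E * Wsum k) =
   (B `^ p * lam k `^ p)%:E * (((1 + tail_const) * kap)%:E * Wsum k).
  by rewrite !muleA -!EFinM; congr (_%:E * _); ring.
apply: lee_wpmul2l; first by rewrite lee_fin mulr_ge0 ?powR_ge0.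
have tD0 T x : 0 <= (ind (stop k T x))%:E * D T x by rewrite mule_ge0// lee_fin ind_ge0.
have mtD T : measurable_fun [set: E] (fun x => (ind (stop k T x))%:E * D T x).
  apply: (adapted_measurable s0) => x y /(idx_lev0 s0 T) xy.
  by rewrite (stop_levelwise k xy) (D_levelwise xy).
rewrite /F /Wsum !ge0_integral_sum//.
rewrite ge0_sume_distrr; last by move=> T _; exact: integral_ge0.
apply: lee_sum => T _; rewrite -ge0_integralZl//.
apply: (le_integral_cells (lev_gt0 T s0)) => //.
- by apply: emeasurable_funM.
- by move=> x _; rewrite mule_ge0.
move=> z; rewrite !setTI -/(lcell T z).
have [tz|tz] := pselect (stop k T z); last first.
  rewrite integral0_eq; first by apply: integral_ge0 => x _; rewrite mule_ge0.
  by move=> x xz; rewrite /q (stop_levelwise k xz) indF// mul0r mul0e.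
have TJ : (T <= J)%N by case: tz.
apply: (@le_trans _ _ (\int[mu]_(x in lcell T z) ((g `^ csum c T x)%:E * W x))).
  by apply: le_integral_nonneg => x xz //; rewrite /q (stop_levelwise k xz) indT// mul1r.
apply: (le_trans (integral_powR_csum z TJ)).
rewrite (@eq_integral _ _ _ mu _ (fun=> ((1 + tail_const) * kap)%:E * D T z)); last first.
  by move=> x; rewrite inE => xz; rewrite (stop_levelwise k xz) indT// mul1e (D_levelwise xz).
by rewrite (integral_lcell_cst s0) muleA.
Qed.

End sawyer.

(** * Tail integrals of a weight *)

Section geometry.
Context {R : realType} {n : nat}.
Local Notation E := (euclid R n).
Local Notation mu := (lebesgue R n).
Implicit Types (t : R) (x y : E).

Lemma floor_dist (u v : R) : (`|u - v| <= 1)%R -> (`|Num.floor u - Num.floor v| <= 1)%R.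
Proof.
have aux (a b : R) : (a <= b + 1)%R -> (Num.floor a <= Num.floor b + 1 :> int)%R.
  move=> ab; rewrite -ltzD1 -(@ltr_int R).
  have /andP[a1 _] := floor_itv a; have /andP[_ b2] := floor_itv b.
  apply: (le_lt_trans a1); apply: (le_lt_trans ab).
  by rewrite [ltRHS]intrD ltrD2r.
rewrite ler_norml => /andP[h1 h2].
have := aux u v; have := aux v u; rewrite ler_norml.
have -> : (u <= v + 1)%R by lra.
have -> : (v <= u + 1)%R by lra.
by move=> /(_ isT) h3 /(_ isT) h4; apply/andP; split; lia.
Qed.

Lemma interval_bound (A T Y Z C l : R) : (A <= Z)%R -> (Z <= A + T)%R ->
  (C <= Y)%R -> (Y <= C + l)%R -> (C <= Z)%R -> (Z <= C + l)%R -> (l < T)%R ->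
  (A - T <= Y < A + (T + T))%R.
Proof. by move=> *; apply/andP; split; lra. Qed.

Lemma near_cell3 t x y : (0 < t)%R -> (forall i, `|tnth y i - tnth x i| <= t)%R -> cell3 t x y.
Proof.
move=> t0 H; apply/adjP => i; rewrite !ffunE; apply: floor_dist.
by rewrite -mulrBl normrM [X in (_ * X)%R]gtr0_norm ?invr_gt0// ler_pdivrMr// mul1r.
Qed.

(** The triples of the ancestors of one cell exhaust the space, unlike the ancestors themselves. *)
Lemma far_cell3 t x y : (0 < t)%R -> exists m, cell3 (t * 2 ^+ m)%R x y.
Proof.
move=> t0; pose b := (\sum_(i < n) `|tnth y i - tnth x i|)%R.
have := @upper_nthrootP R (b / t)%R _ (leqnn _); set m := Num.bound _ => bm.
exists m; apply: near_cell3; first exact: lev_gt0.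
move=> i; apply: (@le_trans _ _ b).
  by rewrite /b (bigD1 i)//= lerDl; apply: sumr_ge0.
by rewrite mulrC -ler_pdivrMr// ltW.
Qed.

Lemma first_cell3 t x y : (0 < t)%R -> exists m, cell3 (t * 2 ^+ m)%R x y /\
  forall k, (k < m)%N -> ~ cell3 (t * 2 ^+ k)%R x y.
Proof.
move=> t0; have [m hm] := far_cell3 x y t0.
have ex : exists m, `[< cell3 (t * 2 ^+ m)%R x y >] by exists m; apply/asboolP.
exists (ex_minn ex); case: ex_minnP => k /asboolP hk kmin; split => // l lk hl.
by have := kmin l (asboolT hl); rewrite leqNgt lk.
Qed.

Lemma cell3_double_sub t x y : (0 < t)%R -> cell3 t x y ->
  cell3 t y `<=` cell3 (2 * t)%R x.
Proof. by move=> t0 xy z yz; exact: adj_trans_double yz xy. Qed.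

End geometry.

Section tail_integrals.
Context {R : realType} {n : nat}.
Hypothesis n_gt0 : (0 < n)%N.
Local Notation E := (euclid R n).
Local Notation mu := (lebesgue R n).
Implicit Types (t : R) (x y : E).
Variables (w : E -> R) (q c0 de : R).
Hypothesis w_weight : weight w.
Hypothesis q_gt1 : (1 < q)%R.
Hypothesis c0_gt0 : (0 < c0)%R.
Hypothesis de_gt0 : (0 < de)%R.
Hypothesis w_Cq : forall Q (A : set E), is_cube Q -> measurable A -> A `<=` Q ->
  \int[mu]_(x in A) (w x)%:E <= c0%:E * (mu A / mu Q) `^ de *
     \int[mu]_x (maximal (fun y => (\1_Q y)%:E) x `^ q * (w x)%:E).

Definition wE x : \bar R := (w x)%:E.

(** The factor by which [M (1_Q) ^ q] decreases when the distance to the cube [Q] is doubled. *)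
Definition th0 : R := (2 `^ (- (n%:R * q)))%R.

Definition w3 t x : \bar R := \int[mu]_(y in cell3 t x) wE y.

Definition wtail t x : \bar R := \sum_(0 <= m <oo) (th0 ^+ m)%:E * w3 (t * 2 ^+ m)%R x.

(** The average over the cell of the integral of the weight against the
    dyadic model [\sum_m th0 ^+ m * \1_(cell3 (t * 2 ^+ m) x)] of
    the power [q] of the maximal function of the cell. *)
Definition Dw t x : \bar R := ((t ^+ n)^-1)%:E * wtail t x.

Lemma measurable_wE : measurable_fun [set: E] wE.
Proof. by apply/measurable_EFinP; case: w_weight. Qed.

Lemma wE_ge0 x : 0 <= wE x.
Proof. by rewrite lee_fin; case: w_weight. Qed.

Lemma w3_ge0 t x : 0 <= w3 t x.
Proof. by apply: integral_ge0 => y _; exact: wE_ge0. Qed.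

Lemma th0_gt0 : (0 < th0)%R. Proof. by rewrite powR_gt0. Qed.

Lemma two_pow_n : (2 ^+ n = 2 `^ n%:R :> R)%R. Proof. by rewrite powR_mulrn. Qed.

Lemma beta_itv : (0 < th0 * 2 ^+ n < 1)%R.
Proof.
rewrite mulr_gt0 ?th0_gt0 ?exprn_gt0//= two_pow_n /th0 -powRD; last by apply/implyP.
have h : (0 < n%:R * (q - 1))%R by rewrite mulr_gt0 ?ltr0n// subr_gt0.
have -> : (- (n%:R * q) + n%:R = - (n%:R * (q - 1)))%R by ring.
by rewrite powRN invf_lt1 ?powR_gt0//; apply: powR_gt1 => //; rewrite ltr1n.
Qed.

Lemma th0_lt1 : (th0 < 1)%R.
Proof.
have /andP[_] := beta_itv; apply: le_lt_trans; rewrite ler_peMr ?(ltW th0_gt0)//.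
by rewrite exprn_ege1// ler1n.
Qed.

Let tw_ge0 t x m : 0 <= (th0 ^+ m)%:E * w3 (t * 2 ^+ m)%R x.
Proof. by rewrite mule_ge0 ?w3_ge0// lee_fin exprn_ge0// ltW// th0_gt0. Qed.

Lemma wtail_ge0 t x : 0 <= wtail t x.
Proof. exact: nneseries_ge0. Qed.

Lemma wtail_rec t x : wtail t x = w3 t x + th0%:E * wtail (2 * t)%R x.
Proof.
pose f m := (th0 ^+ m)%:E * w3 (t * 2 ^+ m)%R x.
have f0 m : 0 <= f m by exact: tw_ge0.
have -> : wtail t x = \sum_(0 <= k < 0 + 1) f k + \sum_(0 + 1 <= k <oo) f k.
  exact: (@nneseries_split R f 0 1 (fun k _ => f0 k)).
rewrite add0n big_nat1 {1}/f expr0 mul1e expr0 mulr1; congr (_ + _).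
have <- : \sum_(0 <= i <oo) f (i + 1)%N = \sum_(1 <= i <oo) f i.
  exact: (@nneseries_addn R f 1 f0).
have <- : \sum_(0 <= i <oo) (th0%:E * ((th0 ^+ i)%:E * w3 (2 * t * 2 ^+ i)%R x)) =
          th0%:E * wtail (2 * t)%R x.
  by apply: nneseriesZl => i _; exact: tw_ge0.
apply: eq_eseriesr => m _; rewrite /f addn1.
have -> : (2 * t * 2 ^+ m = t * 2 ^+ m.+1)%R by rewrite (exprS 2%R); ring.
by rewrite muleA -EFinM -exprS.
Qed.

Lemma Dw_ge0 t x : (0 < t)%R -> 0 <= Dw t x.
Proof. by move=> t0; rewrite mule_ge0 ?wtail_ge0// lee_fin invr_ge0 exprn_ge0// ltW. Qed.

Lemma Dw_vol t x : (0 < t)%R -> Dw t x * (t ^+ n)%:E = wtail t x.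
Proof.
move=> t0; rewrite /Dw muleC muleA -EFinM divff ?mul1e//.
by rewrite gt_eqF// exprn_gt0.
Qed.

Lemma Dw_rec t x : (0 < t)%R ->
  Dw t x = ((t ^+ n)^-1)%:E * w3 t x + (th0 * 2 ^+ n)%:E * Dw (2 * t)%R x.
Proof.
move=> t0; have tn0 : (t ^+ n != 0)%R by rewrite gt_eqF// exprn_gt0.
rewrite {1}/Dw wtail_rec ge0_muleDr ?w3_ge0//; last first.
  by rewrite mule_ge0 ?wtail_ge0// lee_fin ltW// th0_gt0.
congr (_ + _); rewrite /Dw !muleA -!EFinM; congr (_%:E * _).
by rewrite exprMn; field; rewrite tn0 /= expf_neq0.
Qed.

(** The triple of a neighbour lies in the triple of the parent, one scale above. *)
Lemma Dw_near t x y : (0 < t)%R -> cell3 t x y -> Dw t y <= (th0^-1)%:E * Dw t x.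
Proof.
move=> t0 xy; rewrite /Dw muleCA; apply: lee_wpmul2l.
  by rewrite lee_fin invr_ge0 exprn_ge0// ltW.
rewrite (wtail_rec t x) -lee_pdivrMl ?invr_gt0 ?th0_gt0// invrK.
apply: (@le_trans _ _ (th0%:E * wtail (2 * t)%R x)); last by rewrite leeDr ?w3_ge0.
apply: lee_wpmul2l; first by rewrite lee_fin ltW// th0_gt0.
apply: lee_nneseries => [m _ _|m _]; first exact: tw_ge0.
apply: lee_wpmul2l; first by rewrite lee_fin exprn_ge0// ltW// th0_gt0.
have t2 := lev_gt0 m t0; have t22 : (0 < 2 * t * 2 ^+ m)%R by rewrite lev_gt0// mulr_gt0.
apply: ge0_subset_integral; [exact: measurable_cell3|exact: measurable_cell3| | |].
- by apply: measurable_funTS; exact: measurable_wE.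
- by move=> z _; exact: wE_ge0.
have -> : (2 * t * 2 ^+ m = 2 * (t * 2 ^+ m))%R by ring.
apply: cell3_double_sub => //.
by have := @adj_lev R n t 0 m y x t0 (leq0n m); rewrite expr0 mulr1; apply.
Qed.

(** A cube that meets [Q] and contains a point [y] outside of the triple at scale [m] has side at
    least that scale. *)
Lemma maximal_cell_le t x (Q : set E) m y : (0 < t)%R -> measurable Q ->
  mu Q = (t ^+ n)%:E ->
  (forall z, Q z -> forall i, ((idx t x i)%:~R * t <= tnth z i <= (idx t x i + 1)%:~R * t)%R) ->
  ~ cell3 (t * 2 ^+ m)%R x y ->
  maximal (fun z => (\1_Q z)%:E) y <= (2 ^- m ^+ n)%:E.
Proof.
move=> t0 mQ muQ Qcell Ny.
apply: ge_ereal_sup => _ /= [P [cP Py] <-].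
have mP := measurable_cube cP.
rewrite /mean (@eq_integral _ _ _ mu P (fun z => (\1_Q z)%:E)); last first.
  by move=> z _ /=; rewrite ger0_norm.
rewrite (integral_indic mu mP mQ).
have [QP|/set0P[z [Qz Pz]]] := eqVneq (Q `&` P) set0.
  by rewrite QP measure0 mul0e lee_fin exprn_ge0// invr_ge0 exprn_ge0.
have [a [l [l0 PE]]] := cP.
have t'0 : (0 < t * 2 ^+ m)%R by exact: lev_gt0.
have lt : (t * 2 ^+ m <= l)%R.
  rewrite leNgt; apply/negP => ll; apply: Ny; rewrite cell3E// => i /=.
  rewrite in_itv /=; set K := idx _ x i.
  have := floor_itv (tnth x i / (t * 2 ^+ m))%R.
  have -> : Num.floor (tnth x i / (t * 2 ^+ m))%R = K by rewrite /K ffunE.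
  rewrite ler_pdivlMr// ltr_pdivrMr// => /andP[K1 K2].
  have pow2 : (2 ^+ m = (2 ^ m)%:R%:~R :> R)%R by rewrite rmorph_nat natrX.
  have := Qcell z Qz i; rewrite ffunE; set k := Num.floor (tnth x i / t)%R => /andP[z1 z2].
  have k1 : (K * (2 ^ m)%:R <= k)%R.
    by rewrite /k floor_ge_int ler_pdivlMr// intrM -pow2 -mulrA (mulrC (2 ^+ m)%R).
  have k2 : (k + 1 <= (K + 1) * (2 ^ m)%:R)%R.
    by rewrite lezD1 /k floor_lt_int ltr_pdivrMr// intrM -pow2 -mulrA (mulrC (2 ^+ m)%R).
  have z1' : (K%:~R * (t * 2 ^+ m) <= tnth z i)%R.
    apply: le_trans z1; rewrite (mulrC t) mulrA ler_wpM2r ?(ltW t0)// pow2 -intrM ler_int//.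
  have z2' : (tnth z i <= (K + 1)%:~R * (t * 2 ^+ m))%R.
    apply: (le_trans z2); rewrite (mulrC t) mulrA ler_wpM2r ?(ltW t0)// pow2 -intrM ler_int//.
  move: Py Pz; rewrite PE /= => /(_ i) /andP[y1 y2] /(_ i) /andP[a1 a2].
  have e1 : ((K - 1)%:~R * (t * 2 ^+ m) = K%:~R * (t * 2 ^+ m) - t * 2 ^+ m)%R.
    by rewrite intrB mulrBl mul1r.
  have e2 : ((K + 2)%:~R * (t * 2 ^+ m) = K%:~R * (t * 2 ^+ m) + (t * 2 ^+ m + t * 2 ^+ m))%R.
    by rewrite intrD mulrDl (_ : 2%:~R = 1 + 1 :> R)%R// mulrDl !mul1r.
  have e3 : ((K + 1)%:~R * (t * 2 ^+ m) = K%:~R * (t * 2 ^+ m) + t * 2 ^+ m)%R.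
    by rewrite intrD mulrDl mul1r.
  rewrite e1 e2; rewrite e3 in z2'.
  exact: (interval_bound z1' z2' y1 y2 a1 a2 ll).
have muP : mu P = (l ^+ n)%:E by rewrite PE mu_closed_box.
have tl : (0 < l ^+ n)%R by rewrite exprn_gt0.
rewrite muP inver gt_eqF// lee_pdivrMr//.
apply: (@le_trans _ _ (mu Q)).
  by apply: le_measure; rewrite ?inE; [exact: measurableI|exact: mQ|exact: subIsetl].
rewrite muQ -EFinM lee_fin -exprMn lerXn2r ?nnegrE ?(ltW t0)//.
  by rewrite mulr_ge0 ?(ltW l0)// invr_ge0 exprn_ge0.
by rewrite ler_pdivlMl ?exprn_gt0// mulrC.
Qed.

Lemma th0_inv : (th0^-1 = (2 ^+ n) `^ q)%R.
Proof. by rewrite /th0 powRN invrK powRrM two_pow_n. Qed.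

Lemma th0_pow m : ((2 ^- m ^+ n) `^ q = th0 ^+ m)%R.
Proof.
rewrite -exprVn -exprM mulnC exprM.
have -> : ((2^-1 ^+ n : R) = (2 ^+ n)^-1)%R by rewrite exprVn.
have h : (0 <= (2 ^+ n)^-1 :> R)%R by rewrite invr_ge0 exprn_ge0.
by rewrite -(powR_mulrn m h) powRAC powR_mulrn ?powR_ge0// /th0 two_pow_n -powRN -powRrM mulNr.
Qed.

(** Apply [maximal_cell_le] at the last scale before the triples reach [y]; the scale lost is the
    factor [th0^-1]. *)
Lemma maximal_cell_pow t x (Q : set E) y : (0 < t)%R -> is_cube Q ->
  mu Q = (t ^+ n)%:E ->
  (forall z, Q z -> forall i, ((idx t x i)%:~R * t <= tnth z i <= (idx t x i + 1)%:~R * t)%R) ->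
  maximal (fun z => (\1_Q z)%:E) y `^ q <=
  (th0^-1)%:E * \sum_(0 <= m <oo) (th0 ^+ m * ind (cell3 (t * 2 ^+ m)%R x y))%:E.
Proof.
move=> t0 cQ muQ Qcell; have mQ := measurable_cube cQ.
have M0 z : 0 <= maximal (fun z => (\1_Q z)%:E) z.
  have [P [cP cellP muP _]] := cell_sub_cube z t0.
  apply: (@le_trans _ _ (mean P (fun y => `|(\1_Q y)%:E|))).
    rewrite /mean mule_ge0//; first by apply: integral_ge0 => u _; exact: abse_ge0.
    by rewrite muP inver gt_eqF ?exprn_gt0// lee_fin invr_ge0 exprn_ge0// ltW.
  by apply: ereal_sup_ubound; exists P => //; split => //; apply: cellP; exact: cell_refl.
have q0 : (0 <= q)%R by rewrite ltW// (lt_trans ltr01).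
have i0 m : 0 <= (th0 ^+ m * ind (cell3 (t * 2 ^+ m)%R x y))%:E.
  by rewrite lee_fin mulr_ge0 ?ind_ge0// exprn_ge0// ltW// th0_gt0.
have [m [ym Nm]] := first_cell3 x y t0.
rewrite -lee_pdivrMl ?invr_gt0 ?th0_gt0// invrK.
apply: (@le_trans _ _ (th0 ^+ m)%:E); last first.
  apply: le_trans (nneseries_lim_ge m.+1 (fun k _ _ => i0 k)).
  rewrite big_nat_recr//= indT// mulr1 leeDr//.
  by apply: sume_ge0 => k _; exact: i0.
case: m ym Nm => [|m] ym Nm.
  rewrite expr0; apply: (@le_trans _ _ (th0%:E * 1)); last by rewrite mule1 lee_fin ltW// th0_lt1.
  apply: lee_wpmul2l; first by rewrite lee_fin ltW// th0_gt0.
  rewrite -(poweR1r q); apply: le_poweR => //.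
  apply: ge_ereal_sup => _ /= [P [cP Py] <-]; have mP := measurable_cube cP.
  rewrite /mean (@eq_integral _ _ _ mu P (fun z => (\1_Q z)%:E)); last first.
    by move=> z _ /=; rewrite ger0_norm.
  rewrite (integral_indic mu mP mQ).
  have [a [l [l0 PE]]] := cP.
  have muP : mu P = (l ^+ n)%:E by rewrite PE mu_closed_box.
  rewrite [X in _ / X]muP inver gt_eqF ?exprn_gt0// lee_pdivrMr ?exprn_gt0// mul1e -muP.
  by apply: le_measure; rewrite ?inE; [exact: measurableI|exact: mP|exact: subIsetr].
rewrite exprS EFinM; apply: lee_wpmul2l; first by rewrite lee_fin ltW// th0_gt0.
rewrite -th0_pow -poweR_EFin; apply: le_poweR => //.
by apply: (maximal_cell_le t0 mQ muQ Qcell); exact: Nm.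
Qed.

Lemma integral_maximal_cell t x (Q : set E) : (0 < t)%R -> is_cube Q ->
  mu Q = (t ^+ n)%:E ->
  (forall z, Q z -> forall i, ((idx t x i)%:~R * t <= tnth z i <= (idx t x i + 1)%:~R * t)%R) ->
  \int[mu]_y (maximal (fun z => (\1_Q z)%:E) y `^ q * wE y) <= (th0^-1)%:E * wtail t x.
Proof.
move=> t0 cQ muQ Qcell.
have i0 m y : 0 <= (th0 ^+ m * ind (cell3 (t * 2 ^+ m)%R x y))%:E.
  by rewrite lee_fin mulr_ge0 ?ind_ge0// exprn_ge0// ltW// th0_gt0.
have t2 m := lev_gt0 m t0.
pose f m y := (th0 ^+ m * ind (cell3 (t * 2 ^+ m)%R x y))%:E * wE y.
have f0 m y : 0 <= f m y by rewrite mule_ge0// wE_ge0.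
have mf m : measurable_fun [set: E] (f m).
  apply: emeasurable_funM; last exact: measurable_wE.
  under eq_fun do rewrite EFinM -indE.
  apply: emeasurable_funM => //; apply/measurable_EFinP/measurable_indic.
  exact: measurable_cell3.
have thi : 0 <= (th0^-1)%:E by rewrite lee_fin invr_ge0 ltW// th0_gt0.
apply: (@le_trans _ _ (\int[mu]_y ((th0^-1)%:E * \sum_(0 <= m <oo) f m y))).
  apply: le_integral_nonneg => y _; first by rewrite mule_ge0 ?poweR_ge0 ?wE_ge0.
  apply: (@le_trans _ _ ((th0^-1)%:E * (\sum_(0 <= m <oo) (th0 ^+ m * ind (cell3 (t * 2 ^+ m)%R x y))%:E) * wE y)).
    by apply: lee_wpmul2r; [exact: wE_ge0|exact: maximal_cell_pow].
  rewrite -muleA; apply: lee_wpmul2l => //.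
  rewrite muleC /wE -nneseriesZl//; apply: lee_nneseries => [m _ _|m _]; first by rewrite mule_ge0// wE_ge0.
  by rewrite /f muleC.
rewrite ge0_integralZl//; [|exact: ge0_emeasurable_sum|by move=> y _; exact: nneseries_ge0].
apply: lee_wpmul2l => //.
rewrite integral_nneseries//; apply: lee_nneseries => [m _ _|m _]; first by apply: integral_ge0 => y _; exact: f0.
rewrite /w3 -ge0_integralZl//; last 4 first.
- exact: measurable_cell3.
- by apply: measurable_funTS; exact: measurable_wE.
- by move=> y _; exact: wE_ge0.
- by rewrite lee_fin exprn_ge0// ltW// th0_gt0.
rewrite [leRHS]integral_mkcond; apply: le_integral_nonneg => y _ //.
rewrite /patch /f; case: ifPn; rewrite ?inE ?notin_setE => yx; first by rewrite indT// mulr1.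
by rewrite indF// mulr0 mul0e.
Qed.

Definition kapw : R := (c0 * th0^-1)%R.
Definition rhow : R := (2 `^ (- de))%R.

Lemma rhow_itv : (0 < rhow < 1)%R.
Proof.
rewrite powR_gt0//= /rhow powRN invf_lt1 ?powR_gt0//; apply: powR_gt1 => //.
by rewrite ltr1n.
Qed.

(** The [C_p] condition, stated for the dyadic tail integral. *)
Lemma wE_small t x i (A : set E) : (0 < t)%R -> measurable A -> A `<=` cell t x ->
  mu A <= (2 ^- i * t ^+ n)%:E ->
  \int[mu]_(y in A) wE y <= (kapw * rhow ^+ i)%:E * (Dw t x * (t ^+ n)%:E).
Proof.
move=> t0 mA Acell muA; have [Q [cQ cellQ muQ Qcell]] := cell_sub_cube x t0.
have tn : (0 < t ^+ n)%R by rewrite exprn_gt0.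
apply: (le_trans (w_Cq cQ mA (subset_trans Acell cellQ))).
rewrite Dw_vol//.
have -> : (kapw * rhow ^+ i)%:E * wtail t x = (c0%:E * (rhow ^+ i)%:E) * ((th0^-1)%:E * wtail t x).
  by rewrite muleA -!EFinM; congr (_%:E * _); rewrite /kapw; ring.
apply: lee_pmul; last exact: integral_maximal_cell.
- by rewrite mule_ge0 ?poweR_ge0// lee_fin ltW.
- by apply: integral_ge0 => y _; rewrite mule_ge0 ?poweR_ge0// wE_ge0.
apply: lee_wpmul2l; first by rewrite lee_fin ltW.
have -> : (rhow ^+ i = (2 ^- i) `^ de)%R.
  rewrite /rhow -(powR_mulrn i (powR_ge0 _ _)) -(powR_invn i (ler0n R 2)) -!powRrM.
  by congr (_ `^ _)%R; ring.
rewrite -poweR_EFin; apply: le_poweR; first exact: ltW.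
  by rewrite mule_ge0// muQ inver gt_eqF// lee_fin invr_ge0 ltW.
by rewrite muQ inver gt_eqF// lee_pdivrMr.
Qed.

End tail_integrals.

(** * Averages over tripled cells *)

Section tripled_averages.
Context {R : realType} {n : nat}.
Hypothesis n_gt0 : (0 < n)%N.
Local Notation E := (euclid R n).
Local Notation mu := (lebesgue R n).
Implicit Types (t : R) (x y : E).
Variable h : E -> \bar R.
Hypothesis mh : measurable_fun [set: E] h.
Hypothesis h_ge0 : forall x, 0 <= h x.

Definition avg3 t x : \bar R := (((3 * t) ^+ n)^-1)%:E * \int[mu]_(y in cell3 t x) h y.

(** The largest average of [h] over the triples of the dyadic ancestors of
    a cell: a quantity attached to the cell that is comparable with the infimum over
    the cell of the maximal function of [h]. *)
Definition amax t x : \bar R := ereal_sup (range (fun m => avg3 (t * 2 ^+ m)%R x)).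

Let c3 t : (0 < t)%R -> 0 <= (((3 * t) ^+ n)^-1)%:E.
Proof. by move=> t0; rewrite lee_fin invr_ge0 exprn_ge0// mulr_ge0// ltW. Qed.

Let t3n t : (0 < t)%R -> (0 < (3 * t) ^+ n)%R.
Proof. by move=> t0; rewrite exprn_gt0// mulr_gt0. Qed.

Lemma avg3_ge0 t x : (0 < t)%R -> 0 <= avg3 t x.
Proof. by move=> t0; rewrite mule_ge0 ?c3// integral_ge0. Qed.

Lemma avg3_le_amax t x m : avg3 (t * 2 ^+ m)%R x <= amax t x.
Proof. by apply: ereal_sup_ubound; exists m. Qed.

Lemma avg3_le_amax0 t x : avg3 t x <= amax t x.
Proof. by have := avg3_le_amax t x 0; rewrite expr0 mulr1. Qed.

Lemma amax_ge0 t x : (0 < t)%R -> 0 <= amax t x.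
Proof. by move=> t0; apply: le_trans (avg3_le_amax0 t x); exact: avg3_ge0. Qed.

Lemma amax_double t x : amax (2 * t)%R x <= amax t x.
Proof.
apply: ge_ereal_sup => _ /= [m _ <-].
have -> : (2 * t * 2 ^+ m = t * 2 ^+ m.+1)%R by rewrite (exprS 2%R); ring.
exact: avg3_le_amax.
Qed.

Lemma avg3_double t x : (0 < t)%R -> avg3 t x <= (2 ^+ n)%:E * avg3 (2 * t)%R x.
Proof.
move=> t0; rewrite /avg3 muleA -EFinM.
have -> : (2 ^+ n * ((3 * (2 * t)) ^+ n)^-1 = ((3 * t) ^+ n)^-1)%R.
  have -> : (3 * (2 * t) = 2 * (3 * t))%R by ring.
  by rewrite [in LHS](exprMn _ 2%R) invfM mulrA divff ?mul1r// expf_neq0.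
apply: lee_wpmul2l; first exact: c3.
have t2 : (0 < 2 * t)%R by rewrite mulr_gt0.
apply: ge0_subset_integral; [exact: measurable_cell3|exact: measurable_cell3|exact: measurable_funTS|by []|].
by move=> y; exact: adj_double.
Qed.

Lemma amax_step t x : (0 < t)%R -> amax t x <= (2 ^+ n)%:E * amax (2 * t)%R x.
Proof.
move=> t0; have t2 : (0 < 2 * t)%R by rewrite mulr_gt0.
have n0 : 0 <= (2 ^+ n : R)%:E by rewrite lee_fin exprn_ge0.
apply: ge_ereal_sup => _ /= [[|m] _ <-].
  rewrite expr0 mulr1; apply: (le_trans (avg3_double x t0)).
  by apply: lee_wpmul2l => //; exact: avg3_le_amax0.
have -> : (t * 2 ^+ m.+1 = 2 * t * 2 ^+ m)%R by rewrite (exprS 2%R); ring.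
apply: (le_trans (avg3_le_amax _ _ _)).
by rewrite -[leLHS]mul1e lee_wpmul2r ?amax_ge0// lee_fin exprn_ege1// ler1n.
Qed.

Lemma amax_step_lev t x m : (0 < t)%R -> amax t x <= ((2 ^+ n) ^+ m)%:E * amax (t * 2 ^+ m)%R x.
Proof.
move=> t0; elim: m => [|m IH]; first by rewrite !expr0 mulr1 mul1e.
apply: (le_trans IH); rewrite exprSr EFinM -muleA; apply: lee_wpmul2l.
  by rewrite lee_fin !exprn_ge0.
by rewrite levS; apply: amax_step; exact: lev_gt0.
Qed.

Lemma amax_idx t x y : (0 < t)%R -> idx t x = idx t y -> amax t x = amax t y.
Proof.
move=> t0 xy; apply: (f_equal (@ereal_sup R)); apply: eq_imagel => m _.
by rewrite /avg3 (eq_cell3 (idx_lev0 t0 m xy)).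
Qed.

Let absh y : `|h y| = h y. Proof. exact: gee0_abs. Qed.

Lemma avg3_le_maximal t x y : (0 < t)%R -> cell3 t x y -> avg3 t x <= maximal h y.
Proof.
move=> t0 xy; have [Q [cQ sQ muQ]] := cell3_sub_cube x t0.
apply: (@le_trans _ _ (mean Q (fun z => `|h z|))); last first.
  by apply: ereal_sup_ubound; exists Q => //; split => //; exact: sQ.
rewrite /mean muQ inver gt_eqF ?t3n// muleC.
rewrite /avg3 muleC [leRHS]muleC; apply: lee_wpmul2r; first exact: c3.
rewrite (@eq_integral _ _ _ mu Q h); last by move=> z _; exact: absh.
apply: ge0_subset_integral => //; [exact: measurable_cell3|exact: measurable_cube|].
exact: measurable_funTS.
Qed.

Lemma amax_le_maximal t x y : (0 < t)%R -> cell3 t x y -> amax t x <= maximal h y.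
Proof.
move=> t0 xy; apply: ge_ereal_sup => _ /= [m _ <-].
apply: avg3_le_maximal; first exact: lev_gt0.
by have := @adj_lev R n t 0 m y x t0 (leq0n m); rewrite expr0 mulr1; apply.
Qed.

(** Every cube lies in the triple of a cell of comparable side. The cells larger than the given one
    are accounted for by [amax], the smaller ones separately. *)
Lemma maximal_le_avg3 t x : (0 < t)%R ->
  maximal h x <= (6 ^+ n)%:E * maxe (amax t x)
     (ereal_sup (range (fun m => avg3 (t * 2 ^- m)%R x))).
Proof.
move=> t0; apply: ge_ereal_sup => _ /= [Q [cQ Qx] <-].
rewrite /mean (@eq_integral _ _ _ mu Q h); last by move=> z _; exact: absh.
have [a [l [l0 QE]]] := cQ.
have mQ := measurable_cube cQ.
have muQ : mu Q = (l ^+ n)%:E by rewrite QE mu_closed_box.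
suff [u [u0 lu ul Hu]] : exists u, [/\ (0 < u)%R, (l <= u)%R, (u <= 2 * l)%R &
    avg3 u x <= maxe (amax t x) (ereal_sup (range (fun m => avg3 (t * 2 ^- m)%R x)))].
  apply: (@le_trans _ _ ((6 ^+ n)%:E * avg3 u x)); last first.
    by apply: lee_wpmul2l; rewrite // lee_fin exprn_ge0.
  have ln : (0 < l ^+ n)%R by rewrite exprn_gt0.
  rewrite muQ inver gt_eqF// muleC.
  apply: (@le_trans _ _ (((l ^+ n)^-1)%:E * \int[mu]_(y in cell3 u x) h y)).
    apply: lee_wpmul2l; first by rewrite lee_fin invr_ge0 ltW.
    apply: ge0_subset_integral => //; [exact: measurable_cell3|exact: measurable_funTS|].
    apply: cube_sub_cell3 => //; rewrite muQ lee_fin lerXn2r// nnegrE ltW//.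
  rewrite /avg3 muleA; apply: lee_wpmul2r; first exact: integral_ge0.
  rewrite -EFinM lee_fin ler_pdivlMr ?t3n// ler_pdivrMl//.
  have [l00 u00] := (ltW l0, ltW u0).
  by rewrite -exprMn lerXn2r ?nnegrE ?mulr_ge0//; lra.
have [tl|lt] := leP t l.
  have ex : exists m, (l <= t * 2 ^+ m)%R.
    exists (Num.bound (l / t)); have := @upper_nthrootP R (l / t)%R _ (leqnn _).
    by rewrite ltr_pdivrMr// mulrC => /ltW.
  exists (t * 2 ^+ ex_minn ex)%R; case: ex_minnP => m lm mmin; split => //.
  - exact: lev_gt0.
  - case: m lm mmin => [|m] lm mmin; first by rewrite expr0 mulr1; lra.
    have lm' : (t * 2 ^+ m < l)%R.
      by rewrite ltNge; apply/negP => /mmin; rewrite ltnn.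
    by rewrite levS; lra.
  - by rewrite le_max avg3_le_amax.
have ex : exists m, (t * 2 ^- m < l)%R.
  exists (Num.bound (t / l)); have := @upper_nthrootP R (t / l)%R _ (leqnn _).
  by rewrite ltr_pdivrMr// ltr_pdivrMr ?exprn_gt0// mulrC.
have [m [lm ml]] : exists m, (l <= t * 2 ^- m)%R /\ (t * 2 ^- m.+1 < l)%R.
  exists (ex_minn ex).-1; case: ex_minnP => [[|m]] lm mmin.
    by move: lm; rewrite expr0 invr1 mulr1 => /(lt_trans lt); rewrite ltxx.
  by split => //=; rewrite leNgt; apply/negP => /mmin; rewrite ltnn.
exists (t * 2 ^- m)%R; split => //.
- by rewrite divr_gt0// exprn_gt0.
- by move: ml; rewrite (exprS 2%R) invfM; lra.
- by rewrite le_max; apply/orP; right; apply: ereal_sup_ubound; exists m.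
Qed.

Let pow2V t N m : (m <= N)%N -> (t * 2 ^- N * 2 ^+ (N - m) = t * 2 ^- m)%R.
Proof.
move=> mN; rewrite -mulrA; congr (t * _)%R.
have -> : (2 ^+ N = 2 ^+ (N - m) * 2 ^+ m :> R)%R by rewrite -exprD subnK.
by rewrite invfM mulrAC mulVf ?mul1r// expf_neq0.
Qed.

Let lt_avg3E (l u : R) y : (0 < u)%R ->
  (l%:E < avg3 u y) = ((l * (3 ^+ n * u ^+ n))%:E < \int[mu]_(z in cell3 u y) h z).
Proof. by move=> u0; rewrite /avg3 lte_pdivlMl ?t3n// -EFinM exprMn mulrC. Qed.

(** By the weak type estimate at all scales below the cell, the points with a large average
    over a small tripled cell cannot fill the cell. *)
Lemma exists_maximal_le t x : (0 < t)%R -> 0 < amax t x -> amax t x < +oo ->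
  exists2 y, cell t x y & maximal h y <= (6 ^+ n * (2 * (3 ^+ n * 3 ^+ n)))%:E * amax t x.
Proof.
move=> t0 a0 aoo.
have afin : amax t x \is a fin_num by rewrite ge0_fin_numE// ltW.
pose al := fine (amax t x).
have alE : al%:E = amax t x by rewrite fineK.
have al0 : (0 < al)%R by rewrite -lte_fin alE.
pose la := (2 * (3 ^+ n * 3 ^+ n) * al)%R.
have n3 : (0 < 3 ^+ n :> R)%R by rewrite exprn_gt0.
have la0 : (0 < la)%R by rewrite /la mulr_gt0// mulr_gt0// mulr_gt0.
pose S N := [set y | exists2 m, (m <= N)%N & la%:E < avg3 (t * 2 ^- m)%R y] `&` cell t x.
have tN N : (0 < t * 2 ^- N)%R by rewrite divr_gt0// exprn_gt0.
have muS N : mu (S N) <= (2^-1 * t ^+ n)%:E.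
  have := @dyadic_weak_type3 R n (t * 2 ^- N)%R (tN N) h la N x la0 mh h_ge0.
  rewrite /level_cell /level_cell3 divfK ?expf_neq0//.
  set A := (X in mu (X `&` _)).
  have -> : A `&` cell t x = S N.
    rewrite /A /S /vol; apply/seteqP; split => y [/= [i iN Hi] yx]; split => //.
      exists (N - i)%N; first exact: leq_subr.
      rewrite (lt_avg3E _ _ (tN _)).
      have eN : (t * 2 ^- N * 2 ^+ i = t * 2 ^- (N - i))%R.
        by rewrite -(pow2V t (leq_subr i N)) subKn.
      by rewrite -eN; exact: Hi.
    exists (N - i)%N; first exact: leq_subr.
    by move: Hi; rewrite (lt_avg3E _ _ (tN _)) (pow2V t iN).
  move=> H1; rewrite -(@lee_pmul2l _ la%:E)// ?lte_fin//; apply: (le_trans H1).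
  have : avg3 t x <= al%:E by rewrite alE avg3_le_amax0.
  rewrite /avg3 lee_pdivrMl ?t3n// -EFinM => H2.
  apply: (@le_trans _ _ ((3 ^+ n)%:E * ((3 * t) ^+ n * al)%:E)).
    by apply: lee_wpmul2l; [rewrite lee_fin ltW|exact: H2].
  rewrite -!EFinM lee_fin /la exprMn le_eqVlt; apply/orP; left; apply/eqP.
  by field.
have mS N : measurable (S N).
  apply: measurableI; last exact: measurable_cell.
  apply: (adapted_mset (tN N)) => y z yz; apply/propext.
  have e m : (m <= N)%N -> avg3 (t * 2 ^- m)%R y = avg3 (t * 2 ^- m)%R z.
    by move=> mN; rewrite /avg3 -(@pow2V t N m mN) (eq_cell3 (idx_lev0 (tN N) _ yz)).
  split => -[m mN H]; (exists m; first exact: mN); [rewrite -(e m mN)|rewrite (e m mN)]; exact: H.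
have [y yx Ny] : exists2 y, cell t x y & forall m, avg3 (t * 2 ^- m)%R y <= la%:E.
  apply: contrapT => N.
  have cov : cell t x `<=` \bigcup_N S N.
    move=> y yx; apply: contrapT => Ny; apply: N; exists y => // m.
    rewrite leNgt; apply/negP => H; apply: Ny; exists m => //; split => //.
    by exists m.
  have mU : measurable (\bigcup_N S N) by exact: bigcup_measurable.
  have h1 : mu (\bigcup_N S N) <= (2^-1 * t ^+ n)%:E.
    have nd : nondecreasing_seq S.
      move=> i j ij; apply/subsetPset => y [[m mi H] yx]; split => //.
      by exists m => //; exact: leq_trans ij.
    have cvg := @nondecreasing_cvg_mu _ _ _ mu S mS mU nd.
    rewrite -(cvg_lim _ cvg)//; apply: lime_le; first by apply/cvg_ex; eexists; exact: cvg.
    by near=> N'; exact: muS.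
  have h2 : mu (cell t x) <= mu (\bigcup_N S N).
    by apply: le_measure; rewrite ?inE//; exact: measurable_cell.
  have := le_trans h2 h1; have := mu_cell x t0 => ->.
  by rewrite lee_fin leNgt gtr_pMl ?exprn_gt0// invf_lt1// ltr1n.
exists y => //; apply: (le_trans (maximal_le_avg3 y t0)).
rewrite EFinM -muleA; apply: lee_wpmul2l; first by rewrite lee_fin exprn_ge0.
rewrite ge_max; apply/andP; split.
  rewrite (amax_idx t0 yx) -[leLHS]mul1e; apply: lee_wpmul2r; first exact: ltW.
  by rewrite lee_fin !mulr_ege1 ?exprn_ege1 ?ler1n.
apply: ge_ereal_sup => _ /= [m _ <-]; apply: (le_trans (Ny m)).
by rewrite -alE -EFinM.
Unshelve. all: by end_near.
Qed.

(** If [amax] rises above [l] inside the cell it does so because of a triple of a smaller cell. *)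
Lemma amax_weak s j x l : (0 < s)%R -> amax (s * 2 ^+ j)%R x < l%:E ->
  l%:E * mu ([set y | exists2 i, (i <= j)%N & l%:E <= amax (s * 2 ^+ i)%R y] `&` cell (s * 2 ^+ j)%R x) <=
  (2 * (3 ^+ n * 3 ^+ n))%:E * (amax (s * 2 ^+ j)%R x * ((s * 2 ^+ j) ^+ n)%:E).
Proof.
move=> s0 al.
have sj := lev_gt0 j s0.
have l0 : (0 < l)%R by rewrite -lte_fin; apply: le_lt_trans al; exact: amax_ge0.
have l20 : (0 < l / 2)%R by rewrite divr_gt0.
have := @dyadic_weak_type3 R n s s0 h (l / 2)%R j x l20 mh h_ge0.
set A := (X in mu (X `&` _)) => H.
have mA (P : nat -> E -> Prop) : (forall i x y, idx (s * 2 ^+ i)%R x = idx (s * 2 ^+ i)%R y -> P i x = P i y) ->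
    measurable ([set x | exists2 i, (i <= j)%N & P i x] `&` cell (s * 2 ^+ j)%R x).
  move=> eP; apply: measurableI; last exact: measurable_cell.
  apply: (adapted_mset s0) => y z yz; apply/propext.
  have yz' i := idx_lev0 s0 i yz.
  by split => -[i ij Pi]; exists i => //; [rewrite -(eP i y z)|rewrite (eP i y z)].
apply: (@le_trans _ _ (2%:E * ((l / 2)%:E * mu (A `&` level_cell s j x)))).
  rewrite muleA -EFinM (mulrC 2%R) divfK//; apply: lee_wpmul2l; first by rewrite lee_fin ltW.
  apply: le_measure; rewrite ?inE.
  - by apply: mA => i y z yz; rewrite (amax_idx (lev_gt0 i s0) yz).
  - by apply: mA => i y z yz; rewrite /level_cell3 (eq_cell3 yz).
  move=> y [/= [i ij li] yx]; split => //.
  apply: contrapT => N; move: li; rewrite leNgt => /negP; apply.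
  have : amax (s * 2 ^+ i)%R y <= maxe (l / 2)%:E (amax (s * 2 ^+ j)%R x).
    apply: ge_ereal_sup => _ /= [m _ <-]; rewrite -mulrA -exprD.
    have [ijm|ijm] := leqP j (i + m).
      rewrite le_max; apply/orP; right.
      rewrite -(amax_idx sj yx) -(subnKC ijm) exprD mulrA.
      exact: avg3_le_amax.
    rewrite le_max; apply/orP; left; rewrite leNgt; apply/negP => Hm; apply: N.
    exists (i + m)%N; first exact: ltnW.
    by move: Hm; rewrite lt_avg3E ?lev_gt0.
  move=> /le_lt_trans; apply; rewrite gt_max al andbT lte_fin.
  by rewrite ltr_pdivrMr// ltr_pMr// ltr1n.
rewrite [leRHS](_ : _ = 2%:E * ((3 ^+ n)%:E * ((3 ^+ n)%:E * (amax (s * 2 ^+ j)%R x * ((s * 2 ^+ j) ^+ n)%:E)))); last first.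
  by rewrite (EFinM 2%R) (EFinM (3 ^+ n)%R) -!muleA.
apply: lee_wpmul2l; first by rewrite lee_fin.
apply: (le_trans H); apply: lee_wpmul2l; first by rewrite lee_fin exprn_ge0.
have := avg3_le_amax0 (s * 2 ^+ j)%R x; rewrite /avg3 lee_pdivrMl ?t3n// => /le_trans; apply.
by rewrite (exprMn _ 3%R) EFinM -muleA (muleC _ (amax _ _)).
Qed.

End tripled_averages.

(** * Oscillation over cells *)

Section oscillation.
Context {R : realType} {n : nat}.
Hypothesis n_gt0 : (0 < n)%N.
Local Notation E := (euclid R n).
Local Notation mu := (lebesgue R n).
Implicit Types (t : R) (x y : E).
Variables (h : E -> \bar R) (f : E -> R) (delta C2 : R).
Hypothesis mh : measurable_fun [set: E] h.
Hypothesis h_ge0 : forall x, 0 <= h x.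
Hypothesis amax_fin : forall t x, (0 < t)%R -> 0 < amax h t x < +oo.
Hypothesis mf : measurable_fun [set: E] f.
Hypothesis f_ge0 : forall x, (0 <= f x)%R.
Hypothesis delta_gt0 : (0 < delta)%R.
Hypothesis C2_gt0 : (0 < C2)%R.
Hypothesis f_osc : forall Q x, is_cube Q -> Q x ->
  ereal_inf [set mean Q (fun y => `|(f y)%:E - c%:E|) | c in [set: R]] <=
  C2%:E * maximal h x `^ delta.

Definition aR t x : R := fine (amax h t x).

Lemma aRE t x : (0 < t)%R -> (aR t x)%:E = amax h t x.
Proof. by move=> /(amax_fin x)/andP[a0 aoo]; rewrite fineK// ge0_fin_numE// ltW. Qed.

Lemma aR_gt0 t x : (0 < t)%R -> (0 < aR t x)%R.
Proof. by move=> t0; rewrite -lte_fin aRE//; case/andP: (amax_fin x t0). Qed.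

Definition av t x : R := (fine (\int[mu]_(y in cell t x) (f y)%:E) / t ^+ n)%R.

(* the constant of [exists_maximal_le] *)
Let C4 : R := (6 ^+ n * (2 * (3 ^+ n * 3 ^+ n)))%R.

Let C4_gt0 : (0 < C4)%R.
Proof. by rewrite /C4 mulr_gt0 ?exprn_gt0// mulr_gt0// mulr_gt0// exprn_gt0. Qed.

Definition osc_const : R := (4 * (C2 * C4 `^ delta))%R.

Lemma osc_const_gt0 : (0 < osc_const)%R.
Proof. by rewrite /osc_const mulr_gt0// mulr_gt0// powR_gt0. Qed.

Let md c D : measurable_fun D (fun y => `|f y - c|%:E).
Proof.
apply: measurable_funTS; apply/measurable_EFinP; apply: measurableT_comp => //.
exact: measurable_funB.
Qed.

Let mfE D : measurable_fun D (fun y => (f y)%:E).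
Proof. by apply: measurable_funTS; exact/measurable_EFinP. Qed.

(* the oscillation is compared with the maximal function at the point of [exists_maximal_le] *)
Let osc_cst t x : (0 < t)%R -> exists c : R,
  \int[mu]_(y in cell t x) `|f y - c|%:E <= (2^-1 * osc_const * aR t x `^ delta * t ^+ n)%:E.
Proof.
move=> t0; have [Q [cQ sQ muQ _]] := cell_sub_cube x t0.
have /andP[a0 aoo] := amax_fin x t0.
have [y yx My] := exists_maximal_le n_gt0 mh h_ge0 t0 a0 aoo.
have tn : (0 < t ^+ n)%R by rewrite exprn_gt0.
pose V := (C2 * (C4 * aR t x) `^ delta)%R.
have Ca0 : (0 < C4 * aR t x)%R by rewrite mulr_gt0// aR_gt0.
have V0 : (0 < V)%R by rewrite mulr_gt0// powR_gt0.
have M0 : 0 <= maximal h y.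
  by apply: le_trans (amax_le_maximal mh h_ge0 t0 (cell_cell3 yx)); exact: ltW.
have : ereal_inf [set mean Q (fun y => `|(f y)%:E - c%:E|) | c in [set: R]] < (2 * V)%:E.
  apply: (@le_lt_trans _ _ V%:E); last by rewrite lte_fin ltr_pMl// ltr1n.
  apply: (le_trans (f_osc cQ (sQ _ yx))); rewrite /V EFinM -poweR_EFin.
  apply: lee_wpmul2l; first by rewrite lee_fin ltW.
  apply: le_poweR => //; first exact: ltW.
  by rewrite EFinM aRE.
move=> /ereal_inf_lt[_ [c _ <-] mc]; exists c.
have VE : (2 * V = 2^-1 * osc_const * aR t x `^ delta)%R.
  by rewrite /V powRM ?(ltW C4_gt0) ?(ltW (aR_gt0 _ _))// /osc_const; field.
rewrite -VE; have := ltW mc; rewrite /mean muQ inver gt_eqF// lee_pdivrMr// => H.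
apply: le_trans H.
apply: (@le_trans _ _ (\int[mu]_(y0 in Q) `|f y0 - c|%:E)); last by [].
apply: ge0_subset_integral => //; [exact: measurable_cell|exact: measurable_cube].
Qed.

Lemma integrable_cell t x : (0 < t)%R -> \int[mu]_(y in cell t x) (f y)%:E < +oo.
Proof.
move=> t0; have [c Hc] := osc_cst x t0; have mc := measurable_cell x t0.
apply: (@le_lt_trans _ _ (\int[mu]_(y in cell t x) (`|f y - c|%:E + `|c|%:E))).
  apply: le_integral_nonneg => y _; first by rewrite lee_fin.
  rewrite -EFinD lee_fin -[leLHS](ger0_norm (f_ge0 y)).
  by rewrite (le_trans _ (ler_normD _ _))// subrK.
rewrite ge0_integralD//; apply: lte_add_pinfty; first exact: le_lt_trans Hc (ltry _).
by rewrite integral_cst// -[X in _ * X]/(mu _) mu_cell// -EFinM ltry.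
Qed.

Lemma av_dist t x c : (0 < t)%R ->
  (`|av t x - c| * t ^+ n)%:E <= \int[mu]_(y in cell t x) `|f y - c|%:E.
Proof.
move=> t0; have mc := measurable_cell x t0.
have tn : (0 < t ^+ n)%R by rewrite exprn_gt0.
have intf : mu.-integrable (cell t x) (EFin \o f).
  apply/integrableP; split; first exact: mfE.
  under eq_integral do rewrite /= ger0_norm//.
  exact: integrable_cell.
have intc : mu.-integrable (cell t x) (EFin \o cst c).
  apply/integrableP; split; first by apply: (measurable_cst (c%:E)).
  rewrite /= integral_cst// -[X in _ * X]/(mu _) mu_cell// -EFinM ltry//.
have -> : (`|av t x - c| * t ^+ n)%:E = `|\int[mu]_(y in cell t x) (f y - c)%:E|.
  rewrite integralB_EFin// integral_cst// -[X in _ - _ * X]/(mu _) mu_cell//.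
  have finf : \int[mu]_(y in cell t x) (f y)%:E \is a fin_num.
    by rewrite ge0_fin_numE ?integrable_cell// integral_ge0// => y _; rewrite lee_fin.
  rewrite -(fineK finf) -EFinM -EFinB /= /av; congr EFin.
  rewrite -{2}(gtr0_norm tn) -normrM mulrBl divfK// gt_eqF//.
apply: le_trans (le_abse_integral _ _ _) _ => //.
by apply/measurable_EFinP; apply: measurable_funTS; exact: measurable_funB.
Qed.

(** The average is as good as the best constant, up to a factor two. *)
Lemma osc_av t x : (0 < t)%R ->
  \int[mu]_(y in cell t x) `|f y - av t x|%:E <= (osc_const * aR t x `^ delta * t ^+ n)%:E.
Proof.
move=> t0; have [c Hc] := osc_cst x t0; have mc := measurable_cell x t0.
apply: (@le_trans _ _ (\int[mu]_(y in cell t x) (`|f y - c|%:E + `|av t x - c|%:E))).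
  apply: le_integral_nonneg => y _; first by rewrite lee_fin.
  rewrite -EFinD lee_fin (distrC (av t x)).
  by rewrite (le_trans _ (ler_normD _ _))// addrA subrK.
rewrite ge0_integralD//.
have -> : (osc_const * aR t x `^ delta * t ^+ n)%:E =
   (2^-1 * osc_const * aR t x `^ delta * t ^+ n)%:E + (2^-1 * osc_const * aR t x `^ delta * t ^+ n)%:E :> \bar R.
  by rewrite -EFinD; congr EFin; field.
apply: leeD => //; rewrite integral_cst// -[X in _ * X]/(mu _) mu_cell// -EFinM.
exact: le_trans (av_dist x c t0) Hc.
Qed.

Lemma av_idx t x y : idx t x = idx t y -> av t x = av t y.
Proof. by move=> xy; rewrite /av (eq_cell xy). Qed.

Variable s : R.
Hypothesis s0 : (0 < s)%R.
Definition al (j : nat) x := aR (s * 2 ^+ j)%R x.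
Definition ml (j : nat) x := av (s * 2 ^+ j)%R x.
Definition step_const : R := (2 ^+ n * osc_const)%R.

Lemma al_levelwise : levelwise s al.
Proof. by move=> j x y xy; rewrite /al /aR (amax_idx _ (lev_gt0 j s0) xy). Qed.

Lemma al_gt0 j x : (0 < al j x)%R.
Proof. exact: aR_gt0 (lev_gt0 j s0). Qed.

Lemma al_dec j x : (al j.+1 x <= al j x)%R.
Proof. by rewrite -lee_fin !aRE ?lev_gt0// levS; exact: amax_double. Qed.

Lemma al_step j x : (al j x <= 2 ^+ n * al j.+1 x)%R.
Proof. by rewrite -lee_fin EFinM !aRE ?lev_gt0// levS; apply: amax_step => //; exact: lev_gt0. Qed.

Definition weak_const : R := (2 * (3 ^+ n * 3 ^+ n))%R.

Lemma al_weak j x l : (al j x < l)%R ->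
  mu ([set y | exists2 i, (i <= j)%N & (l <= al i y)%R] `&` level_cell s j x) <=
  (weak_const * al j x / l * vol (n := n) s j)%:E.
Proof.
move=> xl; have l0 : (0 < l)%R by apply: lt_trans xl; exact: al_gt0.
have xl' : amax h (s * 2 ^+ j)%R x < l%:E by rewrite -aRE ?lev_gt0// lte_fin.
have H := amax_weak mh h_ge0 s0 xl'.
have -> : [set y | exists2 i, (i <= j)%N & (l <= al i y)%R] =
          [set y | exists2 i, (i <= j)%N & l%:E <= amax h (s * 2 ^+ i)%R y].
  by apply/seteqP; split => y [i ij Hi]; exists i => //; move: Hi;
    rewrite -aRE ?lev_gt0// lee_fin.
rewrite -(@lee_pmul2l _ l%:E)// ?lte_fin//; apply: (le_trans H).
rewrite -aRE ?lev_gt0// -!EFinM lee_fin le_eqVlt; apply/orP; left; apply/eqP.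
by rewrite /weak_const /al /vol; field; exact: lt0r_neq0.
Qed.

Lemma ml_levelwise : levelwise s ml.
Proof. by move=> j x y xy; rewrite /ml (av_idx xy). Qed.

Lemma step_const_ge0 : (0 <= step_const)%R.
Proof. by rewrite /step_const mulr_ge0 ?exprn_ge0// ltW// osc_const_gt0. Qed.

Let reorder (u c v a b : R) : (0 <= u * c * v)%R -> (b <= a)%R ->
  (c * b * (u * v) <= u * c * a * v)%R.
Proof.
move=> ucv ba; have -> : (c * b * (u * v) = u * c * v * b)%R by ring.
by have -> : (u * c * a * v = u * c * v * a)%R; [ring|rewrite ler_wpM2l].
Qed.

(** The average over a cell differs from the average over its parent by at most [2 ^ n] times the
    oscillation over the parent. *)
Lemma ml_step j x : (`|ml j x - ml j.+1 x| <= step_const * al j x `^ delta)%R.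
Proof.
have sj := lev_gt0 j s0; have sj1 := lev_gt0 j.+1 s0.
have tn : (0 < (s * 2 ^+ j) ^+ n)%R by rewrite exprn_gt0.
have := av_dist x (ml j.+1 x) sj => H1.
have H2 : \int[mu]_(y in cell (s * 2 ^+ j)%R x) `|f y - ml j.+1 x|%:E <=
    \int[mu]_(y in cell (s * 2 ^+ j.+1)%R x) `|f y - ml j.+1 x|%:E.
  apply: ge0_subset_integral => //; [exact: measurable_cell|exact: measurable_cell|].
  by move=> y; exact: (@lcell_le R n s s0 j j.+1 x y (leqnSn j)).
have := le_trans H1 (le_trans H2 (osc_av x sj1)); rewrite lee_fin => H3.
rewrite -(ler_pM2r tn); apply: (le_trans H3).
have -> : ((s * 2 ^+ j.+1) ^+ n = 2 ^+ n * (s * 2 ^+ j) ^+ n)%R by rewrite levS exprMn.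
apply: reorder.
  by rewrite mulr_ge0 ?(ltW tn)// mulr_ge0 ?exprn_ge0// ltW// osc_const_gt0.
apply: le_powR; [exact: ltW|exact/ltW/aR_gt0|exact: al_dec].
Qed.

(** The averages of [f - ml j x] over smaller cells are controlled by the weak type estimate for its absolute value. *)
Lemma ml_weak j x t : (0 < t)%R ->
  mu ([set y | exists2 i, (i <= j)%N & (t < `|ml i y - ml j x|)%R] `&` level_cell s j x) <=
  (step_const * al j x `^ delta / t * vol (n := n) s j)%:E.
Proof.
move=> t0; have sj := lev_gt0 j s0.
have adW (P : nat -> E -> Prop) : (forall i x y, idx (s * 2 ^+ i)%R x = idx (s * 2 ^+ i)%R y -> P i x = P i y) ->
    measurable ([set x | exists2 i, (i <= j)%N & P i x] `&` level_cell s j x).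
  move=> eP; apply: measurableI; last exact: measurable_cell.
  apply: (adapted_mset s0) => y z yz; apply/propext.
  have yz' i := idx_lev0 s0 i yz.
  by split => -[i ij Pi]; (exists i; first exact: ij); [rewrite -(eP i y z (yz' i))|rewrite (eP i y z (yz' i))].
rewrite -(@lee_pmul2l _ t%:E)// ?lte_fin//.
have g0 y : 0 <= `|f y - ml j x|%:E by rewrite lee_fin.
have := @dyadic_weak_type R n s s0 (fun y => `|f y - ml j x|%:E) t j x t0 (@md (ml j x) setT) g0.
set A := (X in mu (X `&` _)) => H.
apply: (@le_trans _ _ (t%:E * mu (A `&` level_cell s j x))).
  apply: lee_wpmul2l; first by rewrite lee_fin ltW.
  apply: le_measure; rewrite ?inE.
  - by apply: adW => i y z yz; rewrite (ml_levelwise yz).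
  - by apply: adW => i y z yz; rewrite /level_cell (eq_cell yz).
  move=> y [/= [i ij Hi] yx]; split => //; exists i => //.
  have si := lev_gt0 i s0.
  apply: lt_le_trans (av_dist y (ml j x) si).
  by rewrite lte_fin ltr_pM2r// exprn_gt0.
apply: (le_trans H); apply: (le_trans (osc_av x sj)).
rewrite -EFinM lee_fin.
have -> : (t * (step_const * al j x `^ delta / t * vol (n := n) s j) = step_const * (al j x `^ delta * vol (n := n) s j))%R.
  by field; exact: lt0r_neq0.
rewrite -mulrA; apply: ler_wpM2r; first by rewrite mulr_ge0 ?powR_ge0// ltW// vol_gt0.
by rewrite /step_const ler_peMl ?(ltW osc_const_gt0)// exprn_ege1// ler1n.
Qed.

End oscillation.

(** * The estimate on one cell *)

Section geometric_tail.
Context {R : realType}.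

Lemma geometric_tail (th : R) (c : nat -> R) m0 N : (0 < th < 1)%R ->
  (forall m, 0 <= c m <= 1)%R -> (forall m, (m < m0)%N -> c m = 0%R) ->
  (\sum_(m < N) th ^+ m * c m <= th ^+ m0 / (1 - th))%R.
Proof.
move=> /andP[th0 th1] c01 c0; have th1' : (0 < 1 - th)%R by rewrite subr_gt0.
suff main : (\sum_(m < N) th ^+ m * c m <=
    (th ^+ m0 - th ^+ (maxn m0 N)) / (1 - th))%R.
  by apply: (le_trans main); rewrite ler_pM2r ?invr_gt0// gerBl exprn_ge0// ltW.
elim: N => [|N IH]; first by rewrite big_ord0 maxn0 subrr mul0r.
rewrite big_ord_recr /=; have [mN|Nm] := leqP m0 N; last first.
  rewrite c0// mulr0 addr0; apply: (le_trans IH).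
  by rewrite (maxn_idPl (ltnW Nm)) (maxn_idPl Nm).
move: IH; rewrite (maxn_idPr mN) (maxn_idPr (leqW mN)) => IH.
have /andP[_ cN1] := c01 N.
apply: (le_trans (lerD IH (ler_piMr (exprn_ge0 N (ltW th0)) cN1))).
rewrite le_eqVlt; apply/orP; left; apply/eqP.
by rewrite (exprS th); field; exact: lt0r_neq0.
Qed.

Lemma le_quarter (u v : R) : (0 < v)%R -> (4 * u <= v)%R -> (u * v^-1 <= 4^-1)%R.
Proof. by move=> v0 uv; rewrite ler_pdivrMr//; lra. Qed.

End geometric_tail.

Section local_estimate.
Context {R : realType} {n : nat}.
Hypothesis n_gt0 : (0 < n)%N.
Local Notation E := (euclid R n).
Local Notation mu := (lebesgue R n).
Implicit Types (t : R) (x y : E).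
Variables (w : E -> R) (q c0 de : R).
Hypothesis w_weight : weight w.
Hypothesis q_gt1 : (1 < q)%R.
Hypothesis c0_gt0 : (0 < c0)%R.
Hypothesis de_gt0 : (0 < de)%R.
Hypothesis w_Cq : forall Q (A : set E), is_cube Q -> measurable A -> A `<=` Q ->
  \int[mu]_(x in A) (w x)%:E <= c0%:E * (mu A / mu Q) `^ de *
     \int[mu]_x (maximal (fun y => (\1_Q y)%:E) x `^ q * (w x)%:E).
Variable (p : R).
Hypothesis p_gt0 : (0 < p)%R.
Hypothesis pq : (p < q)%R.

Local Notation W := (wE w).
Local Notation th := (@th0 R n q).

Let th_itv : (0 < th < 1)%R.
Proof. by rewrite th0_gt0 th0_lt1. Qed.

(** At distance [2 ^ m] from the cell the maximal function is still at least [2 ^- (m * n)] times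
    [a]; the coefficients of the tail integral decay faster, since [p < q]. *)
Lemma le_wtail t x (a : R) (G : E -> \bar R) : (0 < t)%R -> (0 <= a)%R ->
  (forall m y, cell3 (t * 2 ^+ m)%R x y -> a%:E <= ((2 ^+ n) ^+ m)%:E * G y) ->
  (a `^ p)%:E * wtail w q t x <= ((1 - th)^-1)%:E * \int[mu]_y (G y `^ p * W y).
Proof.
move=> t0 a0 aG; have /andP[h0 h1] := th_itv.
have h1' : (0 < 1 - th)%R by rewrite subr_gt0.
have n20 : (0 < 2 ^+ n :> R)%R by rewrite exprn_gt0.
pose u m y : R := (th ^+ m * ind (cell3 (t * 2 ^+ m)%R x y))%R.
have u0 m y : (0 <= u m y)%R by rewrite mulr_ge0 ?ind_ge0// exprn_ge0// ltW.
have G0 y : 0 <= G y.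
  have [m [hm _]] := first_cell3 x y t0.
  have := aG m y hm; rewrite -lee_pdivrMl ?exprn_gt0//; apply: le_trans.
  by rewrite mule_ge0 ?lee_fin// invr_ge0 !exprn_ge0.
have uW0 m y : 0 <= (u m y)%:E * W y by apply: mule_ge0; [rewrite lee_fin|exact: wE_ge0].
have mu_ m : measurable_fun [set: E] (fun y => (u m y)%:E * W y).
  apply: emeasurable_funM; last exact: measurable_wE.
  under eq_fun do rewrite EFinM -indE.
  apply: emeasurable_funM => //; apply/measurable_EFinP/measurable_indic.
  exact: measurable_cell3 (lev_gt0 m t0).
have term m : (th ^+ m)%:E * w3 w (t * 2 ^+ m)%R x = \int[mu]_y ((u m y)%:E * W y).
  rewrite /w3 -ge0_integralZl//; last 4 first.
  - exact: measurable_cell3 (lev_gt0 m t0).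
  - exact: measurable_funTS (measurable_wE w_weight).
  - by move=> y _; exact: wE_ge0.
  - by rewrite lee_fin exprn_ge0// ltW.
  rewrite integral_mkcond; apply: eq_integral => y _.
  rewrite /u /patch; case: ifPn; rewrite ?inE ?notin_setE => yx; first by rewrite indT// mulr1.
  by rewrite indF// mulr0 mul0e.
have i0 m : 0 <= (th ^+ m)%:E * w3 w (t * 2 ^+ m)%R x.
  by rewrite mule_ge0 ?w3_ge0// lee_fin exprn_ge0// ltW.
have pw N y : (a `^ p)%:E * (\sum_(m < N) u m y)%:E <= ((1 - th)^-1)%:E * G y `^ p.
  have [m [hm Nm]] := first_cell3 x y t0.
  have := @geometric_tail R th (fun m => ind (cell3 (t * 2 ^+ m)%R x y)) m N th_itv.
  move=> H; have {}H : (\sum_(m < N) u m y <= th ^+ m / (1 - th))%R.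
    by apply: H => [k|k km]; [rewrite ind_ge0 ind_le1|rewrite indF//; exact: Nm].
  apply: (@le_trans _ _ ((a `^ p)%:E * (th ^+ m / (1 - th))%:E)).
    by apply: lee_wpmul2l; [rewrite lee_fin powR_ge0|rewrite lee_fin; exact: H].
  have -> : ((a `^ p)%:E * (th ^+ m / (1 - th))%:E = ((1 - th)^-1)%:E * ((th ^+ m)%:E * (a `^ p)%:E)).
    by rewrite -!EFinM; congr EFin; ring.
  apply: lee_wpmul2l; first by rewrite lee_fin invr_ge0 ltW.
  have ap : (a `^ p)%:E <= (((2 ^+ n) ^+ m) `^ p)%:E * G y `^ p.
    rewrite -!poweR_EFin -poweRM; [|by rewrite lee_fin !exprn_ge0|exact: G0].
    by apply: le_poweR; [exact: ltW|rewrite lee_fin|exact: aG].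
  apply: (@le_trans _ _ ((th ^+ m)%:E * ((((2 ^+ n) ^+ m) `^ p)%:E * G y `^ p))).
    by apply: lee_wpmul2l => //; rewrite lee_fin exprn_ge0// ltW.
  rewrite muleA -EFinM -[leRHS]mul1e; apply: lee_wpmul2r; first exact: poweR_ge0.
  have -> : (((2 ^+ n) ^+ m) `^ p = ((2 ^+ n) `^ p) ^+ m :> R)%R.
    have -> : ((2 ^+ n) ^+ m = (2 ^+ n) `^ m%:R :> R)%R by rewrite powR_mulrn// ltW.
    by rewrite powRAC powR_mulrn// powR_ge0.
  rewrite lee_fin -exprMn exprn_ile1// ?mulr_ge0 ?powR_ge0 ?(ltW h0)//.
  rewrite -(@invrK _ th) th0_inv ler_pdivrMl ?powR_gt0// mulr1.
  by rewrite ler_powR ?(ltW pq)// exprn_ege1// ler1n.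
rewrite /wtail -nneseriesZl; last by move=> m _; exact: i0.
apply: lime_le.
  by apply: is_cvg_nneseries => m _ _; rewrite mule_ge0 ?i0// lee_fin powR_ge0.
near=> N.
rewrite big_mkord -ge0_sume_distrr; last by move=> m _; exact: i0.
under eq_bigr do rewrite term.
rewrite -ge0_integral_sum//.
rewrite -ge0_integralZl//; last 3 first.
- by apply: emeasurable_sum => m; exact: mu_.
- by move=> y _; apply: sume_ge0 => m _; exact: uW0.
- by rewrite lee_fin powR_ge0.
have c1 : (0 < (1 - th)^-1)%R by rewrite invr_gt0.
rewrite -lee_pdivrMl// -ge0_integralZl//; last 3 first.
- apply: emeasurable_funM => //; apply: emeasurable_sum => m; exact: mu_.
- move=> y _; apply: mule_ge0; first by rewrite lee_fin powR_ge0.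
  by apply: sume_ge0 => m _; exact: uW0.
- by rewrite lee_fin invr_ge0 ltW.
have sE y : \sum_(m < N) (u m y)%:E * W y = (\sum_(m < N) u m y)%:E * W y.
  by rewrite -sumEFin ge0_sume_distrl// => m _; rewrite lee_fin.
apply: le_integral_nonneg => y _.
  apply: mule_ge0; first by rewrite lee_fin !invr_ge0 ltW.
  apply: mule_ge0; first by rewrite lee_fin powR_ge0.
  by apply: sume_ge0 => m _; exact: uW0.
rewrite sE muleA muleA; apply: lee_wpmul2r; first exact: wE_ge0.
by rewrite -muleA lee_pdivrMl//; exact: pw.
Unshelve. all: by end_near.
Qed.

Local Notation beta := (th * 2 ^+ n)%R.
Local Notation rho := (rhow de).
Local Notation kap := (@kapw R n q c0).
Local Notation C1 := (@weak_const R n).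
Local Notation L := (@overlap_const R n beta).

Let C1_gt0 : (0 < C1)%R.
Proof. by rewrite /weak_const !mulr_gt0 ?exprn_gt0. Qed.

(* beta is [2 ^ n] to the power [- (q - 1)], so small volumes have small coefficients *)
Let vol_ratio s eta i T : (0 < s)%R -> (0 <= eta)%R -> (i <= T)%N ->
  (vol (n := n) s i <= eta * vol (n := n) s T)%R -> (beta ^+ (T - i) <= eta `^ (q - 1))%R.
Proof.
move=> s0 e0 iT; have n2 : (0 < 2 ^+ n :> R)%R by rewrite exprn_gt0.
have -> : (vol (n := n) s T = (2 ^+ n) ^+ (T - i) * vol (n := n) s i)%R.
  rewrite /vol exprAC -exprMn; congr (_ ^+ _)%R.
  by rewrite -{1}(subnK iT) exprD; ring.
move=> H; have {}H : (((2 ^+ n) ^+ (T - i))^-1 <= eta)%R.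
  rewrite -[leLHS]mul1r ler_pdivrMr ?exprn_gt0//.
  by rewrite -(ler_pM2r (vol_gt0 (n := n) s0 i)) mul1r -mulrA.
have -> : (beta = (2 ^+ n) `^ (- (q - 1)))%R.
  rewrite -[X in (X * _)%R]invrK th0_inv -powRN -{2}(powRr1 (ltW n2)) -powRD.
    by congr (_ `^ _)%R; ring.
  by apply/implyP => _; rewrite gt_eqF.
rewrite -powR_mulrn ?powR_ge0// -powRrM.
have -> : (- (q - 1) * (T - i)%:R = (- (T - i)%:R) * (q - 1))%R by ring.
rewrite powRrM powRN powR_mulrn ?(ltW n2)//.
by apply: le_powR; [rewrite subr_ge0 ltW|rewrite invr_ge0 !exprn_ge0|exact: H].
Qed.

(** The constants of the stopping argument: the ratio [B] of the heights is taken
    so large that [B `^ (p - q)] absorbs the self-similar term, and then [M] such that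
    [rho ^+ M] absorbs the rest. *)
Lemma stopping_constants : exists (B : R) (M : nat) (eta eta1 : R),
  [/\ (2 ^+ n < B)%R, (0 <= eta1)%R, (C1 * 2 ^+ n / B <= eta)%R,
   (forall s i T, (0 < s)%R -> (i <= T)%N ->
      (vol (n := n) s i <= eta * vol (n := n) s T)%R -> (beta ^+ (T - i) <= eta1)%R) &
   (B `^ p * (2 * L * kap * rho ^+ M / (1 - rho) * (th^-1 * 3 ^+ n) + eta1 * eta) <= 2^-1)%R].
Proof.
have /andP[r0 r1] := rhow_itv de_gt0.
have qp : (0 < q - p)%R by rewrite subr_gt0.
pose D := (C1 * 2 ^+ n)%R.
have D0 : (0 < D)%R by rewrite mulr_gt0// exprn_gt0.
(* the solution of [D ^ q * B ^ (p - q) = 1 / 4] *)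
pose B0 := ((4 * D `^ q) `^ (q - p)^-1)%R.
have B00 : (0 <= B0)%R by exact: powR_ge0.
pose B := (2 ^+ n + 1 + B0)%R.
have B0' : (0 < B)%R by rewrite /B -addrA ltr_wpDr ?addr_ge0// exprn_gt0.
have BB : (B0 <= B)%R by rewrite /B lerDr addr_ge0// exprn_ge0.
have e0 : (0 <= D / B)%R by apply: divr_ge0; exact: ltW.
have eE : ((D / B) `^ (q - 1) * (D / B) = D `^ q * B `^ (- q))%R.
  have e00 : (0 < D / B)%R by rewrite divr_gt0.
  have -> : ((D / B) `^ (q - 1) * (D / B) = (D / B) `^ q)%R.
    rewrite -{2}(powRr1 e0) -powRD; first by rewrite subrK.
    by apply/implyP => _; rewrite gt_eqF.
  rewrite powRM ?(ltW D0)//; last by rewrite invr_ge0 ltW.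
  by rewrite -(powR_inv1 (ltW B0')) -powRrM mulN1r.
have small1 : (B `^ p * ((D / B) `^ (q - 1) * (D / B)) <= 4^-1)%R.
  rewrite eE.
  have -> : (B `^ p * (D `^ q * B `^ (- q)) = D `^ q * B `^ (- (q - p)))%R.
    rewrite mulrCA -powRD; last by apply/implyP => _; rewrite gt_eqF.
    by congr (_ * _ `^ _)%R; ring.
  rewrite powRN; apply: le_quarter; first exact: powR_gt0.
  apply: (@le_trans _ _ (B0 `^ (q - p))%R); last by apply: le_powR => //; exact: ltW.
  by rewrite /B0 -powRrM mulVf ?gt_eqF// powRr1// mulr_ge0 ?powR_ge0.
pose K := (B `^ p * (2 * L * kap / (1 - rho) * (th^-1 * 3 ^+ n)))%R.
have [M HM] : exists M, (`|K * rho ^+ M| < 4^-1)%R.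
  have rr : (`|rho| < 1)%R by rewrite gtr0_norm.
  have cv : (fun M => K * rho ^+ M)%R @ \oo --> (K * 0)%R.
    by apply: cvgMr; exact: cvg_expr.
  rewrite mulr0 in cv.
  move/cvgr0Pnorm_lt : cv => /(_ 4^-1%R) H.
  have [|M _ /(_ M (leqnn _)) HM] := H; first by rewrite invr_gt0.
  by exists M.
exists B, M, (D / B)%R, ((D / B) `^ (q - 1))%R; split => //.
- by rewrite /B -addrA ltrDl ltr_wpDr.
- exact: powR_ge0.
- by move=> s i T s0; exact: vol_ratio.
have -> : (B `^ p * (2 * L * kap * rho ^+ M / (1 - rho) * (th^-1 * 3 ^+ n) + (D / B) `^ (q - 1) * (D / B)) =
   K * rho ^+ M + B `^ p * ((D / B) `^ (q - 1) * (D / B)))%R by rewrite /K; ring.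
have := lerD (ltW (le_lt_trans (ler_norm _) HM)) small1; move=> /le_trans; apply.
by rewrite le_eqVlt; apply/orP; left; apply/eqP; field.
Qed.

Lemma Dw_idx t x y : (0 < t)%R -> idx t x = idx t y -> Dw w q t x = Dw w q t y.
Proof.
move=> t0 xy; suff e : wtail w q t x = wtail w q t y by rewrite /Dw e.
apply: eq_eseriesr => m _.
by rewrite /w3 (eq_cell3 (idx_lev0 t0 m xy)).
Qed.

(** The nondegenerate situation, in which [amax] takes positive finite values. *)
Definition controlled (delta C2 : R) (h : E -> \bar R) (f : E -> R) : Prop :=
  [/\ measurable_fun [set: E] h, forall x, 0 <= h x,
      forall t x, (0 < t)%R -> 0 < amax h t x < +oo,
      measurable_fun [set: E] f & forall x, (0 <= f x)%R] /\
  forall Q x, is_cube Q -> Q x ->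
    ereal_inf [set mean Q (fun y => `|(f y)%:E - c%:E|) | c in [set: R]] <=
    C2%:E * maximal h x `^ delta.

(** The constant must not depend on the number [N] of levels, as the small scale goes to zero. *)
Lemma local_estimate (delta C2 : R) : (0 < delta)%R -> (0 < C2)%R ->
  exists C : R, (0 <= C)%R /\ forall h f, controlled delta C2 h f ->
  forall t0 N x0, (0 < t0)%R ->
  \int[mu]_(x in cell t0 x0) ((`|av f (t0 / 2 ^+ N)%R x - av f t0 x0| `^ (p / delta))%:E * W x) <=
  C%:E * \int[mu]_x (maximal h x `^ p * W x).
Proof.
move=> d0 C20; have ritv := rhow_itv de_gt0; have /andP[r0 r1] := ritv.
pose r := (p / delta)%R.
have rgt0 : (0 < r)%R by rewrite divr_gt0.
have drp : (delta * r = p)%R by rewrite mulrC divfK// gt_eqF.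
have [B [M [eta [eta1 [B_gt e10 Ceta Hvol Hsmall]]]]] := stopping_constants.
have u1 : (1 < rho^-1)%R by rewrite invf_gt1.
(* then [g ^ 4] times rho is the square root of rho *)
pose g := (rho^-1 `^ 8^-1)%R.
have g_gt1 : (1 < g)%R by apply: powR_gt1; rewrite // invr_gt0.
have g4 : (g `^ 4 * rho < 1)%R.
  have v1 : (1 < rho^-1 `^ 2^-1)%R by apply: powR_gt1; rewrite // invr_gt0.
  have -> : (g `^ 4 = rho^-1 `^ 2^-1)%R by rewrite /g -powRrM; congr (_ `^ _)%R; field.
  have uE : (rho^-1 `^ 2^-1 * rho^-1 `^ 2^-1 = rho^-1)%R.
    rewrite -powRD; last by apply/implyP => _; rewrite invr_eq0 gt_eqF.
    have -> : (2^-1 + 2^-1 = 1 :> R)%R by field.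
    by rewrite powRr1// invr_ge0 ltW.
  rewrite -ltr_pdivlMr// mul1r -[ltRHS]uE ltr_pMr//; exact: lt_trans v1.
have [Cg [Cg0 HCg]] := powR_split rgt0 g_gt1.
pose K1 := (Cg * (g / (g - 1)) * ((1 + tail_const rho g) * kap) * B `^ p)%R.
pose K2 := (B `^ p * (2 * L * M%:R) * geom_const B p)%R.
pose K3 := ((1 - th)^-1)%R.
pose cK := (stop_const (@step_const R n delta C2) `^ r)%R.
have kap0 : (0 <= kap)%R by rewrite mulr_ge0 ?invr_ge0 ?(ltW c0_gt0)// ltW// th0_gt0.
have K10 : (0 <= K1)%R.
  have g0 : (0 <= g - 1)%R by rewrite subr_ge0 ltW.
  have g00 : (0 <= g)%R by exact: powR_ge0.
  have Bg0 : (0 <= tail_const rho g)%R by rewrite divr_ge0 ?powR_ge0// subr_ge0 ltW.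
  apply: mulr_ge0; last exact: powR_ge0.
  apply: mulr_ge0; first by apply: mulr_ge0 => //; exact: divr_ge0.
  by apply: mulr_ge0 => //; exact: addr_ge0.
have K30 : (0 <= K3)%R by rewrite invr_ge0 subr_ge0 ltW//; case/andP: th_itv.
have Cm0 : (0 <= @step_const R n delta C2)%R by exact: step_const_ge0.
have CK0 : (0 <= stop_const (@step_const R n delta C2))%R.
  by rewrite /stop_const addr_ge0// mulr_ge0// /leap_const addr_ge0// mulr_ge0.
have cK0 : (0 <= cK)%R by exact: powR_ge0.
exists (cK * (K1 * (2 * (K3 + `|K2|))))%R; split.
  by rewrite mulr_ge0// mulr_ge0// mulr_ge0// addr_ge0.
move=> h f [[mh h0 af mf f0] fo] t0 N x0 t00.
pose s := (t0 / 2 ^+ N)%R.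
have s0 : (0 < s)%R by rewrite divr_gt0// exprn_gt0.
have sN : (s * 2 ^+ N = t0)%R by rewrite divfK// expf_neq0.
pose D j x := Dw w q (s * 2 ^+ j)%R x.
have D0 j x : 0 <= D j x by apply: Dw_ge0 => //; exact: lev_gt0.
have lD : levelwise s D by move=> j x y; apply: Dw_idx; exact: lev_gt0.
have HW j y i (A : set E) : (j <= N)%N -> measurable A -> A `<=` level_cell s j y ->
    mu A <= (2 ^- i * vol (n := n) s j)%:E ->
    \int[mu]_(x in A) W x <= (kap * rho ^+ i)%:E * (D j y * (vol (n := n) s j)%:E).
  by move=> _ mA Ay; apply: wE_small => //; exact: lev_gt0.
have Drec j x : D j x = ((vol (n := n) s j)^-1)%:E * \int[mu]_(y in level_cell3 s j x) W y + beta%:E * D j.+1 x.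
  by rewrite /D levS; apply: Dw_rec => //; exact: lev_gt0.
have Dnear j x y : level_cell3 s j x y -> D j y <= (th^-1)%:E * D j x.
  by apply: Dw_near => //; exact: lev_gt0.
have th0V : (0 <= th^-1)%R by rewrite invr_ge0 ltW// th0_gt0.
have la := al_levelwise h s0.
have a0 := al_gt0 af s0.
have ad := al_dec af s0.
have ast := al_step mh h0 af s0.
have aw j x l (jN : (j <= N)%N) := @al_weak R n h mh h0 af s s0 j x l.
have lm := ml_levelwise f (s := s).
have ms j x (jN : (j < N)%N) := ml_step n_gt0 mh h0 af mf f0 d0 C20 fo s0 j x.
have mw j x t (jN : (j <= N)%N) := @ml_weak R n n_gt0 h f delta C2 mh h0 af mf f0 d0 C20 fo s s0 j x t.
have Ga j x y : level_cell3 s j x y -> (al h s j x)%:E <= maximal h y.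
  by move=> xy; rewrite aRE ?lev_gt0//; apply: amax_le_maximal => //; exact: lev_gt0.
pose c := stp N (al h s) (ml f s) C1 (@step_const R n delta C2) delta.
have c01 i x : c i x = 0%R \/ c i x = 1%R.
  by rewrite /c /stp; have [H|H] := pselect ((i <= N)%N /\ cur N (al h s) (ml f s) C1 (@step_const R n delta C2) delta (N - i)%N x = i);
    [right; rewrite indT|left; rewrite indF].
have lc : levelwise s c by exact: stp_levelwise.
have cc j y : (j <= N)%N -> \int[mu]_(x in level_cell s j y) (csum c j x)%:E <= (2 * vol (n := n) s j)%:E.
  by apply: stp_carleson => //; exact: ltW.
have C10 := ltW C1_gt0.
have H1 := @integral_stops R n s s0 N x0 W D (measurable_wE w_weight) (wE_ge0 w_weight) D0 lD kap rho kap0 ritv HW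
  (al h s) B la a0 ad ast B_gt p p_gt0 delta r g Cg rgt0 drp g_gt1 g4 Cg0 HCg c lc c01 cc.
have H2 := @Wsum_total R n s s0 N x0 W D (measurable_wE w_weight) (wE_ge0 w_weight) D0 lD beta th^-1 (beta_itv n_gt0 q_gt1) th0V
  Drec Dnear kap rho kap0 ritv HW (al h s) C1 B la a0 ad ast C10 aw B_gt p (maximal h) p_gt0 Ga N.+1 M eta eta1
  e10 Ceta (fun i T => Hvol s i T s0) Hsmall.
have H3 : (lam N x0 (al h s) B 0 `^ p)%:E * (D N x0 * (vol (n := n) s N)%:E) <=
   K3%:E * \int[mu]_x (maximal h x `^ p * W x).
  rewrite /D /vol Dw_vol ?lev_gt0// /lam expr0 mul1r sN.
  apply: le_wtail => //; first exact/ltW.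
  move=> m y xy; rewrite /al sN aRE//; apply: (le_trans (amax_step_lev mh h0 x0 m t00)).
  apply: lee_wpmul2l; first by rewrite lee_fin !exprn_ge0.
  by apply: amax_le_maximal => //; exact: lev_gt0.
set X := \int[mu]_x (maximal h x `^ p * W x) in H2 H3 *.
have X0 : 0 <= X by apply: integral_ge0 => x _; rewrite mule_ge0 ?poweR_ge0// wE_ge0.
have H4 : (\sum_(k < N.+1) ((lam N x0 (al h s) B k `^ p)%:E * Wsum s N x0 D (al h s) B k)) <= (2 * (K3 + `|K2|))%:E * X.
  apply: (le_trans H2).
  have -> : (2 * (K3 + `|K2|))%:E * X = 2%:E * ((K3 + `|K2|)%:E * X) by rewrite (EFinM 2%R) muleA.
  apply: lee_wpmul2l; first by rewrite lee_fin.
  rewrite EFinD ge0_muleDl ?lee_fin//.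
  apply: leeD => //; apply: lee_wpmul2r => //; rewrite lee_fin; exact: ler_norm.
rewrite EFinM -muleA.
apply: (@le_trans _ _ (\int[mu]_(x in cell t0 x0) (cK%:E * (((\sum_(i < N.+1) c i x * al h s i x `^ delta) `^ r)%:E * W x)))).
  apply: le_integral_nonneg => x xx0; first by rewrite mule_ge0 ?wE_ge0// lee_fin powR_ge0.
  rewrite muleA; apply: lee_wpmul2r; first exact: wE_ge0.
  rewrite -EFinM lee_fin.
  have S0 : (0 <= \sum_(i < N.+1) c i x * al h s i x `^ delta)%R.
    by apply: sumr_ge0 => i _; rewrite mulr_ge0 ?powR_ge0//; exact: stp_ge0.
  rewrite /cK -powRM//.
  apply: le_powR => //; first exact: ltW.
  have := stp_domination C1 a0 ad d0 Cm0 ms x.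
  by rewrite /ml expr0 mulr1 sN (av_idx f xx0).
have eF x y i : idx s x = idx s y -> (c i x * al h s i x `^ delta = c i y * al h s i y `^ delta)%R.
  move=> xy; have xyi := idx_lev0 s0 i xy.
  have -> : c i x = c i y by exact: lc.
  by have -> : al h s i x = al h s i y by exact: la.
pose F x : R := (\sum_(i < N.+1) c i x * al h s i x `^ delta)%R.
have FE x y : idx s x = idx s y -> F x = F y.
  by move=> xy; apply: eq_bigr => i _; exact: eF.
have mS : measurable_fun [set: E] (fun x => (F x `^ r)%:E).
  by apply: (adapted_measurable s0) => x y xy; rewrite (FE x y xy).
rewrite ge0_integralZl//; last 3 first.
- exact: measurable_cell x0 t00.
- apply: emeasurable_funM; last exact: measurable_funTS (measurable_wE w_weight).
  exact: measurable_funTS mS.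
- by move=> x _; rewrite mule_ge0 ?wE_ge0// lee_fin powR_ge0.
apply: lee_wpmul2l; first by rewrite lee_fin.
rewrite EFinM -muleA; move: H1; rewrite /level_cell sN => H1.
apply: (le_trans H1); apply: lee_wpmul2l => //.
Qed.

End local_estimate.

(** * Approximation of measurable sets by unions of cells *)

Section approximable_sets.
Context {R : realType} {n : nat}.
Local Notation E := (euclid R n).
Local Notation mu := (lebesgue R n).
Implicit Types (x y : E) (A B S : set E) (N M : nat).
Variable t0 : R.
Hypothesis t00 : (0 < t0)%R.
Local Notation lev N := (t0 / 2 ^+ N)%R.

Lemma fine_gt0 N : (0 < lev N)%R.
Proof. by rewrite divr_gt0// exprn_gt0. Qed.

Lemma fine_lev N M : (N <= M)%N -> (lev M * 2 ^+ (M - N) = lev N)%R.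
Proof.
move=> NM; have -> : (2 ^+ M = 2 ^+ (M - N) * 2 ^+ N :> R)%R by rewrite -exprD subnK.
by rewrite invfM -mulrA; congr (_ * _)%R; rewrite mulrAC mulVf ?mul1r// expf_neq0.
Qed.

Lemma idx_finer N M x y : (N <= M)%N -> idx (lev M) x = idx (lev M) y ->
  idx (lev N) x = idx (lev N) y.
Proof. by move=> NM xy; have := idx_lev0 (fine_gt0 M) (M - N) xy; rewrite fine_lev. Qed.

Lemma adapted_finer N M S : (N <= M)%N -> adapted (lev N) S -> adapted (lev M) S.
Proof. by move=> NM aS x y xy; apply: aS; exact: idx_finer NM xy. Qed.

Lemma cell_finer N M x y : (N <= M)%N -> cell (lev M) x y -> cell (lev N) x y.
Proof. exact: idx_finer. Qed.

(** The approximation is local, within one large cell, because the measure is infinite. *)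
Definition approximable A : Prop := measurable A /\
  forall x0 (e : R), (0 < e)%R -> exists N S, adapted (lev N) S /\
    mu ((A `\` S `|` S `\` A) `&` cell t0 x0) < e%:E.

Lemma approximable_adapted N S : adapted (lev N) S -> approximable S.
Proof.
move=> aS; split; first exact: (adapted_mset (fine_gt0 N) aS).
by move=> x0 e e0; exists N, S; split=> //; rewrite setDv setU0 set0I measure0 lte_fin.
Qed.

Lemma approximableC A : approximable A -> approximable (~` A).
Proof.
move=> [mA H]; split; first exact: measurableC.
move=> x0 e e0; have [N [S [aS HS]]] := H x0 e e0; exists N, (~` S); split.
  by move=> x y /aS xy; apply/propext; rewrite /setC/= xy.
have -> : ~` A `\` ~` S `|` ~` S `\` ~` A = A `\` S `|` S `\` A.
  by rewrite !setDE !setCK setUC (setIC (~` S)) (setIC (~` A)).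
exact: HS.
Qed.

Let mdiff N A S : measurable A -> adapted (lev N) S -> forall x0,
  measurable ((A `\` S `|` S `\` A) `&` cell t0 x0).
Proof.
move=> mA /(adapted_mset (fine_gt0 N)) mS x0; apply: measurableI; last exact: measurable_cell.
by apply: measurableU; exact: measurableD.
Qed.

Let sym_diffU A B S S' : (A `|` B) `\` (S `|` S') `|` (S `|` S') `\` (A `|` B) `<=`
  (A `\` S `|` S `\` A) `|` (B `\` S' `|` S' `\` B).
Proof. by move=> x /=; tauto. Qed.

Lemma approximableU A B : approximable A -> approximable B -> approximable (A `|` B).
Proof.
move=> [mA HA] [mB HB]; split; first exact: measurableU.
move=> x0 e e0; have e20 : (0 < e / 2)%R by rewrite divr_gt0.
have [N [S [aS HS]]] := HA x0 _ e20; have [M [S' [aS' HS']]] := HB x0 _ e20.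
have aS1 := adapted_finer (leq_maxl N M) aS.
have aS2 := adapted_finer (leq_maxr N M) aS'.
have aU : adapted (lev (maxn N M)) (S `|` S').
  by move=> x y xy; rewrite /setU/= (aS1 x y xy) (aS2 x y xy).
exists (maxn N M), (S `|` S'); split => //.
have mA' := mdiff mA aS x0; have mB' := mdiff mB aS' x0.
apply: (@le_lt_trans _ _ (mu (((A `\` S `|` S `\` A) `&` cell t0 x0) `|` ((B `\` S' `|` S' `\` B) `&` cell t0 x0)))).
  apply: le_measure; rewrite ?inE.
  - apply: (mdiff (measurableU _ _ mA mB) aU).
  - exact: measurableU.
  - by rewrite -setIUl; apply: setSI; exact: sym_diffU.
apply: (le_lt_trans (measureU2 mu mA' mB')).
by rewrite [e]splitr EFinD lteD.
Qed.

Lemma approximable_bigcup (F : (set E)^nat) : (forall k, approximable (F k)) ->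
  approximable (\bigcup_k F k).
Proof.
move=> aF; have mF k : measurable (F k) by case: (aF k).
have mU : measurable (\bigcup_k F k) by exact: bigcup_measurable.
split => // x0 e e0; have e20 : (0 < e / 2)%R by rewrite divr_gt0.
pose G K := \bigcup_(k < K) F k.
have aG K : approximable (G K).
  elim: K => [|K IH].
    rewrite /G bigcup_mkord big_ord0; apply: (@approximable_adapted 0 set0).
    by move=> x y.
  by rewrite /G bigcup_mkord big_ord_recr /= -bigcup_mkord; exact: approximableU.
have mG K : measurable (G K) by case: (aG K).
pose D K := (\bigcup_k F k `\` G K) `&` cell t0 x0.
have mD K : measurable (D K).
  by apply: measurableI; [exact: measurableD|exact: measurable_cell].
have D0 : \bigcap_K D K = set0.
  apply/seteqP; split => // x Hx; have [[[k _ Fx] _] _] := Hx 0%N I.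
  by have [[_ +] _] := Hx k.+1 I; apply; exists k => //=.
have [K HK] : exists K, mu (D K) < (e / 2)%:E.
  have niD : nonincreasing_seq D.
    move=> i j ij; apply/subsetPset => x [[Ux Gx] xx0]; split => //; split => //.
    by move=> [k /= ki Fk]; apply: Gx; exists k => //=; exact: leq_trans ij.
  have D00 : mu (D 0%N) < +oo.
    apply: (@le_lt_trans _ _ (mu (cell t0 x0))).
      by apply: le_measure; rewrite ?inE; [exact: mD|exact: measurable_cell|exact: subIsetr].
    by have := mu_cell x0 t00 => ->; rewrite ltry.
  have := @nonincreasing_cvg_mu _ _ _ mu D D00 mD _ niD; rewrite D0 measure0.
  move=> /(_ measurable0)/fine_cvgP[Hfin /cvgr0Pnorm_lt/(_ _ e20) Hlt].
  near \oo => K; exists K.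
  have f1 : mu (D K) \is a fin_num by near: K; exact: Hfin.
  have f2 : (`|fine (mu (D K))| < e / 2)%R by near: K; exact: Hlt.
  by rewrite -(fineK f1) lte_fin; apply: le_lt_trans f2; exact: ler_norm.
have [N [S [aS HS]]] := (aG K).2 x0 _ e20.
exists N, S; split => //.
have mS := mdiff (mG K) aS x0.
apply: (@le_lt_trans _ _ (mu (((G K `\` S `|` S `\` G K) `&` cell t0 x0) `|` D K))).
  apply: le_measure; rewrite ?inE; [exact: (mdiff mU aS)|exact: measurableU|].
  have GU x : G K x -> (\bigcup_k F k) x by move=> [k _ Fk]; exists k.
  move=> x [H xx0]; have [Gx|Gx] := pselect (G K x).
    by left; split => //; case: H => -[h1 h2]; [left|case: h2; exact: GU].
  case: H => -[h1 h2]; first by right; split.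
  by left; split => //; right.
apply: (le_lt_trans (measureU2 mu mS (mD K))).
by rewrite [e]splitr EFinD lteD.
Unshelve. all: by end_near.
Qed.

Lemma approximable_ray i (a : R) : approximable [set x : E | a < tnth x i]%R.
Proof.
rewrite (_ : [set x | _] = \bigcup_N [set x : E | a < (idx (lev N) x i)%:~R * lev N]%R).
  apply: approximable_bigcup => N; apply: (@approximable_adapted N).
  by move=> x y xy; rewrite /= xy.
have fl N x : ((idx (lev N) x i)%:~R * lev N <= tnth x i < (idx (lev N) x i)%:~R * lev N + lev N)%R.
  have := floor_itv (tnth x i / lev N)%R; rewrite ffunE ler_pdivlMr ?fine_gt0//.
  by rewrite ltr_pdivrMr ?fine_gt0// intrD mulrDl mul1r.
apply/seteqP; split => x /= H; last first.
  by case: H => N _ /lt_le_trans; apply; case/andP: (fl N x).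
have xa : (0 < tnth x i - a)%R by rewrite subr_gt0.
have := @upper_nthrootP R (t0 / (tnth x i - a))%R _ (leqnn _); set N := Num.bound _ => HN.
exists N => //=; case/andP: (fl N x) => _.
rewrite -ltrBlDr; apply: le_lt_trans; rewrite lerBrDr -lerBrDl.
by rewrite ler_pdivrMr ?exprn_gt0// mulrC -ler_pdivrMr// ltW.
Qed.

(** The approximable sets form a sigma-algebra, and the half-spaces bounded by coordinate hyperplanes
    are countable unions of cells. *)
Lemma measurable_approximable A : measurable A -> approximable A.
Proof.
have sa : sigma_algebra setT approximable.
  split; [by apply: (@approximable_adapted 0 set0) => x y| |exact: approximable_bigcup].
  by move=> B aB; rewrite setTD; exact: approximableC.
have coord i (B : set (measurableTypeR R)) : measurable B -> approximable [set x : E | B (tnth x i)].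
  pose P := [set B : set (measurableTypeR R) | approximable [set x : E | B (tnth x i)]].
  have sP : sigma_algebra setT P.
    split; [by apply: (@approximable_adapted 0 set0) => x y| |].
      move=> C /approximableC; rewrite /P/=; congr approximable.
      by apply/seteqP; split => x /=; [move=> h; split|case].
    by move=> F aF; exact: (@approximable_bigcup (fun k => [set x : E | F k (tnth x i)]) aF).
  move: B; suff : measurable `<=` P by [].
  rewrite RGenOInfty.measurableE; apply: smallest_sub => // _ [a ->].
  rewrite /P /= (_ : [set x : E | _] = [set x : E | a < tnth x i]%R); first exact: approximable_ray.
  by apply/seteqP; split => x /=; rewrite in_itv/= andbT.
move: A; suff : measurable `<=` approximable by [].
apply: smallest_sub => //.
apply: (big_ind (fun S : set (set E) => S `<=` approximable)).
- by move=> A [].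
- by move=> S S' HS HS' A [/HS|/HS'].
- by move=> i _ A [B mB <-]; rewrite setTI; exact: (coord i B mB).
Qed.

End approximable_sets.

(** * Dyadic density *)

Section dyadic_density.
Context {R : realType} {n : nat}.
Local Notation E := (euclid R n).
Local Notation mu := (lebesgue R n).
Implicit Types (x y : E) (A B S : set E) (N M : nat).
Variable t0 : R.
Hypothesis t00 : (0 < t0)%R.
Local Notation lev N := (t0 / 2 ^+ N)%R.

Definition dense_at_scale B (t : R) N x : Prop :=
  (t * (lev N) ^+ n)%:E < mu (B `&` cell (lev N) x).

Lemma dense_adapted B t N : adapted (lev N) (dense_at_scale B t N).
Proof. by move=> x y xy; rewrite /dense_at_scale (eq_cell xy). Qed.

(** The weak type estimate at finitely many scales, in the limit. *)
Lemma weak_type_sets B t x0 : measurable B -> (0 < t)%R ->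
  t%:E * mu ([set x | exists N, dense_at_scale B t N x] `&` cell t0 x0) <=
  mu (B `&` cell t0 x0).
Proof.
move=> mB tt0.
pose S M := [set x | exists2 N, (N <= M)%N & dense_at_scale B t N x] `&` cell t0 x0.
have mS M : measurable (S M).
  apply: measurableI; last exact: measurable_cell.
  apply: (adapted_mset (fine_gt0 t00 M)) => x y xy; apply/propext.
  have e N : (N <= M)%N -> dense_at_scale B t N x = dense_at_scale B t N y.
    by move=> NM; apply: dense_adapted; exact: (idx_finer t00 NM xy).
  by split => -[N NM H]; (exists N; first exact: NM); [rewrite -e|rewrite e].
have muS M : t%:E * mu (S M) <= mu (B `&` cell t0 x0).
  have g0 x : 0 <= (\1_B x : R)%:E by rewrite lee_fin.
  have mg : measurable_fun [set: E] (fun x => (\1_B x : R)%:E).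
    by apply/measurable_EFinP/measurable_indic.
  have := @dyadic_weak_type R n (lev M) (fine_gt0 t00 M) (fun x => (\1_B x)%:E) t M x0 tt0 mg g0.
  have mi N x : \int[mu]_(y in cell (lev N) x) (\1_B y)%:E = mu (B `&` cell (lev N) x).
    by apply: (integral_indic mu _ mB); exact: measurable_cell (fine_gt0 t00 N).
  have l0 : (lev M * 2 ^+ M = t0)%R by rewrite divfK// expf_neq0.
  have l00 : (lev 0 = t0)%R by rewrite expr0 divr1.
  have -> : \int[mu]_(y in level_cell (lev M) M x0) (\1_B y)%:E = mu (B `&` cell t0 x0).
    by rewrite -[t0 in RHS]l00 -mi /level_cell l0 l00.
  set A := (X in mu (X `&` _)); have -> : A `&` level_cell (lev M) M x0 = S M.
    rewrite /A /S /level_cell l0; congr (_ `&` _); apply/seteqP; split => x /= [N NM H].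
      exists (M - N)%N; first exact: leq_subr.
      have e : (lev M * 2 ^+ N = lev (M - N))%R.
        by rewrite -[in LHS](subKn NM) fine_lev// leq_subr.
      by move: H; rewrite /vol /dense_at_scale /level_cell e mi.
    exists (M - N)%N; first exact: leq_subr.
    by rewrite /vol /level_cell fine_lev// mi.
  by [].
have ndS : nondecreasing_seq S.
  move=> i j ij; apply/subsetPset => x [[N Ni H] xx0]; split => //.
  by exists N => //; exact: leq_trans ij.
have mU : measurable (\bigcup_M S M) by exact: bigcup_measurable.
have -> : [set x | exists N, dense_at_scale B t N x] `&` cell t0 x0 = \bigcup_M S M.
  apply/seteqP; split => x /=; first by move=> [[N H] xx0]; exists N => //; split => //; exists N.
  by move=> [M _ [[N _ H] xx0]]; split => //; exists N.
have cvg := @nondecreasing_cvg_mu _ _ _ mu S mS mU ndS.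
rewrite muleC -lee_pdivlMr//.
rewrite -(cvg_lim _ cvg)//; apply: lime_le; first by apply/cvg_ex; eexists; exact: cvg.
by near=> M; rewrite /= lee_pdivlMr// muleC.
Unshelve. all: by end_near.
Qed.

(** Almost every point outside of a set is a point of density zero: the set is, up
    to a small measure, a union of cells of one size, and the exceptional part is
    handled by the weak type estimate. *)
Lemma density_negligible B (t : R) x0 : measurable B -> (0 < t)%R ->
  mu.-negligible ([set x | ~ B x /\ forall M, exists2 N, (M <= N)%N & dense_at_scale B t N x] `&` cell t0 x0).
Proof.
move=> mB tt0; set Z := (X in negligible _ X).
have mdn N : measurable [set x | dense_at_scale B t N x].
  exact: (adapted_mset (fine_gt0 t00 N) (@dense_adapted B t N)).
have mZ : measurable Z.
  apply: measurableI; last exact: measurable_cell.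
  rewrite (_ : [set x | _] = ~` B `&` \bigcap_M \bigcup_(N in [set N | (M <= N)%N]) [set x | dense_at_scale B t N x]).
    apply: measurableI; first exact: measurableC.
    by apply: bigcapT_measurable => M; apply: bigcup_measurable => N _; exact: mdn.
  apply/seteqP; split => x /= [Bx H]; split => // M; first by move=> _; have [N MN HN] := H M; exists N.
  by have [N MN HN] := H M I; exists N.
apply/negligibleP; first exact: mZ.
apply/eqP; rewrite eq_le measure_ge0 andbT.
have c0 : (0 < 1 + t^-1)%R by rewrite addr_gt0// invr_gt0.
apply/lee_addgt0Pr => e e0; rewrite add0e.
have e10 : (0 < e / (1 + t^-1))%R by rewrite divr_gt0.
have [M [S [aS HS]]] := (measurable_approximable t00 mB).2 x0 _ e10.
have mS := adapted_mset (fine_gt0 t00 M) aS.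
have mQ := measurable_cell x0 t00.
have mD : measurable (B `\` S) by exact: measurableD.
have mD' : measurable (S `\` B) by exact: measurableD.
pose T := [set x | exists N, dense_at_scale (B `\` S) t N x].
have mT : measurable T.
  rewrite (_ : T = \bigcup_N [set x | dense_at_scale (B `\` S) t N x]).
    apply: bigcup_measurable => N _.
    exact: (adapted_mset (fine_gt0 t00 N) (@dense_adapted _ t N)).
  by apply/seteqP; split => x [N]; [exists N|move=> _ H; exists N].
have sub : Z `<=` ((S `\` B) `&` cell t0 x0) `|` (T `&` cell t0 x0).
  move=> x [[Bx H] xx0]; have [Sx|Sx] := pselect (S x); first by left.
  right; split => //; have [N MN HN] := H M; exists N.
  apply: (lt_le_trans HN); apply: le_measure; rewrite ?inE.
  - by apply: measurableI => //; exact: measurable_cell (fine_gt0 t00 N).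
  - by apply: measurableI => //; exact: measurable_cell (fine_gt0 t00 N).
  move=> y [By yx]; split => //; split => // Sy; apply: Sx.
  by rewrite -(aS y x (cell_finer t00 MN yx)).
have le1 B' : B' `<=` (B `\` S `|` S `\` B) -> measurable B' ->
    mu (B' `&` cell t0 x0) <= (e / (1 + t^-1))%:E.
  move=> BB mB'; apply: le_trans (ltW HS); apply: le_measure; rewrite ?inE.
  - exact: measurableI.
  - by apply: measurableI => //; exact: measurableU.
  - exact: setSI.
apply: (@le_trans _ _ (mu (((S `\` B) `&` cell t0 x0) `|` (T `&` cell t0 x0)))).
  by apply: le_measure; rewrite ?inE//; apply: measurableU; exact: measurableI.
apply: (le_trans (measureU2 mu (measurableI _ _ mD' mQ) (measurableI _ _ mT mQ))).
have -> : e%:E = (e / (1 + t^-1))%:E + (t^-1 * (e / (1 + t^-1)))%:E.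
  rewrite -EFinD; congr EFin; rewrite -[X in (X + _)%R]mul1r -mulrDl.
  by rewrite mulrCA divff ?mulr1// gt_eqF.
apply: leeD; first by apply: le1 => //; exact: subsetUr.
rewrite EFinM -lee_pdivrMl ?invr_gt0// invrK.
apply: (le_trans (weak_type_sets x0 mD tt0)).
by apply: le1 => //; exact: subsetUl.
Qed.

Lemma limn_einf_ge (u : (\bar R)^nat) (b : \bar R) N : (forall k, (N <= k)%N -> b <= u k) ->
  b <= limn_einf u.
Proof.
move=> H; rewrite limn_einf_lim (cvg_lim _ (@cvg_einfs_sup R u))//.
apply: (@le_trans _ _ (einfs u N)); last by apply: ereal_sup_ubound; exists N.
by apply: le_ereal_inf_tmp => _ [k /= Nk <-]; exact: H.
Qed.

Lemma limn_einf_le (u : (\bar R)^nat) (b : \bar R) : (forall k, u k <= b) -> limn_einf u <= b.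
Proof.
move=> H; rewrite limn_einf_lim (cvg_lim _ (@cvg_einfs_sup R u))//.
apply: ge_ereal_sup => _ [N _ <-]; apply: le_trans (H N).
by apply: ereal_inf_lbound; exists N => /=.
Qed.

Variable f : E -> R.
Hypothesis mf : measurable_fun [set: E] f.
Hypothesis f_ge0 : forall x, (0 <= f x)%R.
Hypothesis f_loc : forall t x, (0 < t)%R -> \int[mu]_(y in cell t x) (f y)%:E < +oo.

(** Outside of [B] the function is at least [u], and [B] is a small part of the cell. *)
Lemma mean_lower_bound B t x (u dl : R) : (0 < t)%R -> measurable B -> (0 <= u)%R -> (0 <= dl)%R ->
  (forall y, ~ B y -> (u <= f y)%R) -> mu (B `&` cell t x) <= (dl * t ^+ n)%:E ->
  (u * (1 - dl) <= av f t x)%R.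
Proof.
move=> tt0 mB u0 dl0 Bf Bd; have tn : (0 < t ^+ n)%R by rewrite exprn_gt0.
have mc := measurable_cell x tt0.
have finf : \int[mu]_(y in cell t x) (f y)%:E \is a fin_num.
  by rewrite ge0_fin_numE ?f_loc// integral_ge0// => y _; rewrite lee_fin.
rewrite /av ler_pdivlMr// -lee_fin fineK//.
have mE S : measurable S -> measurable_fun S (fun y => (f y)%:E).
  by move=> mS; apply: measurable_funTS; exact/measurable_EFinP.
have mD : measurable (cell t x `\` B) by exact: measurableD.
apply: (@le_trans _ _ (u%:E * mu (cell t x `\` B))).
  rewrite -mulrA EFinM; apply: lee_wpmul2l => //.
  have -> : mu (cell t x `\` B) = (t ^+ n)%:E - mu (B `&` cell t x).
    have c_fin : mu (cell t x) < +oo by have := mu_cell x tt0 => ->; rewrite ltry.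
    have e := measureD mc mB c_fin; apply: (etrans e).
    by rewrite setIC; congr (_ - _); exact: mu_cell.
  by rewrite mulrBl mul1r EFinB leeB.
rewrite -(integral_cst mu mD); apply: (@le_trans _ _ (\int[mu]_(y in cell t x `\` B) (f y)%:E)).
  by apply: le_integral_nonneg => y [_ By]; rewrite lee_fin//; exact: Bf.
by apply: ge0_subset_integral; [exact: mD|exact: mc|exact: mE|by move=> y _; rewrite lee_fin|exact: subDsetl].
Qed.

(** A one-sided dyadic form of the Lebesgue differentiation theorem: almost every point of a
    level set is a point of density zero of its complement, and rational levels suffice. *)
Lemma av_lower_limit x0 : exists Z, [/\ measurable Z, mu Z = 0 &
  forall x, cell t0 x0 x -> ~ Z x -> forall v, (v < f x)%R ->
    exists M, forall N, (M <= N)%N -> (v <= av f (lev N) x)%R].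
Proof.
have mB (u : R) : measurable [set x | (f x <= u)%R].
  rewrite (_ : [set x | _] = f @^-1` `]-oo, u]); last first.
    by apply/seteqP; split => x /=; rewrite in_itv.
  by rewrite -[X in measurable X]setTI; exact: mf.
pose Zs (p : rat * nat) := [set x | ~ (f x <= ratr p.1)%R /\ forall M, exists2 N, (M <= N)%N &
    dense_at_scale [set x | (f x <= ratr p.1)%R] (p.2.+1%:R^-1) N x] `&` cell t0 x0.
have nZ p : mu.-negligible (Zs p) by apply: density_negligible; [exact: mB|rewrite invr_gt0].
pose F k := if unpickle k is Some p then Zs p else set0.
have [Z [mZ Z0 FZ]] : mu.-negligible (\bigcup_k F k).
  by apply: negligible_bigcup => k; rewrite /F; case: unpickle => // ; exact: negligible_set0.
exists Z; split => // x xx0 Zx v vf.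
have av0 N : (0 <= av f (lev N) x)%R.
  rewrite /av divr_ge0 ?exprn_ge0 ?(ltW (fine_gt0 t00 N))// fine_ge0//.
  by apply: integral_ge0 => y _; rewrite lee_fin.
have [v0|v0] := ltP v 0%R.
  by exists 0%N => N _; apply: (le_trans (ltW v0)).
have [u uv] := rat_in_itvoo vf.
move: uv; rewrite in_itv/= => /andP[vu uf].
have u0 : (0 < ratr u :> R)%R by exact: le_lt_trans v0 vu.
have uv0 : (0 < ratr u - v)%R by rewrite subr_gt0.
pose k := Num.bound (ratr u / (ratr u - v) : R)%R.
have kb : (ratr u / (ratr u - v) < k.+1%:R :> R)%R.
  apply: (@lt_le_trans _ _ k%:R); last by rewrite ler_nat.
  by apply: archi_boundP; rewrite divr_ge0// ltW.
have [m mE] : exists m, unpickle m = Some (u, k) by exists (pickle (u, k)); exact: pickleK.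
have : ~ Zs (u, k) x by move=> H; apply: Zx; apply: FZ; exists m; [exact: I|rewrite /F mE; exact: H].
move=> H; have [M HM] : exists M, forall N, (M <= N)%N ->
    ~ dense_at_scale [set x | (f x <= ratr u)%R] (k.+1%:R^-1) N x.
  apply: contrapT => NM; apply: H; split => //; split; first by apply/negP; rewrite -ltNge.
  by move=> M; apply: contrapT => NN; apply: NM; exists M => N MN HN; apply: NN; exists N.
exists M => N MN; have /negP := HM N MN; rewrite -leNgt => H2.
apply: le_trans (mean_lower_bound (fine_gt0 t00 N) (mB (ratr u)) (ltW u0) _ _ H2).
- rewrite mulrBr mulr1 lerBrDr -lerBrDl ler_pdivrMr//.
  by move: kb; rewrite ltr_pdivrMr// mulrC => /ltW.
- by rewrite invr_ge0.
- by move=> y /= /negP; rewrite -ltNge => /ltW.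
Qed.

(** The lower limit of [av_lower_limit] passes through the power and through the weight. *)
Lemma fatou_av (w : E -> R) (r : R) (b : \bar R) x0 : (0 < r)%R ->
  measurable_fun [set: E] w -> (forall x, 0 <= w x)%R ->
  (forall N, \int[mu]_(x in cell t0 x0) ((av f (lev N) x `^ r)%:E * (w x)%:E) <= b) ->
  \int[mu]_(x in cell t0 x0) ((f x `^ r)%:E * (w x)%:E) <= b.
Proof.
move=> r0 mw w0 Hb; have mc := measurable_cell x0 t00.
pose u N x := (av f (lev N) x `^ r)%:E * (w x)%:E.
have u0 N x : 0 <= u N x by rewrite mule_ge0 ?lee_fin ?powR_ge0.
have mu_ N : measurable_fun (cell t0 x0) (u N).
  apply: emeasurable_funM; apply: measurable_funTS; last exact/measurable_EFinP.
  apply: (adapted_measurable (fine_gt0 t00 N)) => x y xy.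
  by rewrite (av_idx f xy).
apply: le_trans (limn_einf_le Hb); apply: le_trans (fatou mu mc mu_ (fun N x _ => u0 N x)).
have [Z [mZ Z0 HZ]] := av_lower_limit x0.
apply: ae_ge0_le_integral => //.
- by move=> x _; rewrite mule_ge0 ?lee_fin ?powR_ge0.
- apply: emeasurable_funM; apply: measurable_funTS; last exact/measurable_EFinP.
  by apply/measurable_EFinP; apply: (measurableT_comp (measurable_powR r)).
- by move=> x _; apply: (@limn_einf_ge _ _ 0) => k _; exact: u0.
- apply: measurableT_comp => //; apply: measurable_fun_limn_esup => N.
  exact: measurableT_comp.
exists Z; split => // x /= H; apply: contrapT => Zx; apply: H => xx0.
have [wx0|wx0] := eqVneq (w x) 0%R.
  by rewrite wx0 mule0; apply: (@limn_einf_ge _ _ 0) => k _; exact: u0.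
have wp : (0 < w x)%R by rewrite lt_neqAle eq_sym wx0 w0.
have [fx0|fx0] := eqVneq (f x) 0%R.
  by rewrite fx0 powR0 ?gt_eqF// mul0e; apply: (@limn_einf_ge _ _ 0) => k _; exact: u0.
have fp : (0 < f x)%R by rewrite lt_neqAle eq_sym fx0 f_ge0.
apply/lee_addgt0Pr => e e0.
have [z [z0 zf hz]] : exists z : R, [/\ 0 <= z, z < f x `^ r & f x `^ r - e / w x <= z]%R.
  exists (Num.max 0%R (f x `^ r - e / w x)%R); split.
  - by rewrite le_max lexx.
  - by rewrite gt_max powR_gt0//= ltrBlDr ltrDl divr_gt0.
  - by rewrite le_max lexx orbT.
have vf : (z `^ r^-1 < f x)%R.
  rewrite -[ltRHS](powRr1 (ltW fp)) -(divff (lt0r_neq0 r0)) powRrM.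
  by apply: gt0_ltr_powR; rewrite ?invr_gt0// nnegrE ?powR_ge0.
have [M HM] := HZ x xx0 Zx _ vf.
rewrite -leeBlDr//; apply: (@limn_einf_ge _ _ M) => N MN.
rewrite /u -!EFinM -EFinB lee_fin.
have h1 : (z <= av f (lev N) x `^ r)%R.
  have -> : (z = (z `^ r^-1) `^ r)%R by rewrite -powRrM mulVf ?powRr1// lt0r_neq0.
  have h2 := HM N MN.
  by apply: le_powR; [exact: ltW|exact: powR_ge0|exact: h2].
rewrite -[e](divfK wx0) -mulrBl ler_pM2r//; exact: le_trans hz h1.
Qed.

End dyadic_density.

(** * Large cells *)

Section exhaustion.
Context {R : realType} {n : nat}.
Local Notation E := (euclid R n).
Local Notation mu := (lebesgue R n).

(** Only the triples of the dyadic cells exhaust the space, since a cell never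
    leaves its orthant. *)
Lemma integral_le_cells (F : E -> \bar R) (B : \bar R) : measurable_fun [set: E] F ->
  (forall x, 0 <= F x) -> 0 <= B ->
  (forall t x, (0 < t)%R -> \int[mu]_(y in cell t x) F y <= B) ->
  \int[mu]_x F x <= (3 ^+ n)%:E * B.
Proof.
move=> mF F0 B0 FB; pose x0 : E := [tuple 0%R | _ < n].
have tri t : (0 < t)%R -> \int[mu]_(y in cell3 t x0) F y <= (3 ^+ n)%:E * B.
  move=> t0; have tn : (0 < t ^+ n)%R by rewrite exprn_gt0.
  have m3 := measurable_cell3 x0 t0.
  have b0 : 0 <= ((t ^+ n)^-1)%:E * B by rewrite mule_ge0// lee_fin invr_ge0 ltW.
  apply: (@le_trans _ _ (\int[mu]_(y in cell3 t x0) (((t ^+ n)^-1)%:E * B))).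
    apply: (le_integral_cells t0) => //; first exact: measurable_funTS.
    move=> x; have [xx0|xx0] := pselect (cell3 t x0 x).
      have -> : cell3 t x0 `&` cell t x = cell t x.
        by apply/setIidPr => y yx; move: xx0; rewrite /cell3/= -yx.
      rewrite (integral_cst mu (measurable_cell x t0)).
      rewrite muleAC; have -> : ((t ^+ n)^-1)%:E * mu (cell t x) = 1.
        by have := mu_cell x t0 => ->; rewrite -EFinM mulVf// gt_eqF.
      by rewrite mul1e; exact: FB.
    have -> : cell3 t x0 `&` cell t x = set0.
      by apply/seteqP; split => // y [yx0 yx]; apply: xx0; move: yx0; rewrite /cell3/= yx.
    by rewrite !integral_set0.
  rewrite (integral_cst mu m3) muleAC.
  have -> : ((t ^+ n)^-1)%:E * mu (cell3 t x0) = (3 ^+ n)%:E.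
    have := mu_cell3 x0 t0 => ->; rewrite -EFinM exprMn; congr EFin.
    by rewrite mulrCA mulVf ?mulr1// gt_eqF.
  by [].
pose D i := cell3 (1 * 2 ^+ i)%R x0 : set E.
have l0 i : (0 < 1 * 2 ^+ i :> R)%R by exact: lev_gt0.
have ndD : nondecreasing_seq D.
  apply/nondecreasing_seqP => i; apply/subsetPset => y.
  exact: (@adj_lev R n 1%R i i.+1 y x0 ltr01 (leqnSn i)).
have mD i : measurable (D i) by exact: measurable_cell3.
have DT : \bigcup_i D i = [set: E].
  by apply/seteqP; split => // y _; have [i Hi] := far_cell3 x0 y ltr01; exists i.
have cvg := @ge0_nondecreasing_set_cvg_integral _ _ _ D F mu ndD mD
  (fun i => measurable_funTS mF) (fun i x _ => F0 x).
rewrite DT in cvg.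
rewrite -(cvg_lim _ cvg)//; apply: lime_le; first by apply/cvg_ex; eexists; exact: cvg.
by near=> i; exact: tri.
Unshelve. all: by end_near.
Qed.

(** The larger of the two terms dominates, whatever the exponent. *)
Lemma powRD2 (r u v : R) : (0 <= r)%R -> (0 <= u)%R -> (0 <= v)%R ->
  ((u + v) `^ r <= 2 `^ r * (u `^ r + v `^ r))%R.
Proof.
move=> r0 u0 v0; wlog uv : u v u0 v0 / (u <= v)%R.
  by move=> H; have [uv|/ltW vu] := leP u v; [exact: H|rewrite addrC (addrC (u `^ r)%R); exact: H].
apply: (@le_trans _ _ ((2 * v) `^ r)%R); first by apply: le_powR; rewrite ?addr_ge0//; lra.
by rewrite powRM// ler_wpM2l ?powR_ge0// lerDr powR_ge0.
Qed.

End exhaustion.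

Section core_estimate.
Context {R : realType} {n : nat}.
Hypothesis n_gt0 : (0 < n)%N.
Local Notation E := (euclid R n).
Local Notation mu := (lebesgue R n).
Implicit Types (t : R) (x y : E).
Variables (h : E -> \bar R) (f : E -> R) (delta C2 : R).
Hypothesis delta_gt0 : (0 < delta)%R.
Hypothesis C2_gt0 : (0 < C2)%R.
Hypothesis hf : controlled delta C2 h f.
Hypothesis f_level : forall t, (0 < t)%R -> mu [set x | (t < f x)%R] < +oo.

Local Notation C3 := (@osc_const R n delta C2).

(** The averages over large cells are small, because the level sets have finite
    measure: this fixes the additive constant that the oscillations do not see. *)
Lemma av_large t t1 x1 : (0 < t)%R -> (0 < t1)%R -> exists i,
  (av f (t1 * 2 ^+ i) x1 <= t + 2 * C3 * aR h (t1 * 2 ^+ i) x1 `^ delta)%R.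
Proof.
move=> t0 t10; have [[mh h0 af mf f0] fo] := hf.
have mA : measurable [set x | (t < f x)%R].
  rewrite (_ : [set x | _] = f @^-1` `]t, +oo[); last first.
    by apply/seteqP; split => x /=; rewrite in_itv/= andbT.
  by rewrite -[X in measurable X]setTI; exact: mf.
have Afin : mu [set x | (t < f x)%R] \is a fin_num.
  by rewrite ge0_fin_numE//; exact: f_level.
pose V := fine (mu [set x | (t < f x)%R]).
have V0 : (0 <= V)%R by exact: fine_ge0.
have VE : mu [set x | (t < f x)%R] = V%:E by rewrite fineK.
pose i := Num.bound ((1 + 2 * V) / t1)%R.
have Hi : (1 + 2 * V <= t1 * 2 ^+ i)%R.
  have := @upper_nthrootP R ((1 + 2 * V) / t1)%R _ (leqnn i).
  by rewrite ltr_pdivrMr// (mulrC t1) => /ltW.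
exists i; set s := (t1 * 2 ^+ i)%R in Hi *.
have s0 : (0 < s)%R by exact: lev_gt0.
have s1 : (1 <= s)%R by apply: le_trans Hi; rewrite lerDl mulr_ge0.
have sn : (0 < s ^+ n)%R by rewrite exprn_gt0.
have Vs : (2 * V <= s ^+ n)%R.
  apply: (@le_trans _ _ s); first by apply: le_trans Hi; rewrite lerDr.
  by have := ler_weXn2l s1 n_gt0; rewrite expr1.
have [ct|tc] := leP (av f s x1) t.
  have c3 : (0 <= C3)%R by apply/ltW/osc_const_gt0.
  by apply: (le_trans ct); rewrite lerDl mulr_ge0 ?powR_ge0// mulr_ge0.
have mc := measurable_cell x1 s0.
have mD : measurable (cell s x1 `\` [set x | (t < f x)%R]) by exact: measurableD.
have md c D : measurable D -> measurable_fun D (fun y => `|f y - c|%:E).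
  move=> mD'; apply: measurable_funTS; apply/measurable_EFinP; apply: measurableT_comp => //.
  exact: measurable_funB.
have := osc_av n_gt0 mh h0 af mf f0 delta_gt0 C2_gt0 fo x1 s0 => H1.
have H2 : ((av f s x1 - t) * (s ^+ n / 2))%:E <= \int[mu]_(y in cell s x1) `|f y - av f s x1|%:E.
  apply: (@le_trans _ _ (\int[mu]_(y in cell s x1 `\` [set x | (t < f x)%R]) `|f y - av f s x1|%:E)); last first.
    by apply: ge0_subset_integral; [exact: mD|exact: mc|exact: md|by move=> y _; rewrite lee_fin|exact: subDsetl].
  apply: (@le_trans _ _ ((av f s x1 - t)%:E * mu (cell s x1 `\` [set x | (t < f x)%R]))).
    rewrite EFinM; apply: lee_wpmul2l; first by rewrite lee_fin subr_ge0 ltW.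
    have c_fin : mu (cell s x1) < +oo by have := mu_cell x1 s0 => ->; rewrite ltry.
    have e := measureD mc mA c_fin; rewrite [leRHS]e.
    apply: (@le_trans _ _ ((s ^+ n)%:E - V%:E)); first by rewrite -EFinB lee_fin; lra.
    have sc : (s ^+ n)%:E <= mu (cell s x1) by have := mu_cell x1 s0 => ->.
    apply: leeB; first exact: sc.
    by rewrite -VE; apply: le_measure; rewrite ?inE//; exact: measurableI.
  rewrite -(integral_cst mu mD); apply: le_integral_nonneg => y; first by rewrite lee_fin subr_ge0 ltW.
  move=> [_ /negP]; rewrite -leNgt => fy; rewrite lee_fin distrC.
  by apply: le_trans (ler_norm _); rewrite lerD2l lerN2.
have := le_trans H2 H1; rewrite lee_fin.
have -> : ((av f s x1 - t) * (s ^+ n / 2) = (av f s x1 - t) / 2 * s ^+ n)%R by ring.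
rewrite ler_pM2r// => H; lra.
Qed.

End core_estimate.

(** * The weighted estimate *)

Section weighted_estimate.
Context {R : realType} {n : nat}.
Hypothesis n_gt0 : (0 < n)%N.
Local Notation E := (euclid R n).
Local Notation mu := (lebesgue R n).
Implicit Types (t : R) (x y : E).
Variables (w : E -> R) (q c0 de : R).
Hypothesis w_weight : weight w.
Hypothesis q_gt1 : (1 < q)%R.
Hypothesis c0_gt0 : (0 < c0)%R.
Hypothesis de_gt0 : (0 < de)%R.
Hypothesis w_Cq : forall Q (A : set E), is_cube Q -> measurable A -> A `<=` Q ->
  \int[mu]_(x in A) (w x)%:E <= c0%:E * (mu A / mu Q) `^ de *
     \int[mu]_x (maximal (fun y => (\1_Q y)%:E) x `^ q * (w x)%:E).
Variable (p : R).
Hypothesis p_gt0 : (0 < p)%R.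
Hypothesis pq : (p < q)%R.

Lemma weight_cell t x : (0 < t)%R -> \int[mu]_(y in cell t x) (w y)%:E < +oo.
Proof.
move=> t0; have [mw w0 wfin] := w_weight; have [Q [cQ sQ _ _]] := cell_sub_cube x t0.
apply: le_lt_trans (wfin Q cQ); apply: ge0_subset_integral => //.
- exact: measurable_cell.
- exact: measurable_cube.
- by apply: measurable_funTS; exact/measurable_EFinP.
- by move=> y _; rewrite lee_fin.
Qed.


(** [local_estimate] is applied on an ancestor so large that the average of [f] is at most [t]
    up to a term controlled by the maximal function; the weight of the given cell being
    finite, the error vanishes with [t]. *)
Lemma cell_estimate (delta C2 : R) : (0 < delta)%R -> (0 < C2)%R ->
  exists C : R, (0 <= C)%R /\ forall h f, controlled delta C2 h f ->
  (forall t, (0 < t)%R -> mu [set x | (t < f x)%R] < +oo) ->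
  forall t1 x1, (0 < t1)%R ->
  \int[mu]_(x in cell t1 x1) ((f x `^ (p / delta))%:E * (w x)%:E) <=
  C%:E * \int[mu]_x (maximal h x `^ p * (w x)%:E).
Proof.
move=> d0 C20; pose r := (p / delta)%R.
have r0 : (0 < r)%R by rewrite divr_gt0.
have drp : (delta * r = p)%R by rewrite mulrC divfK// gt_eqF.
have [C [C0 HC]] := local_estimate n_gt0 w_weight q_gt1 c0_gt0 de_gt0 w_Cq p_gt0 pq d0 C20.
pose c3 := (2 * @osc_const R n delta C2)%R.
have c30 : (0 <= c3)%R by rewrite mulr_ge0// ltW// osc_const_gt0.
pose T := (2 `^ r : R)%R.
have T0 : (0 < T)%R by rewrite powR_gt0.
exists (T * C + T * (T * c3 `^ r))%R; split.
  by rewrite addr_ge0 ?mulr_ge0 ?powR_ge0 ?(ltW T0).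
move=> h f hf flev t1 x1 t10; have [[mh h0 af mf f0] fo] := hf.
have [mw w0 _] := w_weight.
set X := \int[mu]_x (maximal h x `^ p * (w x)%:E).
have M0 x : 0 <= maximal h x.
  apply: le_trans (amax_le_maximal mh h0 t10 (cell_cell3 (cell_refl t1 x))).
  exact: amax_ge0.
have X0 : 0 <= X by apply: integral_ge0 => x _; rewrite mule_ge0 ?poweR_ge0 ?lee_fin.
have mc := measurable_cell x1 t10.
have wfin : \int[mu]_(y in cell t1 x1) (w y)%:E \is a fin_num.
  by rewrite ge0_fin_numE ?weight_cell// integral_ge0// => y _; rewrite lee_fin.
pose V := fine (\int[mu]_(y in cell t1 x1) (w y)%:E).
have VE : V%:E = \int[mu]_(y in cell t1 x1) (w y)%:E by rewrite fineK.
have V0 : (0 <= V)%R by apply: fine_ge0; apply: integral_ge0 => y _; rewrite lee_fin.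
have V1 : (0 < 1 + V)%R by rewrite ltr_pwDl.
apply/lee_addgt0Pr => e e0.
(* [t] is chosen after the cell, so that its contribution is at most [e] *)
have [t t0 tr] : exists2 t, (0 < t)%R & (T * (T * t `^ r) * V <= e)%R.
  have z0 : (0 < e / (T * T * (1 + V)))%R by rewrite divr_gt0// !mulr_gt0.
  exists ((e / (T * T * (1 + V))) `^ r^-1)%R; first exact: powR_gt0.
  rewrite -powRrM mulVf ?gt_eqF// powRr1 ?(ltW z0)//.
  have -> : (T * (T * (e / (T * T * (1 + V)))) * V = e * (V / (1 + V)))%R.
    by field; rewrite !lt0r_neq0.
  by rewrite ler_piMr ?(ltW e0)// ler_pdivrMr// mul1r lerDr.
have [i Hi] := av_large n_gt0 d0 C20 hf flev x1 t0 t10.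
pose s := (t1 * 2 ^+ i)%R.
have s0 : (0 < s)%R by exact: lev_gt0.
pose c := av f s x1; pose a := aR h s x1.
have a0 : (0 <= a)%R by apply/ltW/aR_gt0.
have c_ge0 : (0 <= c)%R.
  rewrite /c /av divr_ge0 ?exprn_ge0 ?(ltW s0)// fine_ge0//.
  by apply: integral_ge0 => y _; rewrite lee_fin.
pose K := (T * (t `^ r + c3 `^ r * a `^ p))%R.
have K0 : (0 <= K)%R by rewrite mulr_ge0 ?(ltW T0)// addr_ge0 ?mulr_ge0 ?powR_ge0.
have cK : (c `^ r <= K)%R.
  apply: (@le_trans _ _ ((t + c3 * a `^ delta) `^ r)%R); first by apply: le_powR; rewrite ?(ltW r0).
  apply: le_trans (powRD2 (ltW r0) (ltW t0) (mulr_ge0 c30 (powR_ge0 _ _))) _.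
  by rewrite powRM ?powR_ge0// -powRrM drp.
have sub : cell t1 x1 `<=` cell s x1.
  by move=> y; exact: (idx_lev0 t10 i).
have aX : (a `^ p * V)%:E <= X.
  rewrite EFinM VE -ge0_integralZl//; last 3 first.
  - by apply: measurable_funTS; exact/measurable_EFinP.
  - by move=> y _; rewrite lee_fin.
  - by rewrite lee_fin powR_ge0.
  rewrite /X integral_mkcond; apply: le_integral_nonneg => y _.
    by apply: erestrict_ge0 => z _; rewrite mule_ge0 ?lee_fin ?powR_ge0.
  rewrite /patch; case: ifPn; rewrite ?inE => yx; last by rewrite mule_ge0 ?poweR_ge0 ?lee_fin.
  apply: lee_wpmul2r; first by rewrite lee_fin.
  rewrite -poweR_EFin; apply: le_poweR; [exact: ltW|by rewrite lee_fin|].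
  rewrite /a aRE//; apply: amax_le_maximal => //.
  by apply: cell_cell3; exact: sub.
have mav N : measurable_fun [set: E] (fun x => (`|av f (t1 / 2 ^+ N) x - c| `^ r)%:E).
  apply: (adapted_measurable (fine_gt0 t10 N)) => x y xy; by rewrite (av_idx f xy).
have mwc : measurable_fun (cell t1 x1) (fun x => (w x)%:E).
  by apply: measurable_funTS; exact/measurable_EFinP.
have main N : \int[mu]_(x in cell t1 x1) ((`|av f (t1 / 2 ^+ N) x - c| `^ r)%:E * (w x)%:E) <= C%:E * X.
  apply: le_trans (HC h f hf s (N + i)%N x1 s0).
  have -> : (s / 2 ^+ (N + i) = t1 / 2 ^+ N)%R.
    by rewrite /s exprD; field; rewrite !expf_neq0.
  apply: ge0_subset_integral; [exact: mc|exact: measurable_cell| | |exact: sub].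
  - apply: measurable_funTS; apply: emeasurable_funM; [exact: mav|exact/measurable_EFinP].
  - by move=> y _; rewrite mule_ge0 ?lee_fin ?powR_ge0.
apply: (fatou_av t10 mf f0 (integrable_cell n_gt0 mh h0 af mf f0 d0 C20 fo) r0 mw w0) => N.
apply: (@le_trans _ _ (\int[mu]_(x in cell t1 x1) (T%:E * ((`|av f (t1 / 2 ^+ N) x - c| `^ r)%:E * (w x)%:E + K%:E * (w x)%:E)))).
  apply: le_integral_nonneg => x _; first by rewrite mule_ge0 ?lee_fin ?powR_ge0.
  rewrite -!EFinM -[leRHS]/(T * (`|av f (t1 / 2 ^+ N) x - c| `^ r * w x + K * w x))%:E lee_fin.
  rewrite -mulrDl mulrA; apply: ler_wpM2r; first exact: w0.
  apply: (@le_trans _ _ (T * (`|av f (t1 / 2 ^+ N) x - c| `^ r + c `^ r))%R); last first.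
    by rewrite ler_wpM2l ?(ltW T0)// lerD2l.
  apply: le_trans (powRD2 (ltW r0) (normr_ge0 _) c_ge0).
  apply: le_powR; first exact: ltW.
    rewrite /av divr_ge0 ?exprn_ge0 ?(ltW (fine_gt0 t10 N))// fine_ge0//.
    by apply: integral_ge0 => y _; rewrite lee_fin.
  by rewrite -lerBlDr ler_norm.
have pos1 x : 0 <= (`|av f (t1 / 2 ^+ N) x - c| `^ r)%:E * (w x)%:E.
  by rewrite mule_ge0 ?lee_fin ?powR_ge0.
have m1 : measurable_fun (cell t1 x1) (fun x => (`|av f (t1 / 2 ^+ N) x - c| `^ r)%:E * (w x)%:E).
  by apply: emeasurable_funM; [exact: measurable_funTS|exact: mwc].
have pos2 x : 0 <= K%:E * (w x)%:E by rewrite mule_ge0 ?lee_fin.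
have m2 : measurable_fun (cell t1 x1) (fun x => K%:E * (w x)%:E) by exact: emeasurable_funM.
rewrite ge0_integralZl//; last 3 first.
- exact: emeasurable_funD.
- by move=> x _; rewrite adde_ge0.
- by rewrite lee_fin ltW.
rewrite ge0_integralD// (@ge0_integralZl_EFin _ _ _ mu _ mc (fun x => (w x)%:E))//; last first.
  by move=> x _; rewrite lee_fin.
rewrite -VE -EFinM ge0_muleDr; last 2 first.
- exact: integral_ge0.
- by rewrite lee_fin mulr_ge0.
have -> : T%:E * (K * V)%:E = (T * (T * c3 `^ r))%:E * (a `^ p * V)%:E + (T * (T * t `^ r) * V)%:E.
  by rewrite -!EFinM -EFinD; congr EFin; rewrite /K; ring.
rewrite EFinD ge0_muleDl ?lee_fin ?mulr_ge0 ?powR_ge0 ?(ltW T0)// -addeA.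
apply: leeD.
  rewrite EFinM -muleA; apply: lee_wpmul2l; [by rewrite lee_fin ltW|exact: main].
apply: leeD; last by rewrite lee_fin.
by apply: lee_wpmul2l => //; rewrite lee_fin !mulr_ge0 ?powR_ge0 ?(ltW T0).
Qed.

Lemma weighted_estimate (delta C2 : R) : (0 < delta)%R -> (0 < C2)%R ->
  exists C : R, (0 <= C)%R /\ forall h f, controlled delta C2 h f ->
  (forall t, (0 < t)%R -> mu [set x | (t < f x)%R] < +oo) ->
  \int[mu]_x ((f x `^ (p / delta))%:E * (w x)%:E) <=
  C%:E * \int[mu]_x (maximal h x `^ p * (w x)%:E).
Proof.
move=> d0 C20; have [C [C0 HC]] := cell_estimate d0 C20.
exists (3 ^+ n * C)%R; split; first by rewrite mulr_ge0 ?exprn_ge0.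
move=> h f hf flev; have [[mh h0 af mf f0] fo] := hf.
have [mw w0 _] := w_weight.
rewrite EFinM -muleA; apply: integral_le_cells.
- apply: emeasurable_funM; last exact/measurable_EFinP.
  by apply/measurable_EFinP; apply: (measurableT_comp (measurable_powR _)).
- by move=> x; rewrite mule_ge0 ?lee_fin ?powR_ge0.
- rewrite mule_ge0 ?lee_fin//; apply: integral_ge0 => x _.
  by rewrite mule_ge0 ?poweR_ge0 ?lee_fin.
- by move=> t x t0; exact: HC.
Qed.

End weighted_estimate.

(** * Degenerate cases *)

Section vanishing_oscillation.
Context {R : realType} {n : nat}.
Hypothesis n_gt0 : (0 < n)%N.
Local Notation E := (euclid R n).
Local Notation mu := (lebesgue R n).

Lemma amax_cst (e t : R) (x : E) : (0 < t)%R -> amax (fun=> e%:E : \bar R) t x = e%:E.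
Proof.
move=> t0; have avg s : (0 < s)%R -> avg3 (fun=> e%:E) s x = e%:E :> \bar R.
  move=> s0; have n0 : (0 < (3 * s) ^+ n)%R by rewrite exprn_gt0// mulr_gt0.
  rewrite /avg3 (integral_cst mu (measurable_cell3 x s0)) muleCA.
  have -> : (((3 * s) ^+ n)^-1)%:E * mu (cell3 s x) = 1.
    by have := mu_cell3 x s0 => ->; rewrite -EFinM mulVf// gt_eqF.
  by rewrite mule1.
apply/eqP; rewrite eq_le; apply/andP; split.
  by apply: ge_ereal_sup => _ /= [m _ <-]; rewrite avg// lev_gt0.
by rewrite -{1}(avg _ t0); exact: avg3_le_amax0.
Qed.

(** A function without oscillation is controlled by every constant; its averages
    over large cells tend to zero, hence it vanishes. *)
Lemma integral_no_oscillation (f : E -> R) : measurable_fun [set: E] f ->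
  (forall x, 0 <= f x)%R -> (forall t, (0 < t)%R -> mu [set x | (t < f x)%R] < +oo) ->
  (forall Q x, is_cube Q -> Q x ->
    ereal_inf [set mean Q (fun y => `|(f y)%:E - c%:E|) | c in [set: R]] <= 0) ->
  \int[mu]_x (f x)%:E = 0.
Proof.
move=> mf f0 flev fo.
have M0 (e : R) (x : E) : (0 < e)%R -> 0 <= maximal (fun=> e%:E) x.
  move=> e0; apply: (@le_trans _ _ (amax (fun=> e%:E : \bar R) 1%R x)).
    by rewrite amax_cst// lee_fin ltW.
  apply: amax_le_maximal => //; first by move=> _; rewrite lee_fin ltW.
  exact: cell_cell3 (cell_refl 1%R x).
have ctl (e : R) : (0 < e)%R -> controlled 1 1 (fun=> e%:E) f.
  move=> e0; split.
    split => //; first by move=> _; rewrite lee_fin ltW.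
    by move=> t x t0; rewrite amax_cst// lte_fin e0 ltry.
  by move=> Q x cQ Qx; apply: (le_trans (fo Q x cQ Qx)); rewrite mule_ge0// poweR_ge0.
have aE (e t : R) (x : E) : (0 < t)%R -> aR (fun=> e%:E : \bar R) t x = e.
  by move=> t0; rewrite /aR amax_cst.
pose c3 := @osc_const R n 1 1.
have c30 : (0 < c3)%R by exact: osc_const_gt0.
have osc t (x : E) : (0 < t)%R -> \int[mu]_(y in cell t x) `|f y - av f t x|%:E <= 0.
  move=> t0; have tn : (0 < t ^+ n)%R by rewrite exprn_gt0.
  apply/lee_addgt0Pr => e e0; rewrite add0e.
  have z0 : (0 < e / (c3 * t ^+ n))%R by rewrite divr_gt0// mulr_gt0.
  have [[mh h0 af _ _] fo'] := ctl _ z0.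
  apply: (le_trans (osc_av n_gt0 mh h0 af mf f0 ltr01 ltr01 fo' x t0)).
  rewrite aE// powRr1 ?(ltW z0)// lee_fin -/c3 le_eqVlt; apply/orP; left; apply/eqP.
  by field; rewrite expf_neq0 ?lt0r_neq0.
have cellz t1 (x1 : E) : (0 < t1)%R -> \int[mu]_(y in cell t1 x1) (f y)%:E <= 0.
  move=> t10; have tn : (0 < t1 ^+ n)%R by rewrite exprn_gt0.
  have mc := measurable_cell x1 t10.
  apply/lee_addgt0Pr => e e0; rewrite add0e.
  pose t := (e / (2 * t1 ^+ n))%R.
  have t0 : (0 < t)%R by rewrite divr_gt0// mulr_gt0.
  have z0 : (0 < t / (2 * c3))%R by rewrite divr_gt0// mulr_gt0.
  have [i Hi] := av_large n_gt0 ltr01 ltr01 (ctl _ z0) flev x1 t0 t10.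
  have s0 := lev_gt0 i t10; move: Hi; rewrite aE// powRr1 ?(ltW z0)// -/c3.
  set s := (t1 * 2 ^+ i)%R in s0 *.
  have -> : (2 * c3 * (t / (2 * c3)) = t)%R by field; exact: lt0r_neq0.
  move=> Hi; have av0 : (0 <= av f s x1)%R.
    rewrite /av divr_ge0 ?exprn_ge0 ?(ltW s0)// fine_ge0//.
    by apply: integral_ge0 => y _; rewrite lee_fin.
  have md D : measurable D -> measurable_fun D (fun y => `|f y - av f s x1|%:E).
    move=> mD; apply: measurable_funTS; apply/measurable_EFinP; apply: measurableT_comp => //.
    exact: measurable_funB.
  apply: (@le_trans _ _ (\int[mu]_(y in cell t1 x1) (`|f y - av f s x1|%:E + (av f s x1)%:E))).
    apply: le_integral_nonneg => y _; first by rewrite lee_fin.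
    by rewrite -EFinD lee_fin -lerBlDr ler_norm.
  rewrite ge0_integralD//; last exact: md.
  have H1 : \int[mu]_(y in cell t1 x1) `|f y - av f s x1|%:E <= 0.
    apply: le_trans (osc s x1 s0); apply: ge0_subset_integral.
    - exact: mc.
    - exact: measurable_cell.
    - by apply: md; exact: measurable_cell.
    - by move=> y _; rewrite lee_fin.
    - by move=> y; exact: (idx_lev0 t10 i).
  apply: (@le_trans _ _ (0 + ((t + t) * t1 ^+ n)%:E)).
    apply: leeD; first exact: H1.
    rewrite (integral_cst mu mc) -[X in _ * X <= _]/(mu (cell t1 x1)).
    have -> : mu (cell t1 x1) = (t1 ^+ n)%:E by exact: mu_cell.
    by rewrite -EFinM lee_fin ler_wpM2r// ltW.
  rewrite add0e lee_fin le_eqVlt; apply/orP; left; apply/eqP.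
  by rewrite /t; field; rewrite expf_neq0// lt0r_neq0.
apply/eqP; rewrite eq_le integral_ge0 ?andbT; last by move=> x _; rewrite lee_fin.
rewrite -(mule0 (3 ^+ n)%:E); apply: integral_le_cells => //.
- exact/measurable_EFinP.
Qed.

End vanishing_oscillation.

Section general_estimate.
Context {R : realType} {n : nat}.
Hypothesis n_gt0 : (0 < n)%N.
Local Notation E := (euclid R n).
Local Notation mu := (lebesgue R n).
Variables (w : E -> R) (p eps : R).
Hypothesis p_gt0 : (0 < p)%R.
Hypothesis eps_gt0 : (0 < eps)%R.
Hypothesis wC : Cp_weight (Num.max 1 p + eps)%R w.

(** [amax] at a larger scale loses only a finite factor, and its triples reach every point. *)
Lemma maximal_infinite (h : E -> \bar R) t x y : measurable_fun [set: E] h ->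
  (forall z, 0 <= h z) -> (0 < t)%R -> amax h t x = +oo -> maximal h y = +oo.
Proof.
move=> mh h0 t0 a; have [m xy] := far_cell3 x y t0.
have := amax_step_lev mh h0 x m t0; rewrite a leye_eq => /eqP H.
have := amax_le_maximal mh h0 (lev_gt0 m t0) xy.
have : amax h (t * 2 ^+ m)%R x = +oo.
  apply/eqP; rewrite -leye_eq leNgt; apply/negP => lt.
  have A0 : 0 <= (((2 ^+ n) ^+ m : R)%:E) by rewrite lee_fin !exprn_ge0.
  by have := lte_mul_pinfty A0 isT lt; rewrite H ltxx.
by move=> ->; rewrite leye_eq => /eqP.
Qed.

(** The triples exhaust the space, so [h] has integral zero. *)
Lemma maximal_zero (h : E -> \bar R) t x y : measurable_fun [set: E] h ->
  (forall z, 0 <= h z) -> (0 < t)%R -> amax h t x = 0 -> maximal h y = 0.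
Proof.
move=> mh h0 t0 a.
have D0 i : \int[mu]_(z in cell3 (t * 2 ^+ i)%R x) h z <= 0.
  have := avg3_le_amax h t x i; rewrite a /avg3.
  rewrite lee_pdivrMl ?mule0//; by rewrite exprn_gt0// mulr_gt0// lev_gt0.
pose D i := cell3 (t * 2 ^+ i)%R x : set E.
have ndD : nondecreasing_seq D.
  apply/nondecreasing_seqP => i; apply/subsetPset => z.
  exact: (@adj_lev R n t i i.+1 z x t0 (leqnSn i)).
have mD i : measurable (D i) by apply: measurable_cell3; exact: lev_gt0.
have DT : \bigcup_i D i = [set: E].
  by apply/seteqP; split => // z _; have [i Hi] := far_cell3 x z t0; exists i.
have cvg := @ge0_nondecreasing_set_cvg_integral _ _ _ D h mu ndD mD
  (fun i => measurable_funTS mh) (fun i x _ => h0 x).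
rewrite DT in cvg.
have ih : \int[mu]_z h z <= 0.
  rewrite -(cvg_lim _ cvg)//; apply: lime_le; first by apply/cvg_ex; eexists; exact: cvg.
  by near=> i; exact: D0.
apply/eqP; rewrite eq_le; apply/andP; split; last first.
  apply: le_trans (amax_le_maximal mh h0 t0 (cell_cell3 (cell_refl t y))).
  exact: amax_ge0.
apply: ge_ereal_sup => _ /= [Q [cQ Qy] <-].
have mQ := measurable_cube cQ.
rewrite /mean (@eq_integral _ _ _ mu Q h); last by move=> z _; exact: gee0_abs.
have -> : \int[mu]_(z in Q) h z = 0.
  apply/eqP; rewrite eq_le integral_ge0// andbT; apply: le_trans ih.
  exact: ge0_subset_integral.
by rewrite mul0e.
Unshelve. all: by end_near.
Qed.

(** Outside of the situation of [weighted_estimate], the maximal function is infinite everywhere and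
    there is nothing to prove, or zero everywhere and then [f] vanishes. *)
Lemma maximal_controls_oscillation (delta C2 : R) : (0 < delta)%R -> (0 < C2)%R ->
  exists C : R, (0 < C)%R /\ forall (h : E -> \bar R) (f : E -> R),
  measurable_fun [set: E] h -> (forall x, 0 <= h x) ->
  measurable_fun [set: E] f -> (forall x, 0 <= f x)%R ->
  (forall t, (0 < t)%R -> mu [set x | (t < f x)%R] < +oo) ->
  (forall Q x, is_cube Q -> Q x ->
    ereal_inf [set mean Q (fun y => `|(f y)%:E - c%:E|) | c in [set: R]] <=
    C2%:E * maximal h x `^ delta) ->
  \int[mu]_x ((f x `^ (p / delta))%:E * (w x)%:E) <=
  C%:E * \int[mu]_x (maximal h x `^ p * (w x)%:E).
Proof.
move=> d0 C20; have [ww [c0 [de [c00 de0 Hw]]]] := wC.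
have [mw w0 _] := ww.
have q1 : (1 < Num.max 1 p + eps)%R.
  by apply: (@le_lt_trans _ _ (Num.max 1 p)%R); [rewrite le_max lexx|rewrite ltrDl].
have pq : (p < Num.max 1 p + eps)%R.
  by apply: (@le_lt_trans _ _ (Num.max 1 p)%R); [rewrite le_max lexx orbT|rewrite ltrDl].
have [C [C0 HC]] := weighted_estimate n_gt0 ww q1 c00 de0 Hw p_gt0 pq d0 C20.
exists (C + 1)%R; split; first by rewrite ltr_wpDl.
move=> h f mh h0 mf f0 flev fo.
have X0 : 0 <= \int[mu]_x (maximal h x `^ p * (w x)%:E).
  by apply: integral_ge0 => x _; rewrite mule_ge0 ?poweR_ge0 ?lee_fin.
have r0 : (0 < p / delta)%R by rewrite divr_gt0.
have [[t [x [t0 ai]]]|Ni] := pselect (exists t x, (0 < t)%R /\ amax h t x = +oo).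
  rewrite -[leLHS]mul1e; apply: lee_pmul => //.
  - by apply: integral_ge0 => y _; rewrite mule_ge0 ?lee_fin ?powR_ge0.
  - by rewrite lee_fin lerDr.
  apply: le_integral_nonneg => y _; first by rewrite mule_ge0 ?lee_fin ?powR_ge0.
  apply: lee_wpmul2r; first by rewrite lee_fin.
  by rewrite (maximal_infinite y mh h0 t0 ai) poweRyr ?gt_eqF// leey.
have [[t [x [t0 az]]]|Nz] := pselect (exists t x, (0 < t)%R /\ amax h t x = 0).
  have Mz y : maximal h y = 0 by exact: maximal_zero az.
  have fz : \int[mu]_x (f x)%:E = 0.
    apply: integral_no_oscillation => // Q y cQ Qy; apply: (le_trans (fo Q y cQ Qy)).
    by rewrite Mz poweR0r ?mule0// gt_eqF.
  suff -> : \int[mu]_x ((f x `^ (p / delta))%:E * (w x)%:E) = 0.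
    by rewrite mule_ge0// lee_fin addr_ge0.
  have := @ge0_ae_eq_integral _ _ _ mu setT (fun x => (f x `^ (p / delta))%:E * (w x)%:E) (cst 0).
  rewrite integral0; apply => //.
  - apply: emeasurable_funM; last exact/measurable_EFinP.
    by apply/measurable_EFinP; apply: (measurableT_comp (measurable_powR _)).
  - by move=> y _; rewrite mule_ge0 ?lee_fin ?powR_ge0.
  have : ae_eq mu setT (fun x => (f x)%:E) (cst 0).
    apply/ae_eq_integral_abs => //; first exact/measurable_EFinP.
    by rewrite -[RHS]fz; apply: eq_integral => y _; rewrite gee0_abs// lee_fin.
  apply: filterS => y H _; have fy : f y = 0%R by have := H I => -[].
  rewrite /= fy.
  by rewrite powR0 ?mul0e// gt_eqF.
have af t x : (0 < t)%R -> 0 < amax h t x < +oo.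
  move=> t0; rewrite lt_neqAle amax_ge0// andbT; apply/andP; split.
    by apply/eqP => e; apply: Nz; exists t, x.
  by rewrite ltey; apply/eqP => e; apply: Ni; exists t, x.
apply: (le_trans (HC h f _ flev)); first by split.
by apply: lee_wpmul2r => //; rewrite lee_fin lerDl.
Qed.

End general_estimate.

(** * The scalar inequality *)

Section maximal_functions.
Context {R : realType} {n : nat}.
Local Notation E := (euclid R n).
Local Notation mu := (lebesgue R n).
Implicit Types (F G : E -> \bar R).

Lemma mean_ge0 (Q : set E) F : (forall y, 0 <= F y) -> 0 <= mean Q F.
Proof. by move=> F0; rewrite /mean mule_ge0 ?inve_ge0 ?measure_ge0// integral_ge0. Qed.

Lemma exists_cube (x : E) : exists2 Q, is_cube Q & Q x.
Proof.
have [Q [cQ sQ _ _]] := cell_sub_cube x (ltr01 : (0 < 1 :> R)%R).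
by exists Q => //; apply: sQ; exact: cell_refl.
Qed.

Lemma maximal_ge0 F x : 0 <= maximal F x.
Proof.
have [Q cQ Qx] := exists_cube x.
apply: (@le_trans _ _ (mean Q (fun y => `|F y|))); first by apply: mean_ge0 => y; exact: abse_ge0.
by apply: ereal_sup_ubound; exists Q.
Qed.

Lemma le_maximal F G x : (forall y, `|F y| <= `|G y|) -> maximal F x <= maximal G x.
Proof.
move=> FG; apply: ge_ereal_sup => _ /= [Q [cQ Qx] <-].
apply: (@le_trans _ _ (mean Q (fun y => `|G y|))).
  apply: lee_wpmul2r; first by rewrite inve_ge0 measure_ge0.
  by apply: le_integral_nonneg => y _ //; exact: abse_ge0.
by apply: ereal_sup_ubound; exists Q.
Qed.

Lemma maximal_abse F x : maximal (fun y => `|F y|) x = maximal F x.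
Proof. by apply/eqP; rewrite eq_le; apply/andP; split; apply: le_maximal => y; rewrite abse_id. Qed.

(** The form in which the sharp maximal function is used: one cube at a time, and without the power
    [delta^-1]. *)
Lemma oscillation_of_sharp (delta c : R) F x (g : \bar R) : (0 < delta)%R -> (0 < c)%R -> 0 <= g ->
  sharp_maximal_pow delta F x <= c%:E * g -> forall Q, is_cube Q -> Q x ->
  ereal_inf [set mean Q (fun y => `| `|F y| `^ delta - d%:E|) | d in [set: R]] <=
  (c `^ delta)%:E * g `^ delta.
Proof.
move=> d0 c0 g0 H Q cQ Qx; pose S := sharp_maximal (fun y => `|F y| `^ delta) x.
have infS P : is_cube P -> P x ->
    ereal_inf [set mean P (fun y => `| `|F y| `^ delta - d%:E|) | d in [set: R]] <= S.
  by move=> cP Px; apply: ereal_sup_ubound; exists P.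
have S0 : 0 <= S.
  apply: le_trans (infS Q cQ Qx); apply: le_ereal_inf_tmp => _ [d _ <-].
  by apply: mean_ge0 => y; exact: abse_ge0.
apply: (le_trans (infS Q cQ Qx)).
have -> : S = (S `^ delta^-1) `^ delta by rewrite -poweRrM mulVf ?gt_eqF// poweRe1.
rewrite -poweR_EFin -poweRM ?lee_fin ?(ltW c0)//.
by apply: le_poweR => //; [exact: ltW|exact: poweR_ge0].
Qed.

Lemma le_weighted_norm (w : E -> R) (p C : R) F G : (0 < p)%R -> (0 <= C)%R ->
  (forall x, 0 <= w x)%R ->
  \int[mu]_x (`|F x| `^ p * (w x)%:E) <= C%:E * \int[mu]_x (`|G x| `^ p * (w x)%:E) ->
  weighted_norm p w F <= (C `^ p^-1)%:E * weighted_norm p w G.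
Proof.
move=> p0 C0 w0 H; rewrite /weighted_norm -poweR_EFin -poweRM ?lee_fin//.
  apply: le_poweR => //; first by rewrite invr_ge0 ltW.
  by apply: integral_ge0 => x _; rewrite mule_ge0 ?poweR_ge0 ?lee_fin.
by apply: integral_ge0 => x _; rewrite mule_ge0 ?poweR_ge0 ?lee_fin.
Qed.

End maximal_functions.

Section bounded_by_maximal.
Context {R : realType} {n : nat}.
Hypothesis n_gt0 : (0 < n)%N.
Local Notation E := (euclid R n).
Local Notation mu := (lebesgue R n).
Variables (X : set (E -> R)) (T : (E -> R) -> E -> R).
Hypothesis opT : operator_on X T.
Hypothesis DT : condition_D X T.
Variables (p eps : R) (w : E -> R).
Hypothesis p_gt0 : (0 < p)%R.
Hypothesis eps_gt0 : (0 < eps)%R.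
Hypothesis wC : Cp_weight (Num.max 1 p + eps)%R w.

Let w_ge0 x : (0 <= w x)%R. Proof. by case: wC => -[]. Qed.

Lemma measurable_abs_powR (g : E -> R) (r : R) : measurable_fun [set: E] g ->
  measurable_fun [set: E] (fun x => `|g x| `^ r)%R.
Proof.
move=> mg; apply: (measurableT_comp (measurable_powR _)).
exact: measurableT_comp.
Qed.

Lemma level_powR (g : E -> R) (r : R) : (0 < r)%R ->
  (forall t, (0 < t)%R -> mu [set x | (t < `|g x|)%R] < +oo) ->
  forall t, (0 < t)%R -> mu [set x | (t < `|g x| `^ r)%R] < +oo.
Proof.
move=> r0 H t t0; have -> : [set x | (t < `|g x| `^ r)%R] = [set x | (t `^ r^-1 < `|g x|)%R].
  apply/seteqP; split => x /= Hx.
    rewrite ltNge; apply/negP => H1; move: Hx; rewrite ltNge => /negP; apply.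
    have -> : (t = (t `^ r^-1) `^ r)%R by rewrite -powRrM mulVf ?gt_eqF// powRr1// ltW.
    by apply: le_powR => //; exact: ltW.
  have -> : (t = (t `^ r^-1) `^ r)%R by rewrite -powRrM mulVf ?gt_eqF// powRr1// ltW.
  by apply: gt0_ltr_powR => //; rewrite nnegrE// powR_ge0.
by apply: H; exact: powR_gt0.
Qed.

Lemma scalar_bound : exists c : R, (0 < c)%R /\
     forall f, X f ->
       weighted_norm p w (EFin \o T f) <=
       c%:E * weighted_norm p w (maximal (EFin \o f)).
Proof.
have [X0 Xm XTm Xlev] := opT; have [delta [c [/andP[d0 d1] c0 H]]] := DT.
have [C [C0 HC]] := maximal_controls_oscillation n_gt0 p_gt0 eps_gt0 wC d0 (powR_gt0 delta c0).
exists (C `^ p^-1)%R; split; first exact: powR_gt0.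
move=> f Xf; apply: le_weighted_norm => //; first exact: ltW.
have := HC (fun y => `|(f y)%:E|) (fun y => `|T f y| `^ delta)%R.
have e1 x : ((`|T f x| `^ delta) `^ (p / delta) = `|T f x| `^ p)%R.
  by rewrite -powRrM mulrC divfK// gt_eqF.
have -> : \int[mu]_x (((`|T f x| `^ delta) `^ (p / delta))%:E * (w x)%:E) =
          \int[mu]_x (`|(EFin \o T f) x| `^ p * (w x)%:E).
  by apply: eq_integral => x _; rewrite e1 -poweR_EFin.
have -> : \int[mu]_x (maximal (fun y => `|(f y)%:E|) x `^ p * (w x)%:E) =
          \int[mu]_x (`|maximal (EFin \o f) x| `^ p * (w x)%:E).
  by apply: eq_integral => x _; rewrite (maximal_abse (EFin \o f)) gee0_abs// maximal_ge0.
apply.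
- by apply: measurableT_comp => //; apply/measurable_EFinP; exact: Xm.
- by move=> x; exact: abse_ge0.
- exact: measurable_abs_powR (XTm f Xf).
- by move=> x; exact: powR_ge0.
- by apply: level_powR => // t; exact: Xlev.
move=> Q x cQ Qx; rewrite (maximal_abse (EFin \o f)).
have := oscillation_of_sharp d0 c0 (maximal_ge0 (EFin \o f) x) (H f Xf x) cQ Qx.
have -> // : [set mean Q (fun y => `| `|(EFin \o T f) y| `^ delta - d%:E|) | d in [set: R]] =
   [set mean Q (fun y => `|(`|T f y| `^ delta)%:E - d%:E|) | d in [set: R]].
by apply: eq_imagel => d _; congr (mean Q _); apply/funext => y; rewrite -poweR_EFin.
Qed.

(** The maximal function of zero is zero, so the image has no oscillation. It need not vanish
    everywhere, as the hypotheses on the operator ignore null sets. *)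
Lemma image_zero_ae : exists Z, [/\ measurable Z, mu Z = 0 & forall x, ~ Z x -> T (fun=> 0%R) x = 0%R].
Proof.
have [X0 Xm XTm Xlev] := opT; have [delta [c [/andP[d0 d1] c0 H]]] := DT.
pose f x := (`|T (fun=> 0%R) x| `^ delta)%R.
have mf : measurable_fun [set: E] f by exact: measurable_abs_powR (XTm _ X0).
have f0 x : (0 <= f x)%R by exact: powR_ge0.
have Mz (x : E) : maximal (EFin \o (fun _ : E => 0%R : R)) x = 0.
  have mh : measurable_fun [set: E] (EFin \o (fun _ : E => 0%R : R)) by apply: (measurable_cst (0%:E)).
  by apply: (@maximal_zero R n _ 1%R x x mh) => //; exact: (amax_cst 0%R x ltr01).
have fz : \int[mu]_x (f x)%:E = 0.
  apply: integral_no_oscillation => //.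
    by apply: level_powR => // t; exact: Xlev.
  move=> Q x cQ Qx.
  have := oscillation_of_sharp d0 c0 (maximal_ge0 _ x) (H _ X0 x) cQ Qx.
  rewrite Mz poweR0r ?gt_eqF// mule0.
  have -> // : [set mean Q (fun y => `| `|(EFin \o T (fun=> 0%R)) y| `^ delta - d%:E|) | d in [set: R]] =
     [set mean Q (fun y => `|(f y)%:E - d%:E|) | d in [set: R]].
  by apply: eq_imagel => d _; congr (mean Q _); apply/funext => y; rewrite -poweR_EFin.
have : ae_eq mu setT (fun x => (f x)%:E) (cst 0).
  apply/ae_eq_integral_abs => //; first exact/measurable_EFinP.
  by rewrite -[RHS]fz; apply: eq_integral => y _; rewrite gee0_abs// lee_fin.
move=> [Z [mZ Z0 HZ]]; exists Z; split => // x Zx.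
have : f x = 0%R.
  apply: contrapT => fx; apply: Zx; apply: HZ => /= H1; apply: fx.
  by have := H1 I => -[].
by move/eqP; rewrite powR_eq0 => /andP[/eqP/normr0_eq0].
Qed.

End bounded_by_maximal.

(** * The vector-valued inequality *)

Section vector_valued.
Context {R : realType} {n : nat}.
Hypothesis n_gt0 : (0 < n)%N.
Local Notation E := (euclid R n).
Local Notation mu := (lebesgue R n).
Variables (X : set (E -> R)) (T : (E -> R) -> E -> R).
Hypothesis opT : operator_on X T.
Hypothesis DT : condition_D X T.
Variables (p eps : R) (w : E -> R).
Hypothesis p_gt0 : (0 < p)%R.
Hypothesis eps_gt0 : (0 < eps)%R.
Hypothesis wC : Cp_weight (Num.max 1 p + eps)%R w.
Variable q : R.
Hypothesis q_gt1 : (1 < q)%R.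

Let q_gt0 : (0 < q)%R. Proof. exact: lt_trans q_gt1. Qed.

Let term_ge0 (f : nat -> E -> R) j x : 0 <= `|(f j x)%:E| `^ q.
Proof. exact: poweR_ge0. Qed.

Lemma measurable_lq_norm (f : nat -> E -> R) : (forall j, measurable_fun [set: E] (f j)) ->
  measurable_fun [set: E] (lq_norm q f).
Proof.
move=> mf; apply: (measurableT_comp (measurable_poweR _)).
apply: ge0_emeasurable_sum => // j _; apply: (measurableT_comp (measurable_poweR _)).
by apply: measurableT_comp => //; exact/measurable_EFinP.
Qed.

(** Padding by zero stays in the domain of the operator. *)
Definition truncation N (f : nat -> E -> R) j : E -> R := if (j < N)%N then f j else fun=> 0%R.

Lemma lq_norm_truncation N f x : lq_norm q (truncation N f) x <= lq_norm q f x.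
Proof.
apply: le_poweR; first by rewrite invr_ge0 ltW.
  by apply: nneseries_ge0 => j _ _; exact: term_ge0.
apply: lee_nneseries => [j _ _|j _]; first exact: term_ge0.
rewrite /truncation; case: ifP => // _.
by rewrite abse0 poweR0r ?gt_eqF//; exact: term_ge0.
Qed.

Definition partial_norm N (f : nat -> E -> R) x : R :=
  ((\sum_(j < N) `|f j x| `^ q) `^ q^-1)%R.

Let sum_ge0 N (f : nat -> E -> R) x : (0 <= \sum_(j < N) `|f j x| `^ q)%R.
Proof. by apply: sumr_ge0 => j _; exact: powR_ge0. Qed.

Lemma measurable_partial_norm N (f : nat -> E -> R) : (forall j, measurable_fun [set: E] (f j)) ->
  measurable_fun [set: E] (partial_norm N f).
Proof.
move=> mf; apply: (measurableT_comp (measurable_powR _)).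
by apply: measurable_sum => j; exact: measurable_abs_powR.
Qed.

Lemma partial_normS N M f x : (N <= M)%N -> (partial_norm N f x <= partial_norm M f x)%R.
Proof.
move=> /subnK <-; elim: (M - N)%N => // k IH; apply: (le_trans IH).
apply: le_powR; rewrite ?invr_ge0 ?(ltW q_gt0)// addSn big_ord_recr /= lerDl.
exact: powR_ge0.
Qed.

(** Where the image of zero vanishes, only the first [N] terms of the series remain. *)
Lemma lq_norm_image_truncation N f x : T (fun=> 0%R) x = 0%R ->
  lq_norm q (fun j => T (truncation N f j)) x = (partial_norm N (fun j => T (f j)) x)%:E.
Proof.
move=> Tx; rewrite /lq_norm /partial_norm -poweR_EFin; congr (_ `^ _).
pose u j := `|(T (truncation N f j) x)%:E| `^ q.
have u0 j : 0 <= u j by exact: poweR_ge0.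
have := @nneseries_split R u 0 N (fun k _ => u0 k).
rewrite add0n (@eseries0 R u N xpredT); last first.
  move=> j Nj _; rewrite /u /truncation ltnNge Nj /= Tx normr0.
  by rewrite powR0// gt_eqF.
rewrite adde0 => ->; rewrite big_mkord -sumEFin; apply: eq_bigr => j _.
by rewrite /u /truncation ltn_ord -poweR_EFin.
Qed.

(** If the norm of [N] numbers exceeds [t], one of them exceeds [t / N.+1 ^ (1 / q)]. *)
Lemma partial_norm_level N (f : nat -> E -> R) : (forall j, measurable_fun [set: E] (f j)) ->
  (forall j (t : R), (0 < t)%R -> mu [set x | (t < `|f j x|)%R] < +oo) ->
  forall t : R, (0 < t)%R -> mu [set x | (t < `|partial_norm N f x|)%R] < +oo.
Proof.
move=> mf H t t0; pose t' := ((t `^ q / N.+1%:R) `^ q^-1)%R.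
have t'0 : (0 < t')%R by rewrite powR_gt0// divr_gt0// powR_gt0.
have ml (g : E -> R) (s : R) : measurable_fun [set: E] g -> measurable [set x : E | (s < `|g x|)%R].
  move=> mg; have mag : measurable_fun [set: E] (fun x => `|g x|)%R by exact: measurableT_comp.
  rewrite (_ : [set x | _] = (fun x => `|g x|)%R @^-1` `]s, +oo[); last first.
    by apply/seteqP; split => x /=; rewrite in_itv/= andbT.
  by rewrite -[X in measurable X]setTI; exact: mag.
pose A j := [set x | (t' < `|f j x|)%R].
have sub : [set x | (t < `|partial_norm N f x|)%R] `<=` \big[setU/set0]_(j < N) A j.
  move=> x /= Hx; rewrite -bigcup_mkord; apply: contrapT => NA.
  move: Hx; rewrite ltNge => /negP; apply; rewrite ger0_norm ?powR_ge0//.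
  have -> : (t = (t `^ q) `^ q^-1)%R by rewrite -powRrM divff ?gt_eqF// powRr1// ltW.
  apply: le_powR; [by rewrite invr_ge0 ltW|exact: sum_ge0|].
  apply: (@le_trans _ _ (\sum_(j < N) t `^ q / N.+1%:R)%R).
    apply: ler_sum => j _.
    have -> : (t `^ q / N.+1%:R = t' `^ q)%R.
      by rewrite /t' -powRrM mulVf ?gt_eqF// powRr1// divr_ge0// powR_ge0.
    apply: le_powR => //; first exact: ltW.
    by rewrite leNgt; apply/negP => lt; apply: NA; exists j => //=.
  rewrite sumr_const card_ord -[(_ *+ N)%R]mulr_natr -mulrA ler_piMr ?powR_ge0//.
  by rewrite mulrC ler_pdivrMr// mul1r ler_nat.
apply: (@le_lt_trans _ _ (mu (\big[setU/set0]_(j < N) A j))).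
  apply: le_measure; rewrite ?inE //; first by apply: ml; exact: measurable_partial_norm.
  by apply: bigsetU_measurable => j _; exact: ml.
apply: (le_lt_trans (le_mu_bigsetU mu _)); first by move=> j _; exact: ml.
by apply: lte_sum_pinfty => j _; exact: H.
Qed.

(** The norm is the supremum of its truncations; inverting the powers avoids their continuity at
    infinity. *)
Lemma lq_norm_le (f : nat -> E -> R) x (B : \bar R) : 0 <= B ->
  (forall N, (partial_norm N f x `^ p)%:E <= B) -> lq_norm q f x `^ p <= B.
Proof.
move=> B0 H; have qV : (0 <= q^-1)%R by rewrite invr_ge0 ltW.
have pV : (0 <= p^-1)%R by rewrite invr_ge0 ltW.
have pE N : \sum_(0 <= j < N) `|(f j x)%:E| `^ q = (\sum_(j < N) `|f j x| `^ q)%:E.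
  by rewrite big_mkord -sumEFin; apply: eq_bigr => j _; rewrite -poweR_EFin.
have SB : \sum_(0 <= j <oo) `|(f j x)%:E| `^ q <= (B `^ p^-1) `^ q.
  apply: lime_le; first by apply: is_cvg_nneseries => j _ _; exact: term_ge0.
  near=> N; rewrite pE.
  have -> : (\sum_(j < N) `|f j x| `^ q)%:E = ((partial_norm N f x)%:E) `^ q.
    by rewrite poweR_EFin /partial_norm -powRrM mulVf ?gt_eqF// powRr1.
  apply: le_poweR; [exact: ltW|by rewrite lee_fin powR_ge0|].
  have -> : (partial_norm N f x)%:E = (partial_norm N f x `^ p)%:E `^ p^-1.
    by rewrite poweR_EFin -powRrM divff ?gt_eqF// powRr1// powR_ge0.
  by apply: le_poweR => //; rewrite lee_fin powR_ge0.
have -> : B = (((B `^ p^-1) `^ q) `^ q^-1) `^ p.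
  rewrite -!poweRrM (_ : (_ * _)%R = 1%R) ?poweRe1//.
  by field; rewrite !gt_eqF.
apply: le_poweR; [exact: ltW|exact: poweR_ge0|].
by apply: le_poweR => //; apply: nneseries_ge0 => j _ _; exact: term_ge0.
Unshelve. all: by end_near.
Qed.

Lemma vector_bound : condition_Dq q X T -> exists c : R, (0 < c)%R /\
  forall f : nat -> E -> R, (forall j, X (f j)) ->
    weighted_norm p w (lq_norm q (fun j => T (f j))) <=
    c%:E * weighted_norm p w (maximal (lq_norm q f)).
Proof.
move=> Dq; have [X0 Xm XTm Xlev] := opT; have [[mw w0 _] _] := wC.
have d0 : (0 < 2^-1 :> R)%R by rewrite invr_gt0.
have d1 : (0 < (2^-1 : R) < 1)%R by rewrite d0 invf_lt1// ltr1n.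
(* any exponent below one would do *)
set delta : R := (2^-1)%R in d0 d1.
have [c [c0 H]] := Dq delta d1.
have [C [C0 HC]] := maximal_controls_oscillation n_gt0 p_gt0 eps_gt0 wC d0 (powR_gt0 delta c0).
have [Z [mZ Z0 TZ]] := image_zero_ae n_gt0 opT DT.
exists (C `^ p^-1)%R; split; first exact: powR_gt0.
move=> f Xf; apply: le_weighted_norm => //; first exact: ltW.
have mTf j : measurable_fun [set: E] (T (f j)) by exact: XTm.
have Xt N j : X (truncation N f j) by rewrite /truncation; case: ifP.
have L0 (g : nat -> E -> R) x : 0 <= lq_norm q g x by exact: poweR_ge0.
have -> : \int[mu]_x (`|maximal (lq_norm q f) x| `^ p * (w x)%:E) =
          \int[mu]_x (maximal (lq_norm q f) x `^ p * (w x)%:E).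
  by apply: eq_integral => x _; rewrite gee0_abs// maximal_ge0.
pose P N := partial_norm N (fun j => T (f j)).
have P0 N x : (0 <= P N x)%R by exact: powR_ge0.
have mP N : measurable_fun [set: E] (P N) by exact: measurable_partial_norm.
have PN N x : `|P N x|%R = P N x by exact: ger0_norm.
have trunc N : \int[mu]_x ((P N x `^ p)%:E * (w x)%:E) <=
    C%:E * \int[mu]_x (maximal (lq_norm q f) x `^ p * (w x)%:E).
  apply: (@le_trans _ _ (\int[mu]_x (((P N x `^ delta) `^ (p / delta))%:E * (w x)%:E))).
    apply: le_integral_nonneg => x _; first by rewrite mule_ge0 ?lee_fin ?powR_ge0.
    by rewrite -powRrM mulrC divfK// gt_eqF.
  apply: (HC (lq_norm q f) (fun y => P N y `^ delta)%R).
  - by apply: measurable_lq_norm => j; exact: Xm.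
  - exact: L0.
  - exact: (measurableT_comp (measurable_powR _) (mP N)).
  - by move=> x; exact: powR_ge0.
  - move=> t t0; suff -> : [set x | (t < P N x `^ delta)%R] = [set x | (t < `|P N x| `^ delta)%R].
      apply: level_powR t0 => //; apply: partial_norm_level => // j t'; exact: Xlev.
    by apply/seteqP; split => x /=; rewrite PN.
  move=> Q x cQ Qx; have mQ := measurable_cube cQ.
  have M0 := maximal_ge0 (lq_norm q (truncation N f)) x.
  have Mle : maximal (lq_norm q (truncation N f)) x <= maximal (lq_norm q f) x.
    by apply: le_maximal => y; rewrite !gee0_abs//; exact: lq_norm_truncation.
  apply: (@le_trans _ _ ((c `^ delta)%:E * maximal (lq_norm q (truncation N f)) x `^ delta)); last first.
    apply: lee_wpmul2l; first by rewrite lee_fin powR_ge0.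
    by apply: le_poweR; [exact: ltW d0|exact: M0|exact: Mle].
  have := oscillation_of_sharp d0 c0 M0 (H _ (Xt N) x) cQ Qx.
  have -> // : [set mean Q (fun y => `| `|lq_norm q (fun j => T (truncation N f j)) y| `^ delta - d%:E|) | d in [set: R]] =
     [set mean Q (fun y => `|(P N y `^ delta)%:E - d%:E|) | d in [set: R]].
  apply: eq_imagel => d _.
  suff e : \int[mu]_(y in Q) `| `|lq_norm q (fun j => T (truncation N f j)) y| `^ delta - d%:E| =
           \int[mu]_(y in Q) `|(P N y `^ delta)%:E - d%:E| by rewrite /mean e.
  have mL : measurable_fun [set: E] (lq_norm q (fun j => T (truncation N f j))).
    by apply: measurable_lq_norm => j; exact: XTm.
  apply: ae_eq_integral => //.
  - apply: measurable_funTS; apply: measurableT_comp => //; apply: emeasurable_funB => //.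
    by apply: (measurableT_comp (measurable_poweR _)); exact: measurableT_comp.
  - apply: measurable_funTS; apply: measurableT_comp => //; apply: emeasurable_funB => //.
    by apply/measurable_EFinP; exact: (measurableT_comp (measurable_powR _) (mP N)).
  exists Z; split => // y /= Hy; apply: contrapT => Zy; apply: Hy => _.
  by rewrite (lq_norm_image_truncation N f (TZ y Zy)) /= -/(P N y) PN.
pose u N x := (P N x `^ p)%:E * (w x)%:E.
have u0 N x : 0 <= u N x by rewrite mule_ge0 ?lee_fin ?powR_ge0.
have mu_ N : measurable_fun [set: E] (u N).
  apply: emeasurable_funM; last exact/measurable_EFinP.
  by apply/measurable_EFinP; exact: (measurableT_comp (measurable_powR _) (mP N)).
apply: le_trans (limn_einf_le trunc).
apply: le_trans (fatou mu measurableT mu_ (fun N x _ => u0 N x)).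
apply: le_integral_nonneg => x _; first by rewrite mule_ge0 ?poweR_ge0 ?lee_fin.
rewrite gee0_abs//.
have [wx0|wx0] := eqVneq (w x) 0%R.
  by rewrite wx0 mule0; apply: (@limn_einf_ge R _ _ 0%N) => k _; exact: u0.
have wp : (0 < w x)%R by rewrite lt_neqAle eq_sym wx0 w0.
rewrite muleC -lee_pdivlMl//.
have uB N : u N x <= limn_einf (u^~ x).
  apply: (@limn_einf_ge R _ _ N) => k Nk; apply: lee_wpmul2r; first by rewrite lee_fin.
  rewrite lee_fin; apply: le_powR; [exact: ltW|exact: P0|exact: partial_normS].
apply: lq_norm_le.
  by rewrite mule_ge0 ?lee_fin ?invr_ge0//; apply: le_trans (uB 0%N).
by move=> N; rewrite lee_pdivlMl// muleC; exact: uB.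
Qed.

End vector_valued.

Theorem theorem17 (R : realType) (n : nat) (n_gt0 : (0 < n)%N)
    (X : set (euclid R n -> R)) (T : (euclid R n -> R) -> euclid R n -> R)
    (opT : operator_on X T) (DT : condition_D X T)
    (p eps : R) (p_gt0 : (0 < p)%R) (eps_gt0 : (0 < eps)%R)
    (w : euclid R n -> R) (wC : Cp_weight (Num.max 1 p + eps)%R w) :
  (exists c : R, (0 < c)%R /\
     forall f, X f ->
       weighted_norm p w (EFin \o T f) <=
       c%:E * weighted_norm p w (maximal (EFin \o f)))
  /\
  (forall q : R, (1 < q)%R -> condition_Dq q X T ->
     exists c : R, (0 < c)%R /\
       forall f : nat -> euclid R n -> R, (forall j, X (f j)) ->
         weighted_norm p w (lq_norm q (fun j => T (f j))) <=
         c%:E * weighted_norm p w (maximal (lq_norm q f))).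
Proof.
split; first exact: scalar_bound p_gt0 eps_gt0 wC.
by move=> q q1; exact: vector_bound p_gt0 eps_gt0 wC q q1.
Qed.
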